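(* Let $f\in L^2(\Omega)$, $\boldsymbol F\in L^2(\Omega)^d$, and let $\overline u\in H^1_0(\Omega)$ be the solution of $$\forall \varphi\in H^1_0(\Omega),\quad \int_\Omega \nabla\overline u\cdot\nabla\varphi\,\mathrm dx=\int_\Omega (f\varphi-\boldsymbol F\cdot\nabla\varphi)\,\mathrm dx$$ (so that $\nabla\overline u+\boldsymbol F\in \boldsymbol H_{\rm div}(\Omega)$ with $-\mathrm{div}(\nabla\overline u+\boldsymbol F)=f$ a.e. in $\Omega$). Let $\mathcal T$ be an admissible mesh of $\Omega$ and let $u\in X_{\mathcal T}$ be the solution of the finite volume scheme $$\forall v\in X_{\mathcal T},\quad d\int_\Omega G_{\mathcal T}u\,G_{\mathcal T}v\,\mathrm dx=\int_\Omega (f v-\boldsymbol F\cdot\nabla_{\mathcal T}v)\,\mathrm dx .$$ Then $$\frac12\Big(\zeta_{\mathcal T}(\nabla\overline u+\boldsymbol F)+\mathcal I_{\mathcal T}(\overline u)\Big)\le \delta_{\mathcal T}(\overline u,u)\le 3\Big(\zeta_{\mathcal T}(\nabla\overline u+\boldsymbol F)+\mathcal I_{\mathcal T}(\overline u)\Big).$$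
   Context: Let $d\in\{2,3\}$ and let $\Omega\subset\mathbb R^d$ be a bounded open polytopal domain (polygonal if $d=2$, polyhedral if $d=3$). $|A|$ denotes the $d$- or $(d-1)$-dimensional measure of $A$, as appropriate. Admissible mesh. An admissible mesh $\mathcal T$ of $\Omega$ consists of: a finite family (also denoted $\mathcal T$) of disjoint open polytopal convex subsets of $\Omega$ (control volumes); a finite family $\mathcal E$ of disjoint subsets of $\overline\Omega$ contained in hyperplanes of $\mathbb R^d$, with strictly positive $(d-1)$-dimensional measure (the edges or faces); and a family of points $(x_K)_{K\in\mathcal T}$; such that: (i) the closure of the union of all control volumes is $\overline\Omega$; (ii) for each $K\in\mathcal T$ there is $\mathcal E_K\subset\mathcal E$ with $\partial K=\overline K\setminus K=\bigcup_{\sigma\in\mathcal E_K}\overline\sigma$, and $\mathcal E=\bigcup_{K}\mathcal E_K$; (iii) $x_K\in K$ for all $K\in\mathcal T$; (iv) $\mathcal E$ is partitioned into $\mathcal E_{\rm ext}\cup\mathcal E_{\rm int}$: if $\sigma\in\mathcal E_{\rm ext}$, there is exactly one $K\in\mathcal T$ with $\sigma\in\mathcal E_K$, $\sigma\subset\partial\Omega$, and the straight line through $x_K$ orthogonal to $\sigma$ intersects $\sigma$; if $\sigma\in\mathcal E_{\rm int}$, there are exactly two elements $K,L$ of $\mathcal T$ with $\sigma\in\mathcal E_K\cap\mathcal E_L$, $\partial K\cap\partial L=\overline\sigma$, and the straight line through $x_K$ and $x_L$ is orthogonal to $\sigma$ (this line is not required to meet $\overline\sigma$). For $K\in\mathcal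 T$, $\sigma\in\mathcal E_K$: $d_{K,\sigma}>0$ is the orthogonal distance from $x_K$ to (the hyperplane containing) $\sigma$; $D_{K,\sigma}$ is the cone with vertex $x_K$ and basis $\sigma$, so $|D_{K,\sigma}|=|\sigma|d_{K,\sigma}/d$; $\boldsymbol n_{K,\sigma}$ is the unit normal to $\sigma$ outward to $K$. Discrete space and operators. $X_{\mathcal T}$ is the set of real families $u=((u_K)_{K\in\mathcal T},(u_\sigma)_{\sigma\in\mathcal E})$ with $u_\sigma=0$ for $\sigma\in\mathcal E_{\rm ext}$; $u$ also denotes the function in $L^2(\Omega)$ equal to $u_K$ a.e. in each $K$. For $u\in X_{\mathcal T}$ and a.e. $x\in D_{K,\sigma}$, $$G_{\mathcal T}u(x)=\frac{u_\sigma-u_K}{d_{K,\sigma}},\qquad \nabla_{\mathcal T}u(x)=d\,\frac{u_\sigma-u_K}{d_{K,\sigma}}\boldsymbol n_{K,\sigma}.$$ Norm on $X_{\mathcal T}$: $\|u\|_{\mathcal T}^2=d\|G_{\mathcal T}u\|_{L^2(\Omega)}^2$. $\boldsymbol H_{\rm div}(\Omega)=\{\boldsymbol\varphi\in L^2(\Omega)^d:\ \mathrm{div}\boldsymbol\varphi\in L^2(\Omega)\}$. Conformity error: for $\boldsymbol\varphi\in\boldsymbol H_{\rm div}(\Omega)$, $$\zeta_{\mathcal T}(\boldsymbol\varphi)=\sup\Big\{\int_\Omega(\mathrm{div}\boldsymbol\varphi\, v+\boldsymbol\varphi\cdot\nabla_{\mathcal T}v)\,\mathrm dx:\ v\in X_{\mathcal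 T},\ \|v\|_{\mathcal T}=1\Big\}.$$ Mean normal gradient: for $\varphi\in H^1_0(\Omega)$, $\mathcal G_{\mathcal T}\varphi\in L^2(\Omega)$ is equal a.e. in $D_{K,\sigma}$ to $\frac1{|D_{K,\sigma}|}\int_{D_{K,\sigma}}\nabla\varphi(y)\cdot\boldsymbol n_{K,\sigma}\,\mathrm dy$. For $\varphi\in H^1_0(\Omega)$ and $v\in X_{\mathcal T}$, $$\delta_{\mathcal T}(\varphi,v)=\frac1{\mathrm{diam}(\Omega)}\|\varphi-v\|_{L^2(\Omega)}+\sqrt d\,\|\mathcal G_{\mathcal T}\varphi-G_{\mathcal T}v\|_{L^2(\Omega)},\qquad \mathcal I_{\mathcal T}(\varphi)=\inf_{v\in X_{\mathcal T}}\delta_{\mathcal T}(\varphi,v).$$ *)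

(* Defs.v *)
From HB Require Import structures.
From mathcomp Require Import all_boot all_order all_algebra.
From mathcomp Require Import all_classical all_reals all_analysis.

Set Implicit Arguments.
Unset Strict Implicit.
Unset Printing Implicit Defensive.
Import Order.TTheory GRing.Theory Num.Theory.
Import numFieldNormedType.Exports.

Local Open Scope classical_set_scope.
Local Open Scope ring_scope.

Definition measure_rV_display : measure_display.
Proof. exact: default_measure_display. Qed.

(* As for [n.-tuple]: the product sigma-algebra, i.e. the Borel sets of R^n. *)
Section measurable_rV.
Context (R : realType) (n : nat).

Definition rV_coord (i : 'I_n) (x : 'rV[R]_n) : R := x ord0 i.

Let rV_set0 : g_sigma_preimage rV_coord set0.
Proof. exact: sigma_algebra0. Qed.

Let rV_setC A : g_sigma_preimage rV_coord A -> g_sigma_preimage rV_coord (~` A).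
Proof. exact: sigma_algebraC. Qed.

Let rV_bigcup (F : _^nat) : (forall i, g_sigma_preimage rV_coord (F i)) ->
  g_sigma_preimage rV_coord (\bigcup_i (F i)).
Proof. exact: sigma_algebra_bigcup. Qed.

HB.instance Definition _ := @isMeasurable.Build measure_rV_display
  'rV[R]_n (g_sigma_preimage rV_coord) rV_set0 rV_setC rV_bigcup.

End measurable_rV.

Section measurable_rV_lemmas.
Context (R : realType).

Lemma measurable_rV_coord n (i : 'I_n) :
  measurable_fun [set: 'rV[R]_n] (@rV_coord R n i).
Proof.
move=> _ Y mY; rewrite setTI; apply: sub_sigma_algebra => /=.
rewrite -bigcup_seq/=; exists i => /=; first by rewrite mem_index_enum.
by exists Y => //; rewrite setTI.
Qed.

Lemma measurable_fun_rVP d (T : measurableType d) n (f : T -> 'rV[R]_n) :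
  (forall i, measurable_fun [set: T] (@rV_coord R n i \o f)) ->
  measurable_fun [set: T] f.
Proof.
move=> mf _ A mA; rewrite setTI.
have : preimage_set_system [set: T] f (g_sigma_preimage (@rV_coord R n))
    (f @^-1` A) by exists A => //; rewrite setTI.
rewrite -g_sigma_preimage_comp; apply: smallest_sub.
  exact: sigma_algebra_measurable.
rewrite -bigcup_seq/=; apply: bigcup_sub => i _.
by move=> B [C mC <-]; exact: mf.
Qed.

Definition rV_cons n (p : R * 'rV[R]_n) : 'rV[R]_n.+1 :=
  row_mx (p.1)%:M p.2 : 'rV[R]_(1 + n).

Definition rV_uncons n (x : 'rV[R]_n.+1) : R * 'rV[R]_n :=
  (x ord0 ord0, \row_i x ord0 (lift ord0 i)).

Lemma rV_consK n : cancel (@rV_uncons n) (@rV_cons n).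
Proof.
move=> x; apply/rowP => i; rewrite /rV_cons /rV_uncons mxE.
case: splitP => j ij; rewrite mxE /=.
  rewrite [j]ord1 mulr1n; congr (x _ _).
  by apply: val_inj; rewrite /= ij [j]ord1.
by congr (x _ _); apply: val_inj; rewrite /= ij.
Qed.

Lemma rV_unconsK n : cancel (@rV_cons n) (@rV_uncons n).
Proof.
move=> [a y]; rewrite /rV_uncons /rV_cons; congr pair.
  by rewrite mxE; case: splitP => // j _; rewrite mxE [j]ord1.
apply/rowP => i; rewrite !mxE; case: splitP => j /= => [ij|[ij]].
  by have := ltn_ord j; rewrite -ij.
by congr (y _ _); apply: val_inj.
Qed.

Lemma measurable_rV_cons n : measurable_fun [set: R * 'rV[R]_n] (@rV_cons n).
Proof.
apply: measurable_fun_rVP => i; rewrite /comp /rV_coord /rV_cons.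
under eq_fun do rewrite mxE.
case: (splitP (i : 'I_(1 + n))) => j ij.
  under eq_fun do rewrite mxE [j]ord1 mulr1n.
  exact: measurable_fst.
by apply: (measurableT_comp (measurable_rV_coord j)); exact: measurable_snd.
Qed.

Lemma measurable_rV_uncons n :
  measurable_fun [set: 'rV[R]_n.+1] (@rV_uncons n).
Proof.
apply/measurable_fun_pair => /=; first exact: measurable_rV_coord.
apply: measurable_fun_rVP => i; rewrite /comp /rV_coord.
under eq_fun do rewrite mxE.
exact: measurable_rV_coord.
Qed.

End measurable_rV_lemmas.

Section lebesgue_rV_step.
Context (R : realType) (n : nat).
Variable m : {sigma_finite_measure set 'rV[R]_n -> \bar R}.

Definition leb_step : set 'rV[R]_n.+1 -> \bar R :=
  pushforward (@lebesgue_measure R \x m)%E (@rV_cons R n).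

Let leb_step0 : leb_step set0 = 0%E.
Proof. by rewrite /leb_step /pushforward preimage_set0 measure0. Qed.

Let leb_step_ge0 A : (0 <= leb_step A)%E.
Proof. by rewrite /leb_step /pushforward measure_ge0. Qed.

Let leb_step_sigma_additive : semi_sigma_additive leb_step.
Proof.
move=> F mF tF mUF.
have mpre A : measurable A -> measurable (@rV_cons R n @^-1` A).
  by move=> mA; rewrite -[X in measurable X]setTI; exact: measurable_rV_cons.
rewrite /leb_step /pushforward preimage_bigcup.
apply: measure_semi_sigma_additive => [i||].
- exact: mpre.
- apply/trivIsetP => /= i j _ _ ij; rewrite -preimage_setI.
  by move/trivIsetP : tF => /(_ _ _ _ _ ij) ->//; rewrite preimage_set0.
- by rewrite -preimage_bigcup; exact: mpre.
Qed.

HB.instance Definition _ := isMeasure.Build _ _ _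
  leb_step leb_step0 leb_step_ge0 leb_step_sigma_additive.

Let leb_step_sigma_finite : sigma_finite setT leb_step.
Proof.
have /sigma_finiteP[F [TF ndF Foo]] := sigma_finiteT (@lebesgue_measure R).
have /sigma_finiteP[G [TG ndG Goo]] := sigma_finiteT m.
exists (fun i => @rV_uncons R n @^-1` (F i `*` G i)).
  rewrite -preimage_bigcup (_ : \bigcup_i _ = setT) ?preimage_setT//.
  rewrite -setXTT TF TG predeqE => -[x y]; split.
    by move=> [i _ []/= ? ?]; split; exists i.
  move=> [/= [i _ Fix] [k _ Gky]]; exists (maxn i k) => //; split.
  - by move: x Fix; exact/subsetPset/ndF/leq_maxl.
  - by move: y Gky; exact/subsetPset/ndG/leq_maxr.
move=> i; have [mF Fi] := Foo i; have [mG Gi] := Goo i; split.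
  rewrite -[X in measurable X]setTI; apply: measurable_rV_uncons => //.
  exact: measurableX.
rewrite /leb_step /pushforward (_ : _ @^-1` _ = F i `*` G i).
  by rewrite product_measure1E// lte_mul_pinfty// ge0_fin_numE.
by rewrite -comp_preimage (_ : _ \o _ = id)//; apply/funext; exact: rV_unconsK.
Qed.

HB.instance Definition _ := Measure_isSigmaFinite.Build _ _ _ leb_step
  leb_step_sigma_finite.

End lebesgue_rV_step.

(* Lebesgue measure on R^n, as an iterated product of the one on R. *)
Fixpoint leb (R : realType) (n : nat) :
    {sigma_finite_measure set 'rV[R]_n -> \bar R} :=
  if n is n'.+1 then leb_step (leb R n') else \d_(0 : 'rV[R]_0).

Section euclidean.
Context (R : realType) (d : nat).
Local Notation E := 'rV[R]_d.
Implicit Types (x y n : E) (A P Omega : set E).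

Definition dotv x y : R := \sum_(i < d) x ord0 i * y ord0 i.

(* The library norm on matrices is the sup norm. *)
Definition enorm x : R := Num.sqrt (dotv x x).

Definition diam A : R := sup [set enorm (x - y) | x in A & y in A].

Definition bdry A : set E := closure A `\` A°.

Definition hyperplane n (c : R) : set E := [set x | dotv n x = c].

Definition open_polytope P := bounded_set P /\
  exists (m : nat) (a : 'I_m -> E) (b : 'I_m -> R),
    P = [set x | forall i, dotv (a i) x < b i].

Definition closed_polytope P := bounded_set P /\
  exists (m : nat) (a : 'I_m -> E) (b : 'I_m -> R),
    P = [set x | forall i, dotv (a i) x <= b i].

(* Boundedness, openness, and a boundary made of finitely many flat pieces;
   slits and non-connected sets are allowed. *)
Definition polytopal_domain Omega :=
  [/\ bounded_set Omega, open Omega, Omega !=set0 &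
    exists (m : nat) (P : 'I_m -> set E),
      bdry Omega = \bigcup_i P i /\
      forall i, closed_polytope (P i) /\
        exists n c, n != 0 /\ P i `<=` hyperplane n c].

(* (d-1)-dimensional Lebesgue measure of a subset A of [hyperplane n c], n a
   unit vector: A is read in the isometric parametrisation s |-> c n + s B of
   the hyperplane, the rows of B being an orthonormal basis of the orthogonal
   of n. By rotation invariance the value does not depend on B. *)
Definition hyperplane_measure n (c : R) A : \bar R :=
  let B := xget 0 [set B : 'M[R]_(d.-1, d) | B *m B^T = 1%:M /\ n *m B^T = 0] in
  leb R d.-1 [set s : 'rV[R]_d.-1 | A (c *: n + s *m B)].

End euclidean.

Section function_spaces.
Context (R : realType) (d : nat) (Omega : set 'rV[R]_d).
Local Notation E := 'rV[R]_d.
Local Notation mu := (leb R d).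
Implicit Types (u f : E -> R) (F g : E -> E).

(* Functions are represented by Borel functions on the whole of R^d of which
   only the restriction to Omega matters. *)
Definition L2 : set (E -> R) := [set u | u \_ Omega \in Lfun mu 2%:E].

Definition L2norm u : R := fine ('N[mu]_2%:E[EFin \o (u \_ Omega)])%E.

Definition L2v : set (E -> E) := [set g | forall i, L2 (fun x => g x ord0 i)].

Definition L2vnorm g : R := L2norm (fun x => enorm (g x)).

Definition partial (i : 'I_d) u : E -> R := 'D_(delta_mx ord0 i) u.

Fixpoint Ck (k : nat) u : Prop :=
  continuous u /\
  if k is k'.+1 then
    forall i, (forall x, derivable u x (delta_mx ord0 i)) /\ Ck k' (partial i u)
  else True.

Definition Cc_infty : set (E -> R) := [set u |
  [/\ forall k, Ck k u,
      compact (closure [set x | u x != 0]) &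
      closure [set x | u x != 0] `<=` Omega]].

Definition grad u : E -> E := fun x => \row_i partial i u x.

Definition is_weak_grad u g := forall psi, Cc_infty psi -> forall i,
  \int[mu]_(x in Omega) (u x * partial i psi x) =
  - \int[mu]_(x in Omega) (g x ord0 i * psi x).

Definition is_weak_div g f := forall psi, Cc_infty psi ->
  \int[mu]_(x in Omega) (dotv (g x) (grad psi x)) =
  - \int[mu]_(x in Omega) (f x * psi x).

(* The weak gradient and divergence are only determined almost everywhere;
   a representative is chosen. *)
Definition wgrad u : E -> E := xget 0 [set g | L2v g /\ is_weak_grad u g].

Definition wdiv g : E -> R := xget 0 [set f | L2 f /\ is_weak_div g f].

Definition H1 : set (E -> R) :=
  [set u | L2 u /\ exists g, L2v g /\ is_weak_grad u g].

Definition H10 : set (E -> R) := [set u | H1 u /\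
  forall e, 0 < e -> exists psi, [/\ Cc_infty psi,
    L2norm (u \- psi) < e & L2vnorm (wgrad u \- grad psi) < e]].

Definition Hdiv : set (E -> E) :=
  [set g | L2v g /\ exists f, L2 f /\ is_weak_div g f].

End function_spaces.

Section mesh.
Context (R : realType) (d : nat) (Omega : set 'rV[R]_d).
Local Notation E := 'rV[R]_d.
Local Notation mu := (leb R d).

Record admissible_mesh := AdmissibleMesh {
  cell : finType;
  edge : finType;
  vol : cell -> set E;
  face : edge -> set E;
  center : cell -> E;
  edges_of : cell -> {set edge};
  ext : {set edge};
  (* [hyperplane (nrm s) (off s)] is the hyperplane containing s *)
  nrm : edge -> E;
  off : edge -> R;
  vol_polytope : forall K, open_polytope (vol K);
  vol_sub : forall K, vol K `<=` Omega;
  vol_disjoint : trivIset setT vol;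
  face_sub : forall s, face s `<=` closure Omega;
  face_disjoint : trivIset setT face;
  nrm_unit : forall s, enorm (nrm s) = 1;
  face_hyperplane : forall s, face s `<=` hyperplane (nrm s) (off s);
  face_measurable : forall s, measurable (face s);
  face_gt0 : forall s, (0 < hyperplane_measure (nrm s) (off s) (face s))%E;
  (* a face and its closure have the same measure; without this the cones
     [cone K s] would not cover Omega up to a null set *)
  face_closure : forall s,
    hyperplane_measure (nrm s) (off s) (closure (face s) `\` face s) = 0%E;
  vol_closure : closure (\bigcup_K vol K) = closure Omega;
  vol_bdry : forall K,
    closure (vol K) `\` vol K = \bigcup_(s in [set` edges_of K]) closure (face s);
  edges_of_cover : forall s, exists K, s \in edges_of K;
  center_in : forall K, vol K (center K);
  ext_face : forall s, s \in ext -> exists K,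
    [/\ [set L | s \in edges_of L]%SET = [set K]%SET,
        face s `<=` bdry Omega &
        exists t, face s (center K + t *: nrm s)];
  int_face : forall s, s \notin ext -> exists K L,
    [/\ K != L,
        [set M | s \in edges_of M]%SET = [set K; L]%SET,
        bdry (vol K) `&` bdry (vol L) = closure (face s) &
        exists t, center L - center K = t *: nrm s]
}.

Variable T : admissible_mesh.
Implicit Types (K : cell T) (s : edge T).

Definition dist_face K s : R := `|dotv (nrm s) (center K) - off s|.

(* K is convex, hence lies on the same side of the face as its center. *)
Definition out_normal K s : E :=
  Num.sg (off s - dotv (nrm s) (center K)) *: nrm s.

Definition cone K s : set E :=
  [set center K + t *: (y - center K) | t in `]0, 1[ & y in face s].

Definition dofs : Type := (cell T -> R) * (edge T -> R).

Definition XT : set dofs := [set v | forall s, s \in ext T -> v.2 s = 0].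

Implicit Types v : dofs.

Definition fun_of v : E -> R := fun x => \sum_K v.1 K * \1_(vol K) x.

Definition GT v : E -> R := fun x =>
  \sum_K \sum_(s in edges_of K)
    (v.2 s - v.1 K) / dist_face K s * \1_(cone K s) x.

Definition gradT v : E -> E := fun x =>
  \sum_K \sum_(s in edges_of K)
    (d%:R * ((v.2 s - v.1 K) / dist_face K s) * \1_(cone K s) x) *: out_normal K s.

Definition normT v : R := Num.sqrt (d%:R * L2norm Omega (GT v) ^+ 2).

Definition meanGT (phi : E -> R) : E -> R := fun x =>
  \sum_K \sum_(s in edges_of K)
    (fine (mu (cone K s)))^-1 *
    (\int[mu]_(y in cone K s) dotv (wgrad Omega phi y) (out_normal K s)) *
    \1_(cone K s) x.

Definition zetaT (phi : E -> E) : R :=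
  sup [set \int[mu]_(x in Omega)
         (wdiv Omega phi x * fun_of v x + dotv (phi x) (gradT v x)) |
       v in [set v | XT v /\ normT v = 1]].

Definition deltaT (phi : E -> R) v : R :=
  (diam Omega)^-1 * L2norm Omega (phi \- fun_of v) +
  Num.sqrt d%:R * L2norm Omega (meanGT phi \- GT v).

Definition interpT (phi : E -> R) : R := inf [set deltaT phi v | v in XT].

End mesh.

(* Main.v *)
(* Testing the weak formulation with smooth compactly supported functions gives
   div (grad ubar + F) = - f. By the scheme, the quantity whose supremum is zeta
   then equals, for every discrete v,
     r(v) = d \int (G ubar - G_T u) G_T v,
   where G ubar is the mean normal gradient: on each cone grad ubar is integrated
   against a constant vector. Cauchy-Schwarz bounds zeta by the flux part of
   delta(ubar, u), which is the lower bound. For the upper bound take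
   w = v - u: since |w|^2 = r(w) - d \int (G ubar - G_T v) G_T w, one gets
   |w| <= zeta + sqrt d |G ubar - G_T v|. The discrete Poincare inequality
   |w|_{L2} <= diam(Omega) |w| gives
   delta(ubar, u) <= delta(ubar, v) + 2 |w| <= 3 delta(ubar, v) + 2 zeta.

   The Poincare inequality is proved by following, from almost every point of a
   cell, the ray parallel to the first axis until it leaves Omega: w telescopes
   along the faces crossed, the distances sum to at most diam(Omega), and
   integrating over the ray origins turns each crossed face into its cones. *)

Require Import Defs.
From mathcomp Require Import all_boot all_order all_algebra.
From mathcomp Require Import all_classical all_reals all_analysis.
From mathcomp Require Import measurable_realfun.
From mathcomp Require Import ring lra.

Set Implicit Arguments.
Unset Strict Implicit.
Unset Printing Implicit Defensive.
Import Order.TTheory GRing.Theory Num.Theory.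
Import numFieldNormedType.Exports.

Local Open Scope classical_set_scope.
Local Open Scope ring_scope.

(** * Borel structure and Lebesgue measure of R^n *)

(** What telescopes along a ray is the first coordinate of the cell centres, not the position on the
    ray. The two cells at a crossed interior face lie on opposite sides of its hyperplane, so their
    two distances to it add up to the distance of the centres along the normal; times the absolute
    value of the first component of the normal, this is the increment of the first coordinate from
    one centre to the next. Hence the line of centres may miss the face. Only the last, exterior
    face uses the orthogonal foot of a centre: it lies in the face, so the total is a difference of
    coordinates of two points of the closure of [Omega].

    Values of the surface measure are never compared between parametrisations. Cones and sets of ray
    origins are both computed from the Lebesgue measure of the projection of a face along the first
    axis, a factor that cancels. Surface measure intervenes only through positivity, which makes a
    face span a facet of its cell, and through nullity of relative boundaries; nullity passes
    through affine bijections with no Jacobian to compute. *)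

Lemma negligible_bigcup_fin d (U : measurableType d) (R : realType)
    (mu : {measure set U -> \bar R}) (I : finType) (F : I -> set U) :
  (forall i, mu.-negligible (F i)) -> mu.-negligible (\bigcup_i F i).
Proof.
move=> hF.
pose G k := if onth (enum I) k is Some i then F i else set0.
apply: (@negligibleS _ _ _ _ (\bigcup_k G k)); last first.
  apply: negligible_bigcup => k; rewrite /G; case: (onth _ _) => [i|] //.
  exact: negligible_set0.
move=> x [i _ Fix]; exists (index i (enum I)) => //.
rewrite /G (_ : onth _ _ = Some i)//.
by rewrite onthE (nth_map i) ?index_mem ?mem_enum// nth_index ?mem_enum.
Qed.

Section rV_measurability.
Context (R : realType).

Lemma rV_ballP n (x y : 'rV[R]_n) (e : R) : 0 < e ->
  ball x e y <-> forall i, `|x ord0 i - y ord0 i| < e.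
Proof.
move=> e0; split=> [[_ h] i|h]; first exact: h.
by split=> // i j; rewrite [i]ord1; exact: h.
Qed.

Lemma measurable_rV_ball n (x : 'rV[R]_n) (e : R) : measurable (ball x e).
Proof.
have [e0|e0] := leP e 0.
  rewrite (_ : ball x e = set0)//; apply/seteqP; split=> // y [].
  by rewrite ltNge e0.
rewrite (_ : ball x e = \bigcap_(i in setT) (@rV_coord R n i @^-1` ball (x ord0 i) e)).
  apply: fin_bigcap_measurable => // i _; rewrite -[X in measurable X]setTI.
  apply: measurable_rV_coord => //; exact: open_measurable (ball_open _ _).
apply/seteqP; split=> y.
  by move=> /rV_ballP xy i _; exact: xy.
by move=> xy; apply/rV_ballP => // i; exact: xy.
Qed.

Definition rat_center n (p : 'rV[rat]_n * nat) : 'rV[R]_n := map_mx ratr p.1.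

Definition rat_radius n (p : 'rV[rat]_n * nat) : R := p.2.+1%:R^-1.

Lemma rat_radius_gt0 n (p : 'rV[rat]_n * nat) : 0 < rat_radius p.
Proof. by rewrite invr_gt0. Qed.

(** The doubled radius leaves room in [U] for the closed boxes contained in the closure of the ball,
    as [integral_ball_eq0] requires. *)
Lemma open_rat_ball n (U : set 'rV[R]_n) x : open U -> U x ->
  exists p : 'rV[rat]_n * nat, ball (rat_center p) (rat_radius p) x /\
    ball (rat_center p) (rat_radius p *+ 2) `<=` U.
Proof.
move=> oU Ux.
have := oU; rewrite openE => /(_ x Ux) /nbhs_ballP[e /= e0 xeU].
(* One radius separates [x] from the rational centre and two more reach the edge of the doubled
   ball, hence [e / 3]. *)
have [k ke] : exists k : nat, k.+1%:R^-1 < e / 3.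
  have [k _ /(_ k (leqnn _)) /=] := near_infty_natSinv_lt (PosNum (divr_gt0 e0 (ltr0n _ 3))).
  by exists k.
have k0 : 0 < k.+1%:R^-1 :> R by rewrite invr_gt0.
have hq i : exists q : rat, `|ratr q - x ord0 i| < k.+1%:R^-1 :> R.
  have : x ord0 i - k.+1%:R^-1 < x ord0 i + k.+1%:R^-1 by rewrite ltrD2l gtrN.
  by move=> /rat_in_itvoo[q]; rewrite in_itv/= => qx; exists q; rewrite ltr_distl.
pose q := \row_i sval (cid (hq i)).
have xq : ball (map_mx ratr q : 'rV[R]_n) k.+1%:R^-1 x.
  by apply/rV_ballP => // i; rewrite !mxE; case: cid.
exists (q, k); split=> // y qy; apply: xeU.
apply: (@le_ball _ _ _ (k.+1%:R^-1 + k.+1%:R^-1 *+ 2)).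
  by rewrite mulr2n; move: ke; set r := _^-1; lra.
by apply: ball_triangle qy; exact: ball_sym.
Qed.

Lemma open_measurable_rV n (U : set 'rV[R]_n) : open U -> measurable U.
Proof.
move=> oU.
pose B (p : 'rV[rat]_n * nat) := ball (rat_center p) (rat_radius p).
rewrite (_ : U = \bigcup_p (if `[< B p `<=` U >] then B p else set0)).
  apply: countable_bigcupT_measurable => // p.
  by case: ifP => // _; exact: measurable_rV_ball.
apply/seteqP; split=> [x Ux|x [p _]]; last first.
  by case: asboolP => // + Bx; apply.
have [p [px pU]] := open_rat_ball oU Ux; exists p => //.
rewrite ifT//; apply/asboolP; apply: subset_trans pU; apply: le_ball.
by rewrite mulr2n lerDl ltW// rat_radius_gt0.
Qed.

Lemma closed_measurable_rV n (U : set 'rV[R]_n) : closed U -> measurable U.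
Proof.
by move=> cU; rewrite -[U]setCK; apply: measurableC; apply: open_measurable_rV; exact: closed_openC.
Qed.

Lemma continuous_measurable_rV n (f : 'rV[R]_n -> R) :
  continuous f -> measurable_fun setT f.
Proof.
move=> cf; apply: (measurability _ (RGenOpens.measurableE R)) => _ [_ [a [b ->]] <-].
rewrite setTI; apply: open_measurable_rV; move: cf => /continuousP; apply.
exact: interval_open.
Qed.

Lemma measurable_dotv n (a : 'rV[R]_n) : measurable_fun setT (dotv a).
Proof.
apply: measurable_sum => i; apply: measurable_funM => //.
exact: measurable_rV_coord.
Qed.

Lemma rV_cons0 n (s : R) (y : 'rV[R]_n) : rV_cons (s, y) ord0 ord0 = s.
Proof. by have [] := @rV_unconsK R n (s, y). Qed.

Lemma rV_consS n (s : R) (y : 'rV[R]_n) i :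
  rV_cons (s, y) ord0 (lift ord0 i) = y ord0 i.
Proof. by have [_ /rowP/(_ i)] := @rV_unconsK R n (s, y); rewrite mxE. Qed.

Lemma rV_consP n (x : 'rV[R]_n.+1) : exists s y, x = rV_cons (s, y).
Proof. by exists (rV_uncons x).1, (rV_uncons x).2; rewrite -[LHS](@rV_consK R n). Qed.

End rV_measurability.

(** * Slicing along the first axis and affine changes of variables *)

Lemma ge0_integral_comp_scaled d1 d2 (X : measurableType d1) (Y : measurableType d2)
    (R : realType) (mu : {measure set X -> \bar R}) (nu : {measure set Y -> \bar R})
    (phi : X -> Y) (r : R) (g : Y -> \bar R) :
  0 <= r -> measurable_fun setT phi ->
  (forall A, measurable A -> mu (phi @^-1` A) = (r%:E * nu A)%E) ->
  measurable_fun setT g -> (forall y, (0 <= g y)%E) ->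
  (\int[mu]_x g (phi x) = r%:E * \int[nu]_y g y)%E.
Proof.
move=> r0 mphi hphi mg g0.
rewrite -(ge0_integral_mscale nu measurableT (NngNum r0))//.
rewrite -[LHS](ge0_integral_pushforward mphi mu (f:=g) measurableT)//.
by apply: eq_measure_integral => A mA _; exact: hphi.
Qed.

Section leb_fubini.
Context (R : realType).

Definition rV_slice n (A : set 'rV[R]_n.+1) (y : 'rV[R]_n) : set R :=
  [set s | A (rV_cons (s, y))].

Lemma measurable_rV_consV n (A : set 'rV[R]_n.+1) :
  measurable A -> measurable (@rV_cons R n @^-1` A).
Proof.
by move=> mA; rewrite -[X in measurable X]setTI; exact: measurable_rV_cons.
Qed.

Lemma measurable_rV_slice n (A : set 'rV[R]_n.+1) y :
  measurable A -> measurable (rV_slice A y).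
Proof.
move=> mA; rewrite (_ : rV_slice A y = ysection (@rV_cons R n @^-1` A) y).
  by apply: measurable_ysection; exact: measurable_rV_consV.
by rewrite ysectionE.
Qed.

Lemma measurable_fun_rV_slice n (A : set 'rV[R]_n.+1) : measurable A ->
  measurable_fun setT (fun y => lebesgue_measure (rV_slice A y)).
Proof.
move=> mA; have := measurable_fun_ysection (@lebesgue_measure R) (measurable_rV_consV mA).
apply: eq_measurable_fun => y _ /=; by rewrite ysectionE.
Qed.

Lemma leb_slice n (A : set 'rV[R]_n.+1) : measurable A ->
  (leb R n.+1 A = \int[leb R n]_y lebesgue_measure (rV_slice A y))%E.
Proof.
move=> mA; rewrite /= /leb_step /pushforward.
rewrite (product_measure_unique (m' := (lebesgue_measure \x^ (leb R n))%E))//.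
- by apply: eq_integral => y _ /=; rewrite ysectionE.
- by move=> B C mB mC; exact: product_measure2E.
- exact: measurable_rV_consV.
Qed.

Lemma leb_slice2 n (A : set 'rV[R]_n.+1) : measurable A ->
  (leb R n.+1 A = \int[lebesgue_measure]_s leb R n [set y | A (rV_cons (s, y))])%E.
Proof.
move=> mA; rewrite /= /leb_step /pushforward /product_measure1.
by apply: eq_integral => y _ /=; rewrite xsectionE.
Qed.

End leb_fubini.

Section affine_change.
Context (R : realType).

(** By uniqueness of Lebesgue measure it is enough to compare the rescaled pushforward with it on
    the intervals []x, y]]. A negative [k] turns their preimages into intervals [[u, v[], whose
    length obeys the same formula. *)
Lemma lebesgue_measure_affine (a k : R) (A : set R) : k != 0 -> measurable A ->
  (lebesgue_measure ((fun s => a + k * s)%R @^-1` A) =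
   `|k|^-1%:E * lebesgue_measure A)%E.
Proof.
move=> k0 mA.
pose phi (s : measurableTypeR R) : measurableTypeR R := a + k * s.
have mphi : measurable_fun setT phi.
  apply: measurable_funD; first exact: measurable_cst.
  by apply: measurable_funM; [exact: measurable_cst|exact: measurable_id].
have k1 : 0 <= `|k| by [].
pose pphi : {measure set (measurableTypeR R) -> \bar R} :=
  pushforward lebesgue_measure phi.
pose m : {measure set (measurableTypeR R) -> \bar R} := mscale (NngNum k1) (pphi mphi).
have mE B : m B = (`|k|%:E * lebesgue_measure (phi @^-1` B))%E by [].
have := @lebesgue_measure_unique _ m.
move=> /(_ _ A mA) ->; last first.
  move=> X [[x y] _ <-]; rewrite mE /=.
  have -> : phi @^-1` `]x, y]%classic = if 0 < k then `](x - a) / k, (y - a) / k]%classic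
     else `[(y - a) / k, (x - a) / k[%classic.
    apply/seteqP; split=> s /=; rewrite /phi !in_itv/=.
      move=> /andP[xs sy]; case: ifPn => [kp|kn]; rewrite /= in_itv/=.
        by rewrite ltr_pdivrMr// ler_pdivlMr// mulrC; lra.
      have {}kn : k < 0 by rewrite lt_neqAle k0 leNgt.
      by rewrite ltr_ndivlMr// ler_ndivrMr// [s * k]mulrC; lra.
    case: ifPn => [kp|kn]; rewrite /= in_itv/=.
      by rewrite ltr_pdivrMr// ler_pdivlMr// [s * k]mulrC; lra.
    have {}kn : k < 0 by rewrite lt_neqAle k0 leNgt.
    by rewrite ltr_ndivlMr// ler_ndivrMr// [s * k]mulrC; lra.
  case: ifPn => [kp|kn]; rewrite !lebesgue_measure_itv/= !lte_fin.
    rewrite ltr_pM2r ?invr_gt0// ltrD2r; case: ifPn => _; last by rewrite mule0.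
    rewrite -!EFinD -EFinM gtr0_norm//; congr EFin; by field.
  have {}kn : k < 0 by rewrite lt_neqAle k0 leNgt.
  rewrite ltr_nM2r ?invr_lt0// ltrD2r; case: ifPn => _; last by rewrite mule0.
  rewrite -!EFinD -EFinM ltr0_norm//; congr EFin; by field.
rewrite mE muleA -EFinM mulVf ?mul1e//.
by rewrite normr_eq0.
Qed.

Lemma measurable_rV_affine n (a : 'rV[R]_n) (k : R) :
  measurable_fun setT (fun x : 'rV[R]_n => a + k *: x).
Proof.
apply: measurable_fun_rVP => i; rewrite /comp /rV_coord.
under eq_fun do rewrite !mxE.
apply: measurable_funD => //; apply: measurable_funM => //.
exact: measurable_rV_coord.
Qed.

Lemma rV_cons_affine n (a : 'rV[R]_n.+1) (k s : R) (y : 'rV[R]_n) :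
  a + k *: rV_cons (s, y) =
  rV_cons (a ord0 ord0 + k * s, (rV_uncons a).2 + k *: y).
Proof.
rewrite -[LHS](@rV_consK R n); congr rV_cons; rewrite /rV_uncons.
have E := @rV_unconsK R n (s, y); case: E => E1 E2.
congr pair; first by rewrite !mxE -[in RHS]E1 mxE.
by apply/rowP => i; rewrite !mxE -[in RHS]E2 !mxE.
Qed.

(** The map acts separately on the first coordinate and on the others, so slices of the preimage are
    preimages of slices and each dimension contributes one factor [|k|^-1]. *)
Lemma leb_affine n (a : 'rV[R]_n) (k : R) (A : set 'rV[R]_n) :
  k != 0 -> measurable A ->
  (leb R n ((fun x => a + k *: x)%R @^-1` A) = (`|k| ^- n)%:E * leb R n A)%E.
Proof.
move=> k0; elim: n a A => [|n IH] a A mA.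
  rewrite expr0 invr1 mul1e /=; congr (\d_ _ _); apply/seteqP.
  by split=> x /=; rewrite (thinmx0 x) thinmx0.
rewrite !leb_slice//; last first.
  by rewrite -[X in measurable X]setTI; exact: measurable_rV_affine.
pose phi y := lebesgue_measure (rV_slice A y).
transitivity (\int[leb R n]_y (`|k|^-1%:E * phi ((rV_uncons a).2 + k *: y)%R))%E.
  apply: eq_integral => y _; rewrite -(lebesgue_measure_affine (a ord0 ord0))//; last first.
    exact: measurable_rV_slice.
  congr lebesgue_measure; apply/seteqP.
  by split=> s; rewrite /rV_slice/= rV_cons_affine.
have phi0 y : (0 <= phi y)%E by exact: measure_ge0.
have mphi : measurable_fun setT phi by exact: measurable_fun_rV_slice.
rewrite ge0_integralZl//; last first.
  exact: (measurableT_comp mphi (measurable_rV_affine _ _)).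
rewrite (ge0_integral_comp_scaled (r := `|k| ^- n) (nu := leb R n))//.
- by rewrite muleA -EFinM exprS invfM.
- exact: measurable_rV_affine.
- by move=> B mB; exact: IH.
Qed.

Lemma leb_translation n (a : 'rV[R]_n) (A : set 'rV[R]_n) : measurable A ->
  leb R n ((fun x => a + x) @^-1` A) = leb R n A.
Proof.
move=> mA; have := leb_affine a (oner_neq0 R) mA.
rewrite normr1 expr1n invr1 mul1e => <-; congr (leb R n _).
by apply/seteqP; split=> x /=; rewrite scale1r.
Qed.

Lemma integral_translation n (a : 'rV[R]_n) (g : 'rV[R]_n -> \bar R) :
  (leb R n).-integrable setT g ->
  (\int[leb R n]_x g (a + x)%R = \int[leb R n]_x g x)%E.
Proof.
move=> ig.
have mphi : measurable_fun setT (fun x : 'rV[R]_n => a + x).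
  by apply: eq_measurable_fun (measurable_rV_affine a 1) => x _ /=; rewrite scale1r.
have mg := measurable_int _ ig.
have pushE A : measurable A -> A `<=` setT ->
    pushforward (leb R n) (fun x => a + x) A = leb R n A.
  by move=> mA _; exact: leb_translation.
have ig' : (leb R n).-integrable setT (g \o (fun x => a + x)).
  apply/integrableP; split; first exact: (measurableT_comp mg mphi).
  have /integrableP[_] := ig; apply: le_lt_trans.
  rewrite -(ge0_integral_pushforward mphi (leb R n) (f := abse \o g) measurableT); last 2 first.
    - exact: measurableT_comp.
    - by move=> ? _; exact: abse_ge0.
  by rewrite (eq_measure_integral (leb R n)).
rewrite -[LHS](integral_pushforward mphi mg (D:=setT) ig')//.
by apply: eq_measure_integral.
Qed.

End affine_change.

(** * Null sets: linear preimages, points, hyperplanes *)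

Section null_sets.
Context (R : realType).

(** Allows a product with the total mass to be cancelled in [leb_mulmx_null]; any nonzero value,
    infinite or not, will do. *)
Lemma leb_setT_neq0 n : leb R n setT != 0%E.
Proof.
elim: n => [|n IH]; first by rewrite /= diracT gt_eqF ?lte01.
rewrite leb_slice//.
rewrite (eq_integral (cst +oo%E)); last first.
  move=> y _; rewrite /rV_slice (_ : [set s | _] = setT)//.
  by rewrite -set_itvNyy lebesgue_measure_itv.
by rewrite integral_cst// gt0_mulye ?lt0e ?IH ?measure_ge0.
Qed.

Lemma dotvC n (x y : 'rV[R]_n) : dotv x y = dotv y x.
Proof. by apply: eq_bigr => i _; rewrite mulrC. Qed.

Lemma dotvDr n (z x y : 'rV[R]_n) : dotv z (x + y) = dotv z x + dotv z y.
Proof. by rewrite -big_split; apply: eq_bigr => i _; rewrite mxE mulrDr. Qed.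

Lemma dotvNr n (z x : 'rV[R]_n) : dotv z (- x) = - dotv z x.
Proof. by rewrite /dotv -sumrN; apply: eq_bigr => i _; rewrite mxE mulrN. Qed.

Lemma dotvBr n (z x y : 'rV[R]_n) : dotv z (x - y) = dotv z x - dotv z y.
Proof. by rewrite dotvDr dotvNr. Qed.

Lemma dotvZr n (z x : 'rV[R]_n) k : dotv z (k *: x) = k * dotv z x.
Proof. by rewrite /dotv mulr_sumr; apply: eq_bigr => i _; rewrite mxE mulrCA. Qed.

Lemma dotvZl n (z x : 'rV[R]_n) k : dotv (k *: x) z = k * dotv x z.
Proof. by rewrite dotvC dotvZr dotvC. Qed.

Lemma dotv_delta n (z : 'rV[R]_n) i : dotv z (delta_mx 0 i) = z ord0 i.
Proof.
rewrite /dotv (bigD1 i)//= mxE !eqxx mulr1 big1 ?addr0// => j ji.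
by rewrite mxE (negbTE ji) andbF mulr0.
Qed.

Lemma dotvE n (x y : 'rV[R]_n) : dotv x y = (x *m y^T) ord0 ord0.
Proof. by rewrite mxE; apply: eq_bigr => i _; rewrite mxE. Qed.

Lemma measurable_mulmxr m n (M : 'M[R]_(m, n)) :
  measurable_fun setT (fun s : 'rV[R]_m => s *m M).
Proof.
apply: measurable_fun_rVP => i; rewrite /comp /rV_coord.
under eq_fun do rewrite mxE.
apply: measurable_sum => j; apply: measurable_funM => //.
exact: measurable_rV_coord.
Qed.

Lemma measurable_rVD d (T : measurableType d) n (f g : T -> 'rV[R]_n) :
  measurable_fun setT f -> measurable_fun setT g ->
  measurable_fun setT (fun x => f x + g x).
Proof.
move=> mf mg; apply: measurable_fun_rVP => i; rewrite /comp /rV_coord.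
under eq_fun do rewrite mxE.
apply: measurable_funD.
  exact: (measurableT_comp (measurable_rV_coord i) mf).
exact: (measurableT_comp (measurable_rV_coord i) mg).
Qed.

(* Integrate the indicator of [sM + y \in A] over (s, y) in both orders: the
   sections in y are translates of A, and those in s are translates of the
   preimage of A. *)
Lemma leb_mulmx_null m n (M : 'M[R]_(m, n)) (P : 'M[R]_(n, m)) (A : set 'rV[R]_n) :
  P *m M = 1%:M -> measurable A -> leb R n A = 0%E ->
  leb R m [set s | A (s *m M)] = 0%E.
Proof.
move=> PM mA A0.
pose W := [set p : 'rV[R]_m * 'rV[R]_n | A (p.1 *m M + p.2)].
have mW : measurable W.
  rewrite -[W]setTI; apply: measurable_rVD => //.
  exact: (measurableT_comp (measurable_mulmxr M)).
have W0 : (leb R m \x leb R n)%E W = 0%E.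
  rewrite /product_measure1; apply: integral0_eq => s _ /=.
  by rewrite xsectionE -A0; exact: (leb_translation (s *m M) mA).
have mB : measurable [set s | A (s *m M)].
  by rewrite -[X in measurable X]setTI; exact: measurable_mulmxr.
have : (leb R m \x leb R n)%E W = (leb R m [set s | A (s *m M)%R] * leb R n setT)%E.
  rewrite (product_measure_unique (m' := (leb R m \x^ leb R n)%E))//; last first.
    by move=> B C mB' mC; exact: product_measure2E.
  rewrite /= /product_measure2 -integral_cst//; apply: eq_integral => y _ /=.
  rewrite ysectionE -[RHS](leb_translation (y *m P))//; congr (leb R m _).
  apply/seteqP; split=> s /=; rewrite /W /= mulmxDl -mulmxA PM mulmx1.
    by rewrite addrC.
  by rewrite [X in A X]addrC.
rewrite W0 => /esym/eqP; rewrite mule_eq0 (negbTE (leb_setT_neq0 n)) orbF.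
by move=> /eqP.
Qed.

Lemma leb_addmulmx_null m n (a : 'rV[R]_n) (M : 'M[R]_(m, n)) (P : 'M[R]_(n, m))
    (A : set 'rV[R]_n) :
  P *m M = 1%:M -> measurable A -> leb R n A = 0%E ->
  leb R m [set s | A (a + s *m M)] = 0%E.
Proof.
move=> PM mA A0.
apply: (@leb_mulmx_null m n M P [set y | A (a + y)]) => //; last first.
  by rewrite -A0; exact: (leb_translation _ mA).
rewrite -[X in measurable X]setTI; apply: measurable_rVD => //.
Qed.

Lemma measurable_rV_set1 n (c : 'rV[R]_n) : measurable [set c].
Proof.
apply: closed_measurable_rV; apply: accessible_closed_set1.
exact/hausdorff_accessible/norm_hausdorff.
Qed.

Lemma leb1_set1 (c : 'rV[R]_1) : leb R 1 [set c] = 0%E.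
Proof.
rewrite leb_slice; last exact: measurable_rV_set1.
apply: integral0_eq => y _; rewrite -(lebesgue_measure_set1 (c ord0 ord0)).
congr lebesgue_measure; apply/seteqP; split=> s /=.
  by by move=> /rowP/(_ ord0); rewrite rV_cons0.
move=> ->; apply/rowP => i; rewrite [i]ord1.
by rewrite rV_cons0.
Qed.

Lemma dotv_gt0 n (a : 'rV[R]_n) : a != 0 -> 0 < dotv a a.
Proof.
move=> a0; rewrite /dotv lt0r sumr_ge0 ?andbT; last by move=> i _; rewrite -expr2 sqr_ge0.
apply: contra a0; rewrite psumr_eq0; last by move=> i _; rewrite -expr2 sqr_ge0.
move=> /allP h; apply/eqP/rowP => i; rewrite mxE; apply/eqP.
by have := h i (mem_index_enum _); rewrite -expr2 sqrf_eq0.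
Qed.

(** The hyperplane is the preimage of a point of the line under [s |-> s *m a^T], a surjection with
    section [a / |a|^2]. *)
Lemma hyperplane_null n (a : 'rV[R]_n) (c : R) : a != 0 ->
  leb R n (hyperplane a c) = 0%E.
Proof.
move=> a0; rewrite -(_ : [set s | [set (c%:M : 'rV[R]_1)] (s *m a^T)] = hyperplane a c).
  apply: (@leb_mulmx_null n 1 a^T ((dotv a a)^-1 *: a)).
  - apply/matrixP => i j; rewrite !ord1 -scalemxAl mxE -dotvE !mxE eqxx.
    by rewrite mulVf// gt_eqF// dotv_gt0.
  - exact: measurable_rV_set1.
  - exact: leb1_set1.
apply/seteqP; split=> s; rewrite /hyperplane/=.
  move=> /matrixP/(_ ord0 ord0); rewrite -dotvE mxE eqxx mulr1n => <-.
  by apply: eq_bigr => i _; rewrite mulrC.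
move=> h; apply/matrixP => i j; rewrite !ord1 -dotvE mxE eqxx mulr1n -h.
by apply: eq_bigr => k _; rewrite mulrC.
Qed.

End null_sets.

(** * Orthonormal frames adapted to a hyperplane *)

Section orthonormal_frame.
Context (R : realType).

Lemma enorm1 n (x : 'rV[R]_n) : enorm x = 1 -> dotv x x = 1.
Proof.
rewrite /enorm => h; rewrite -[LHS]sqr_sqrtr ?h ?expr1n//.
by apply: sumr_ge0 => i _; rewrite -expr2 sqr_ge0.
Qed.

(* The last n rows of the Householder reflection exchanging a and e_0. *)
Lemma exists_orthonormal_complement n (a : 'rV[R]_n.+1) : enorm a = 1 ->
  exists B : 'M[R]_(n, n.+1), B *m B^T = 1%:M /\ a *m B^T = 0.
Proof.
move=> /enorm1 a1.
pose e : 'rV[R]_n.+1 := delta_mx 0 0.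
(* If [a] is already the first basis vector, then [v = 0], and the convention [0^-1 = 0] gives
   [k = 0] and [H] the identity; both cases share one formula. *)
pose v := a - e; pose k := 2 / dotv v v.
pose H := 1%:M - k *: (v^T *m v).
have HT : H^T = H by rewrite /H linearB/= linearZ/= trmx_mul trmxK trmx1.
have vv : dotv v v = 2 - 2 * a ord0 ord0.
  rewrite /v !dotvBr ![dotv (a - e) _]dotvC !dotvBr a1 !dotv_delta [dotv e a]dotvC dotv_delta mxE eqxx /=; ring.
have vvE : v *m v^T = (dotv v v)%:M by apply/matrixP => i j; rewrite !ord1 -dotvE mxE eqxx mulr1n.
have HH : H *m H = 1%:M.
  have kk : k * (k * dotv v v) = k + k.
    have [v0|v0] := eqVneq (dotv v v) 0; last by rewrite /k; field.
    by rewrite /k v0 invr0 !(mulr0, addr0).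
  have NN : (k *: (v^T *m v)) *m (k *: (v^T *m v)) = (k + k) *: (v^T *m v).
    rewrite -scalemxAl -scalemxAr -mulmxA [v *m (_ *m _)]mulmxA vvE.
    by rewrite mul_scalar_mx -scalemxAr !scalerA -kk mulrA.
  rewrite /H; move: NN; set N := k *: (v^T *m v) => NN.
  rewrite mulmxBl mul1mx mulmxBr NN mulmx1 scalerDl -/N.
  have -> : N - (N + N) = - N by rewrite opprD addrA subrr sub0r.
  by rewrite opprK subrK.
have eH : e *m H = a.
  rewrite /H mulmxBr mulmx1 -scalemxAr mulmxA.
  have -> : e *m v^T = (a ord0 ord0 - 1)%:M.
    by apply/matrixP => i j; rewrite !ord1 -rowE !mxE /=.
  rewrite mul_scalar_mx scalerA.
  have [v0|v0] := eqVneq (dotv v v) 0.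
    have : v = 0 by apply/eqP; apply: contra_eqT v0 => v0; rewrite gt_eqF// dotv_gt0.
    by move=> /eqP; rewrite subr_eq0 => /eqP ->; rewrite /k v0 invr0 mulr0 mul0r scale0r subr0.
  rewrite (_ : k * _ = -1); first by rewrite scaleN1r opprK /v addrC subrK.
  by rewrite /k vv; rewrite vv in v0; field.
exists (row' ord0 H); split; apply/matrixP => i j.
  have <- : (H *m H^T) (lift ord0 i) (lift ord0 j) = (1%:M : 'M[R]_n) i j.
    by rewrite HT HH !mxE (inj_eq lift_inj).
  by rewrite !mxE; apply: eq_bigr => l _; rewrite !mxE.
rewrite [i]ord1; have : (a *m H^T) ord0 (lift ord0 j) = 0.
  by rewrite -eH HT -mulmxA HH mulmx1 !mxE.
move=> h; by rewrite [RHS]mxE -[RHS]h !mxE; apply: eq_bigr => l _; rewrite !mxE.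
Qed.

End orthonormal_frame.

(** * Hyperplanes as graphs over the last coordinates *)

Section hyperplane_graph.
Context (R : realType) (n : nat).
Implicit Types (a x : 'rV[R]_n.+1) (y : 'rV[R]_n) (S : set 'rV[R]_n.+1).

Lemma dotv_rV_cons a (s : R) y :
  dotv a (rV_cons (s, y)) = a ord0 ord0 * s + dotv (rV_uncons a).2 y.
Proof.
rewrite /dotv big_ord_recl rV_cons0; congr (_ + _).
by apply: eq_bigr => i _; rewrite rV_consS mxE.
Qed.

(* The hyperplane a . x = c, when transverse to the first axis, is the graph of
   the first coordinate as a function of the others. *)
Definition hgraph a (c : R) y : 'rV[R]_n.+1 :=
  rV_cons ((c - dotv (rV_uncons a).2 y) / a ord0 ord0, y).

Definition hproj a (c : R) S : set 'rV[R]_n := [set y | S (hgraph a c y)].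

Lemma hgraph_hyperplane a c y : a ord0 ord0 != 0 -> dotv a (hgraph a c y) = c.
Proof. by move=> a0; rewrite dotv_rV_cons mulrC divfK// subrK. Qed.

Lemma hgraphE a c s y : a ord0 ord0 != 0 ->
  hyperplane a c (rV_cons (s, y)) -> rV_cons (s, y) = hgraph a c y.
Proof.
move=> a0; rewrite /hyperplane /= dotv_rV_cons => <-; congr (rV_cons (_, _)).
by rewrite addrK mulrC mulKf.
Qed.

Lemma measurable_hgraph a c : measurable_fun setT (hgraph a c).
Proof.
apply: (measurableT_comp (@measurable_rV_cons R n)).
apply/measurable_fun_pair => //=; apply: measurable_funM => //.
by apply: measurable_funB => //; exact: measurable_dotv.
Qed.

Lemma measurable_hproj a c S : measurable S -> measurable (hproj a c S).
Proof. by move=> mS; rewrite -[hproj _ _ _]setTI; exact: measurable_hgraph. Qed.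

(** A frame exists, so the [xget] in [hyperplane_measure] does not fall back on its default. The
    square matrix with rows [a] and [B] is a right inverse of its transpose, hence also a left
    inverse: this is the third identity, which recovers a point from its coordinates. *)
Lemma hyperplane_measure_frame a (c : R) S : enorm a = 1 ->
  exists B : 'M[R]_(n, n.+1), [/\ B *m B^T = 1%:M, a *m B^T = 0,
    a^T *m a + B^T *m B = 1%:M &
    hyperplane_measure a c S = leb R n [set s | S (c *: a + s *m B)]].
Proof.
move=> a1; rewrite /hyperplane_measure /=.
set P := (X in xget 0 X); set B := xget 0 P.
have [BB aB] : P B by have [B0 hB0] := exists_orthonormal_complement a1; exact: (xgetI 0 hB0).
exists B; split=> //.
pose Q : 'M[R]_(1 + n) := col_mx a B.
have aa : a *m a^T = 1%:M.
  by apply/matrixP => i j; rewrite !ord1 -dotvE mxE eqxx enorm1.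
have QQ : Q *m Q^T = 1%:M.
  rewrite /Q tr_col_mx mul_col_row aa aB BB.
  have -> : B *m a^T = 0 by rewrite -[LHS]trmxK trmx_mul trmxK aB trmx0.
  by rewrite -scalar_mx_block.
have /mulmx1C : Q *m Q^T = 1%:M by [].
by rewrite /Q tr_col_mx mul_row_col.
Qed.

(** The orthonormal and the graph parametrisations of the hyperplane differ by an affine bijection
    with linear part [L *m B^T], and such a bijection preserves null sets whatever its
    determinant. *)
Lemma hproj_null a (c : R) S : enorm a = 1 -> a ord0 ord0 != 0 ->
  measurable S -> S `<=` hyperplane a c -> hyperplane_measure a c S = 0%E ->
  leb R n (hproj a c S) = 0%E.
Proof.
move=> a1 a0 mS Sh; have [B [BB aB aaBB ->]] := hyperplane_measure_frame c S a1.
set A := [set s | _] => A0.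
have mA : measurable A.
  rewrite -[A]setTI; apply: measurable_rVD => //; exact: measurable_mulmxr.
have hS x : dotv a x = c -> c *: a + (x *m B^T) *m B = x.
  move=> xc; rewrite -mulmxA -[in RHS](mulmx1 x) -aaBB mulmxDr (mulmxA x a^T).
  congr (_ + _); rewrite (_ : x *m a^T = c%:M) ?mul_scalar_mx//.
  by apply/matrixP => i j; rewrite !ord1 -dotvE dotvC xc mxE eqxx.
pose L : 'M[R]_(n, n.+1) := \matrix_i (hgraph a 0 (delta_mx 0 i)).
have hL y : y *m L = hgraph a 0 y.
  apply/rowP => j; rewrite mxE /hgraph.
  have [->|[k ->]] : j = ord0 \/ exists k, j = lift ord0 k.
  - by case: (unliftP ord0 j) => [k ->|->]; [right; exists k|left].
  - rewrite rV_cons0; under eq_bigr do rewrite mxE /hgraph rV_cons0 sub0r dotv_delta.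
    rewrite sub0r [in RHS]/dotv mulNr mulr_suml -sumrN; apply: eq_bigr => i _.
    by ring.
  - rewrite rV_consS; under eq_bigr do rewrite mxE /hgraph rV_consS mxE eqxx/=.
    rewrite (bigD1 k)//= eqxx mulr1 big1 ?addr0// => i ik.
    by rewrite eq_sym (negbTE ik) mulr0.
have hg y : hgraph a c y = hgraph a c 0 + hgraph a 0 y.
  rewrite /hgraph; apply/rowP => j; rewrite [RHS]mxE.
  have [->|[k ->]] : j = ord0 \/ exists k, j = lift ord0 k.
  - by case: (unliftP ord0 j) => [k ->|->]; [right; exists k|left].
  - have d0 : dotv (rV_uncons a).2 0 = 0 by rewrite -(scale0r 0) dotvZr mul0r.
    by rewrite !rV_cons0 d0 -mulrDl subr0 sub0r.
  - by rewrite !rV_consS mxE add0r.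
(* If [y] is in the kernel, [hgraph a 0 y] is orthogonal to [a] and to every row of [B], hence zero;
   its last coordinates are those of [y]. *)
have Lu : L *m B^T \in unitmx.
  rewrite -row_free_unit -kermx_eq0; apply/rowV0P => y.
  move=> /sub_kermxP; rewrite mulmxA hL => yB.
  have : dotv a (hgraph a 0 y) = 0 by exact: hgraph_hyperplane.
  move=> h; have := hS (hgraph a 0 y).
  have := congr1 (fun z => z *m B) yB; rewrite mul0mx => yBB.
  have {}h : hgraph a 0 y *m a^T = 0.
    by apply/matrixP => i j; rewrite !ord1 -dotvE dotvC h mxE.
  have : hgraph a 0 y = 0.
    by rewrite -[LHS]mulmx1 -aaBB mulmxDr !mulmxA h yBB mul0mx addr0.
  move=> /rowP g0 _; apply/rowP => i.
  by have := g0 (lift ord0 i); rewrite /hgraph rV_consS !mxE.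
rewrite (_ : hproj a c S = [set y | A (hgraph a c 0 *m B^T + y *m (L *m B^T))]).
  by apply: (leb_addmulmx_null _ (mulVmx Lu)).
apply/seteqP; split=> y; rewrite /A /hproj/= mulmxA hL -mulmxDl -hg.
  by rewrite hS//; exact: hgraph_hyperplane.
by rewrite hS//; exact: hgraph_hyperplane.
Qed.

(** In frame coordinates the second hyperplane has normal [b *m B^T], which vanishes only when [b]
    is collinear with [a]. *)
Lemma hyperplane_measure_transverse a b (c e : R) : enorm a = 1 ->
  b != dotv a b *: a -> hyperplane_measure a c (hyperplane b e) = 0%E.
Proof.
move=> a1 ba; have [B [BB aB aaBB ->]] := hyperplane_measure_frame c (hyperplane b e) a1.
rewrite (_ : [set s | _] = hyperplane (b *m B^T) (e - c * dotv b a)).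
  apply: hyperplane_null; apply: contra ba => /eqP bB; apply/eqP.
  rewrite -[LHS]mulmx1 -aaBB mulmxDr !mulmxA bB mul0mx addr0.
  rewrite (_ : b *m a^T = (dotv a b)%:M) ?mul_scalar_mx//.
  by apply/matrixP => i j; rewrite !ord1 -dotvE dotvC mxE eqxx.
have hE s : dotv b (c *: a + s *m B) = c * dotv b a + dotv (b *m B^T) s.
  by rewrite dotvDr dotvZr; congr (_ + _); rewrite !dotvE trmx_mul mulmxA.
apply/seteqP; split=> s; rewrite /hyperplane/= hE => h; first by rewrite -h addrAC subrr add0r.
by rewrite h addrC subrK.
Qed.

End hyperplane_graph.

(** * Lebesgue measure of cones *)

Section cones.
Context (R : realType).

(** The slice of a cone at height [t] has measure proportional to [t ^+ n]; this integral is the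
    factor [1/d] in the volume of a cone. *)
Lemma integral_exprn_itv01 n :
  (\int[@lebesgue_measure R]_(t in `]0%R, 1%R[) (t ^+ n)%:E = (n.+1%:R^-1)%:E)%E.
Proof.
have mX : measurable_fun setT (fun t : R => (t ^+ n)%:E).
  by apply/measurable_EFinP; apply: measurable_funX.
rewrite integral_itv_bndo_bndc; last exact: measurable_funTS.
rewrite integral_itv_obnd_cbnd; last exact: measurable_funTS.
have cX (x : R) : (fun t : R => t ^+ n.+1 / n.+1%:R) t @[t --> x] --> x ^+ n.+1 / n.+1%:R.
  by apply: cvgM; [exact: exprn_continuous|exact: cvg_cst].
rewrite (@continuous_FTC2 _ (fun t => t ^+ n) (fun t => t ^+ n.+1 / n.+1%:R) 0 1)//.
- by rewrite expr1n expr0n/= mul0r sube0 mul1r.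
- by apply: continuous_subspaceT => x; exact: exprn_continuous.
- split=> [x _||].
  + by apply: derivableM => //; exact: exprn_derivable.
  + by apply: cvg_at_right_filter; exact: cX.
  + by apply: cvg_at_left_filter; exact: cX.
- move=> x _; rewrite derive1Mr; last exact: exprn_derivable.
  by rewrite derive1E exp_derive /= scaler1 mulrAC divff ?mul1r ?pnatr_eq0.
Qed.

Context (n : nat).
Implicit Types (a x : 'rV[R]_n.+1) (y : 'rV[R]_n) (S : set 'rV[R]_n.+1).

Definition open_cone x S : set 'rV[R]_n.+1 :=
  [set x + t *: (z - x) | t in `]0, 1[ & z in S].

Variables (a : 'rV[R]_n.+1) (c : R) (x0 : 'rV[R]_n.+1) (S : set 'rV[R]_n.+1).
Hypotheses (mS : measurable S) (Sh : S `<=` hyperplane a c)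
  (x0h : dotv a x0 != c).

Let delta := c - dotv a x0.

Let delta0 : delta != 0.
Proof. by rewrite subr_eq0 eq_sym. Qed.

(** The affine function equal to 0 at the apex and to 1 on the hyperplane of the base. *)
Definition cone_param x := dotv a (x - x0) / delta.

(** The image becomes a preimage, from which measurability can be read. [powR] with exponent [-1] is
    the inverse on positive reals and is measurable on the whole line. *)
Lemma open_coneE : open_cone x0 S = [set x | 0 < cone_param x < 1 /\
  S (x0 + (cone_param x `^ (-1)) *: (x - x0))].
Proof.
apply/seteqP; split=> [_ [t t01 [z Sz <-]]|x [t01 St]]/=.
  rewrite /cone_param; rewrite addrC addKr dotvZr dotvBr (Sh Sz) mulfK//.
  move: t01; rewrite /= in_itv/= => t01; split=> //.
  have t0 : 0 < t by case/andP: t01.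
  by rewrite powR_inv1 ?ltW// scalerA mulVf ?gt_eqF// scale1r addrC subrK.
have t0 : 0 < cone_param x by case/andP: t01.
exists (cone_param x); first by rewrite /= in_itv.
exists (x0 + (cone_param x `^ (-1)) *: (x - x0)) => //.
rewrite [x0 + _ - x0]addrC addKr scalerA powR_inv1 ?ltW// mulfV ?gt_eqF//.
by rewrite scale1r addrC subrK.
Qed.

Lemma measurable_cone_param : measurable_fun setT cone_param.
Proof.
apply: measurable_funM => //; rewrite /cone_param.
under eq_fun do rewrite dotvBr.
by apply: measurable_funB => //; exact: measurable_dotv.
Qed.

Lemma measurable_open_cone : measurable (open_cone x0 S).
Proof.
have mp := measurable_cone_param.
rewrite open_coneE (_ : [set x | _] = cone_param @^-1` `]0, 1[%classic `&`
  (fun x => x0 + (cone_param x `^ (-1)) *: (x - x0)) @^-1` S); last first.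
  by apply/seteqP; split=> x /=; rewrite in_itv/=.
apply: measurableI; first by rewrite -[X in measurable X]setTI; exact: mp.
rewrite -[X in measurable X]setTI; apply: measurable_rVD => //.
apply: measurable_fun_rVP => i; rewrite /comp /rV_coord.
under eq_fun do rewrite mxE.
apply: measurable_funM.
  exact: (measurableT_comp (measurable_powR (-1))).
under eq_fun do rewrite mxE.
by apply: measurable_funD => //; exact: measurable_rV_coord.
Qed.

(* Slicing along the first axis, the shear x |-> (cone_param x, x') turns the
   cone into the cone of apex x0' and height 1 over hproj S. *)
Lemma leb_open_cone : a ord0 ord0 != 0 ->
  leb R n.+1 (open_cone x0 S) =
  ((`|delta / a ord0 ord0| / n.+1%:R)%:E * leb R n (hproj a c S))%E.
Proof.
move=> a0; have mcone := measurable_open_cone.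
set P := hproj a c S; set z0 := (rV_uncons x0).2; set a' := (rV_uncons a).2.
have mP : measurable P by exact: measurable_hproj.
pose W (t : R) y := 0 < t < 1 /\ P (z0 + (t `^ (-1)) *: (y - z0)).
pose D := [set x : 'rV[R]_n.+1 | W (rV_uncons x).1 (rV_uncons x).2].
have DE t y : D (rV_cons (t, y)) = W t y by rewrite /D /mkset rV_unconsK.
have mD : measurable D.
  rewrite (_ : D = (fun x => (rV_uncons x).1) @^-1` `]0, 1[%classic `&`
    (fun x => z0 + ((rV_uncons x).1 `^ (-1)) *: ((rV_uncons x).2 - z0)) @^-1` P); last first.
    by apply/seteqP; split=> x /=; rewrite /D /W /= in_itv/=.
  have m1 : measurable_fun setT (fun x : 'rV[R]_n.+1 => (rV_uncons x).1).
    exact: measurable_rV_coord.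
  apply: measurableI; first by rewrite -[X in measurable X]setTI; exact: m1.
  rewrite -[X in measurable X]setTI; apply: measurable_rVD => //.
  apply: measurable_fun_rVP => i; rewrite /comp /rV_coord.
  under eq_fun do rewrite mxE.
  apply: measurable_funM.
    exact: (measurableT_comp (measurable_powR (-1))).
  under eq_fun do rewrite !mxE.
  by apply: measurable_funB => //; exact: measurable_rV_coord.
have sliceE y : lebesgue_measure (rV_slice (open_cone x0 S) y) =
    (`|delta / a ord0 ord0|%:E * lebesgue_measure (rV_slice D y))%E.
  (* On the line over [y], [cone_param] is affine in the first coordinate with slope [k]; its
     inverse slope gives the factor in front of the measure. *)
  pose al := (dotv a' y - dotv a x0) / delta; pose k := a ord0 ord0 / delta.
  have k0 : k != 0 by rewrite mulf_neq0// invr_eq0.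
  have -> : rV_slice (open_cone x0 S) y = (fun s => al + k * s) @^-1` (rV_slice D y).
    have parE s : cone_param (rV_cons (s, y)) = al + k * s.
      by rewrite /cone_param dotvBr dotv_rV_cons /al /k; field.
    have hE s t : t != 0 -> t = al + k * s ->
        x0 + t^-1 *: (rV_cons (s, y) - x0) = hgraph a c (z0 + t^-1 *: (y - z0)).
      move=> t0 tE; have [u [z ez]] := rV_consP (x0 + t^-1 *: (rV_cons (s, y) - x0)).
      rewrite {1}ez (_ : z0 + _ = z); last first.
        have aff m (k1 : R) (v w : 'rV[R]_m) i :
          (w + k1 *: (v - w)) ord0 i = w ord0 i + k1 * (v ord0 i - w ord0 i) by rewrite !mxE.
        apply/rowP => i; rewrite -[RHS](rV_consS u z) -ez !aff rV_consS.
        by rewrite /z0 mxE.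
      apply: hgraphE => //; rewrite /hyperplane/= -ez dotvDr dotvZr dotvBr dotv_rV_cons.
      rewrite -/a' (_ : _ - dotv a x0 = t * delta); first by rewrite mulKf// /delta addrC subrK.
      by rewrite tE /al /k; field.
    rewrite open_coneE; apply/seteqP; split=> s; rewrite /rV_slice /= DE /W parE.
      move=> [t01]; have t0 : 0 < al + k * s by case/andP: t01.
      by rewrite powR_inv1 ?ltW// (hE _ _ _ erefl) ?gt_eqF.
    move=> [t01]; have t0 : 0 < al + k * s by case/andP: t01.
    rewrite powR_inv1 ?ltW// => h; split => //.
    by rewrite (hE _ _ _ erefl) ?gt_eqF.
  rewrite lebesgue_measure_affine//; last exact: measurable_rV_slice.
  by rewrite /k -normfV invf_div.
rewrite leb_slice//; under eq_integral do rewrite sliceE.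
rewrite ge0_integralZl//; last exact: measurable_fun_rV_slice.
(* [D] is now sliced the other way: at height [t] it is the dilation of [P] by [t] about [z0], of
   measure [t ^+ n] times that of [P]. *)
rewrite -leb_slice// leb_slice2// EFinM -muleA; congr (_ * _)%E.
rewrite -integral_exprn_itv01 -ge0_integralZr//; last 2 first.
  - by apply/measurable_EFinP; apply: measurable_funTS; apply: measurable_funX.
  - by move=> t /=; rewrite in_itv/= lee_fin => /andP[t0 _]; rewrite exprn_ge0// ltW.
rewrite [RHS]integral_mkcond; apply: eq_integral => t _; rewrite patchE.
case: ifPn => [/set_mem/=|/negP nt]; last first.
  rewrite (_ : [set y | _] = set0) ?measure0//; apply/seteqP; split=> // y.
  by rewrite /= DE => -[t01 _]; apply: nt; apply/mem_set; rewrite /= in_itv.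
rewrite in_itv/= => t01; have t0 : 0 < t by case/andP: t01.
rewrite (_ : [set y | _] = (fun y => (z0 - t^-1 *: z0) + t^-1 *: y) @^-1` P); last first.
  have E y : z0 + t^-1 *: (y - z0) = (z0 - t^-1 *: z0) + t^-1 *: y.
    by rewrite scalerBr addrA addrAC.
  by apply/seteqP; split=> y; rewrite /= DE /W powR_inv1 ?ltW// E // => -[].
rewrite leb_affine ?invr_eq0 ?gt_eqF//; congr (_%:E * _)%E.
by rewrite normfV exprVn invrK gtr0_norm.
Qed.

End cones.

(** * Euclidean geometry of admissible meshes *)

Lemma closure_subset_closed (U : topologicalType) (A B : set U) :
  closed B -> A `<=` B -> closure A `<=` B.
Proof. by move=> /closure_id {2}-> AB; exact: closureS. Qed.

(** * Euclidean norm and diameter *)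

Section euclidean_norm.
Context (R : realType) (n : nat).
Implicit Types x y z : 'rV[R]_n.

Lemma dotv_ge0 x : 0 <= dotv x x.
Proof. by apply: sumr_ge0 => i _; rewrite -expr2 sqr_ge0. Qed.

Lemma sqr_enorm x : enorm x ^+ 2 = dotv x x.
Proof. by rewrite sqr_sqrtr// dotv_ge0. Qed.

Lemma enorm_ge0 x : 0 <= enorm x.
Proof. exact: sqrtr_ge0. Qed.

Lemma normr_coord_enorm x i : `|x ord0 i| <= enorm x.
Proof.
rewrite -(@ler_pXn2r _ 2) ?nnegrE ?enorm_ge0// sqr_enorm -normrX ger0_norm ?sqr_ge0//.
rewrite /dotv (bigD1 i)//= -expr2 lerDl; apply: sumr_ge0 => j _.
by rewrite -expr2 sqr_ge0.
Qed.

Lemma normr_rV_coord x i : `|x ord0 i| <= `|x|.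
Proof.
rewrite [leRHS]/Num.norm /= mx_normrE; apply/bigmax_geP; right => /=.
by exists (ord0, i).
Qed.

Lemma enorm_le_norm x : enorm x <= Num.sqrt n%:R * `|x|.
Proof.
rewrite -(@ler_pXn2r _ 2) ?nnegrE ?enorm_ge0 ?mulr_ge0 ?sqrtr_ge0//.
rewrite sqr_enorm exprMn sqr_sqrtr ?ler0n// mulr_natl.
rewrite -[X in _ *+ X]card_ord -sumr_const; apply: ler_sum => i _.
rewrite -expr2 -[leLHS]ger0_norm ?sqr_ge0// normrX.
by rewrite ler_pXn2r ?nnegrE ?normr_rV_coord.
Qed.

Lemma enormN x : enorm (- x) = enorm x.
Proof. by rewrite /enorm dotvNr [dotv (- x) x]dotvC dotvNr opprK. Qed.

Lemma continuous_sum_rV m (f : 'I_m -> 'rV[R]_n -> R) :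
  (forall i, continuous (f i)) -> continuous (fun x => \sum_(i < m) f i x).
Proof.
move=> cf; elim: m f cf => [|m IH] f cf.
  by under eq_fun do rewrite big_ord0; exact: cst_continuous.
under eq_fun do rewrite big_ord_recl.
by move=> x; apply: continuousD; [exact: cf|apply: IH => i; exact: cf].
Qed.

Lemma continuous_dotv x : continuous (dotv x).
Proof.
apply: continuous_sum_rV => i y.
by apply: continuousM; [exact: cst_continuous|exact: coord_continuous].
Qed.

Lemma continuous_enormB y : continuous (fun x => enorm (x - y)).
Proof.
move=> x; apply: (@continuous_comp _ _ _ (fun x => dotv (x - y) (x - y)) Num.sqrt); last first.
  exact: sqrt_continuous.
apply: continuous_sum_rV => i {}x.
have h : continuous (fun z : 'rV[R]_n => (z - y) ord0 i).
  have -> : (fun z : 'rV[R]_n => (z - y) ord0 i) = (fun z => z ord0 i - y ord0 i).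
    by apply/funext => z; rewrite !mxE.
  by move=> z; apply: continuousB; [exact: coord_continuous|exact: cst_continuous].
by apply: continuousM; exact: h.
Qed.

End euclidean_norm.

Section diameter.
Context (R : realType) (n : nat) (Omega : set 'rV[R]_n).
Hypothesis bO : bounded_set Omega.

Lemma diam_has_sup : Omega !=set0 ->
  has_sup [set enorm (x - y) | x in Omega & y in Omega].
Proof.
move=> [x0 Ox0]; split; first by exists (enorm (x0 - x0)), x0 => //; exists x0.
have [M [Mr hM]] := bO.
exists (Num.sqrt n%:R * ((M + 1) + (M + 1))) => _ [x Ox [y Oy <-]].
apply: (le_trans (enorm_le_norm _)); rewrite ler_wpM2l ?sqrtr_ge0//.
apply: (le_trans (ler_normB _ _)); apply: lerD; by apply: hM => //; rewrite ltrDl.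
Qed.

(** The inequality is a closed condition in each variable, so it extends to the closure one variable
    at a time. *)
Lemma enorm_le_diam x y : closure Omega x -> closure Omega y ->
  enorm (x - y) <= diam Omega.
Proof.
have cl (z : 'rV[R]_n) : closed [set x : 'rV[R]_n | enorm (x - z) <= diam Omega].
  have -> : [set x : 'rV[R]_n | enorm (x - z) <= diam Omega] =
      (fun x : 'rV[R]_n => enorm (x - z)) @^-1` [set r | r <= diam Omega] by [].
  apply: preimage_closed; last exact: closed_le.
  by move=> u _; exact: continuous_enormB.
have h1 z : Omega z -> forall x, closure Omega x -> enorm (x - z) <= diam Omega.
  move=> Oz; apply: closure_subset_closed (cl z) _ => v Ov /=.
  apply: sup_upper_bound.
    by apply: diam_has_sup; exists v.
  by exists v => //; exists z.
move=> cx cy; rewrite -enormN opprB; move: y cy.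
apply: closure_subset_closed (cl x) _ => v Ov /=.
by rewrite -enormN opprB; exact: h1.
Qed.

Lemma diam_gt0 (i : 'I_n) : open Omega -> Omega !=set0 -> 0 < diam Omega.
Proof.
move=> oO [x Ox]; have := oO; rewrite openE => /(_ _ Ox) /nbhs_ballP[e /= e0 xe].
pose y := x + (e / 2) *: delta_mx 0 i.
have Oy : Omega y.
  apply: xe; apply/rV_ballP => // j; rewrite !mxE opprD addNKr normrN.
  rewrite normrM (le_lt_trans (y := `|e / 2|))//.
    by rewrite ler_piMr//; case: (_ && _); rewrite ?normr0 ?normr1.
  by rewrite gtr0_norm ?divr_gt0// ltr_pdivrMr// ltr_pMr// ltr1n.
apply: (lt_le_trans _ (enorm_le_diam (subset_closure Oy) (subset_closure Ox))).
apply: (lt_le_trans _ (normr_coord_enorm _ i)).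
by rewrite !mxE !eqxx mulr1 addrAC subrr add0r normr_gt0 gt_eqF ?divr_gt0.
Qed.

End diameter.

(** * Convex polytopes as intersections of half-spaces *)

Section polytopes.
Context (R : realType) (n : nat).
Implicit Types (x y p q : 'rV[R]_n).

Definition halfspaces m (a : 'I_m -> 'rV[R]_n) (b : 'I_m -> R) :=
  [set x | forall i, dotv (a i) x < b i].

Variables (m : nat) (a : 'I_m -> 'rV[R]_n) (b : 'I_m -> R).
Local Notation P := (halfspaces a b).

Lemma open_halfspaces : open P.
Proof.
rewrite (_ : P = ~` \bigcup_(i in [set: 'I_m]) (dotv (a i) @^-1` [set r | b i <= r])).
  apply: closed_openC; apply: closed_bigcup => [|i _]; first exact: finite_finset.
  by apply: preimage_closed; [move=> x _; exact: continuous_dotv|exact: closed_ge].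
apply/seteqP; split=> x /=; first by move=> h [i _ /=]; rewrite leNgt h.
by move=> h i; rewrite ltNge; apply/negP => bi; apply: h; exists i.
Qed.

Lemma closure_halfspacesW x : closure P x -> forall i, dotv (a i) x <= b i.
Proof.
move=> cx i; move: x cx.
have cl : closed [set x | dotv (a i) x <= b i].
  have -> : [set x | dotv (a i) x <= b i] = dotv (a i) @^-1` [set r | r <= b i] by [].
  apply: preimage_closed; last exact: closed_le.
  by move=> x _; exact: continuous_dotv.
by apply: closure_subset_closed cl _ => x Px /=; exact/ltW/Px.
Qed.

Lemma segment_halfspaces x y t : P x -> (forall i, dotv (a i) y <= b i) ->
  0 <= t < 1 -> P (x + t *: (y - x)).
Proof.
move=> Px cy /andP[t0 t1] i; rewrite dotvDr dotvZr dotvBr.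
rewrite (_ : _ + _ = (1 - t) * dotv (a i) x + t * dotv (a i) y); last by ring.
rewrite [ltRHS](_ : _ = (1 - t) * b i + t * b i); last by ring.
by apply: ltr_leD; [rewrite ltr_pM2l ?subr_gt0|rewrite ler_wpM2l].
Qed.

(** Points of the segment from [x] to [y] other than [y] satisfy all constraints strictly, and they
    approach [y]. *)
Lemma closure_halfspaces x y : P x -> (forall i, dotv (a i) y <= b i) ->
  closure P y.
Proof.
move=> Px cy B /nbhs_ballP[e /= e0 yB].
pose N := `|x - y| + 1.
have N0 : 0 < N by rewrite ltr_wpDl.
(* This choice gives [t < 1] and [t * |x - y| < e] at once. *)
pose t := e / (N + e).
have Ne0 : 0 < N + e by rewrite addr_gt0.
have t01 : 0 < t < 1 by rewrite divr_gt0//= ltr_pdivrMr// mul1r ltrDr.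
exists (x + (1 - t) *: (y - x)); split.
  by apply: segment_halfspaces => //; move: t01; rewrite !subr_cp0 /= => /andP[? ?]; apply/andP; split; lra.
apply: yB; apply/rV_ballP => // i.
have -> : y ord0 i - (x + (1 - t) *: (y - x)) ord0 i = - (t * (x - y) ord0 i).
  by rewrite !mxE; ring.
rewrite normrN normrM; have /andP[t0 _] := t01; rewrite (gtr0_norm t0).
apply: (@le_lt_trans _ _ (t * `|x - y|)); first by rewrite ler_wpM2l ?normr_rV_coord// ltW.
rewrite /t mulrAC ltr_pdivrMr// ltr_pM2l//.
by rewrite /N -addrA ltrDl addr_gt0.
Qed.

(** The exit time is the least ratio [T i] over the constraints that [q] fails; constraints
    satisfied at both ends hold along the whole segment. *)
Lemma segment_exit x q : P x -> ~ P q ->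
  exists2 t, 0 < t <= 1 & (closure P `\` P) (x + t *: (q - x)).
Proof.
move=> Px /existsNP[i0 /negP]; rewrite -leNgt => bq.
pose V i := b i <= dotv (a i) q.
pose T i := (b i - dotv (a i) x) / (dotv (a i) q - dotv (a i) x).
have [i Vi hi] := @arg_minP _ _ _ i0 V T bq.
have VT j : V j -> 0 < T j <= 1.
  move=> Vj; have := Px j; rewrite /T => xj.
  have dj : 0 < dotv (a j) q - dotv (a j) x by rewrite subr_gt0 (lt_le_trans xj).
  by rewrite ler_pdivrMr // mul1r lerD2r (Vj : b j <= dotv (a j) q) andbT divr_gt0 // subr_gt0.
have eT j t : dotv (a j) (x + t *: (q - x)) = dotv (a j) x + t * (dotv (a j) q - dotv (a j) x).
  by rewrite dotvDr dotvZr dotvBr.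
exists (T i); first exact: VT.
have /andP[Ti0 Ti1] := VT _ Vi.
split; last first.
  move=> /(_ i); rewrite eT /T divfK ?subrKC ?ltxx//.
  by rewrite gt_eqF// subr_gt0 (lt_le_trans (Px i)).
apply: (closure_halfspaces Px) => j; rewrite eT.
have [Vj|] := leP (b j) (dotv (a j) q).
  have dj : 0 < dotv (a j) q - dotv (a j) x by rewrite subr_gt0 (lt_le_trans (Px j)).
  by rewrite -lerBrDl -ler_pdivlMr//; exact: hi.
move=> qj; have xj := Px j.
by nra.
Qed.

End polytopes.

Section hyperplanes.
Context (R : realType) (n : nat) (a : 'rV[R]_n) (c : R).

Lemma closed_hyperplane : closed (hyperplane a c).
Proof.
have -> : hyperplane a c = dotv a @^-1` [set c] by [].
apply: preimage_closed; first by move=> x _; exact: continuous_dotv.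
exact: closed_eq.
Qed.

Lemma measurable_hyperplane : measurable (hyperplane a c).
Proof. by apply: closed_measurable_rV; exact: closed_hyperplane. Qed.

End hyperplanes.

(** * Cells, faces and cones of an admissible mesh *)

Section mesh_geometry.
Context (R : realType) (n : nat) (Omega : set 'rV[R]_n.+1).
Variable T : admissible_mesh Omega.
Implicit Types (K L M : cell T) (s : edge T) (x y p q : 'rV[R]_n.+1).

Lemma vol_halfspaces K : exists m (a : 'I_m -> 'rV[R]_n.+1) b, vol K = halfspaces a b.
Proof. by have [_ [m [a [b ->]]]] := vol_polytope K; exists m, a, b. Qed.

Lemma open_vol K : open (vol K).
Proof. by have [m [a [b ->]]] := vol_halfspaces K; exact: open_halfspaces. Qed.

Lemma closure_face_sub K s : s \in edges_of K ->
  closure (face s) `<=` closure (vol K) `\` vol K.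
Proof. by move=> sK x cx; rewrite vol_bdry; exists s. Qed.

Lemma closure_face_hyperplane s :
  closure (face s) `<=` hyperplane (nrm s) (off s).
Proof.
exact: (closure_subset_closed (@closed_hyperplane _ _ _ _) (@face_hyperplane _ _ _ _ s)).
Qed.

Lemma vol_inj K L x : vol K x -> vol L x -> K = L.
Proof. by move=> Kx Lx; apply: (@vol_disjoint _ _ _ T) => //; exists x. Qed.

Lemma face_inj s s' x : face s x -> face s' x -> s = s'.
Proof. by move=> sx s'x; apply: (@face_disjoint _ _ _ T) => //; exists x. Qed.

(** The frame chosen in [hyperplane_measure] depends on [a] alone, so all the sets are pulled back
    by the same affine map and subadditivity applies. *)
Lemma hyperplane_measure_cover (a : 'rV[R]_n.+1) (c : R) S (I : finType)
    (F : I -> set 'rV[R]_n.+1) :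
  measurable S -> (forall i, measurable (F i)) -> S `<=` \bigcup_i F i ->
  (forall i, hyperplane_measure a c (F i) = 0%E) -> hyperplane_measure a c S = 0%E.
Proof.
move=> mS mF SF; rewrite /hyperplane_measure /=; set B := xget _ _ => F0.
have mphi : measurable_fun setT (fun u : 'rV[R]_n => c *: a + u *m B).
  by apply: measurable_rVD => //; exact: measurable_mulmxr.
have mpre A : measurable A -> measurable [set u | A (c *: a + u *m B)].
  by move=> mA; rewrite -[X in measurable X]setTI; exact: mphi.
apply/negligibleP; first exact: mpre.
apply: (@negligibleS _ _ _ _ (\bigcup_i [set u | F i (c *: a + u *m B)])).
  by move=> u /SF [i _ Fi]; exists i.
by apply: negligible_bigcup_fin => i; apply/negligibleP; [exact: mpre|exact: F0].
Qed.

(** The sign that makes [nrm s] point out of [K]. *)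
Definition side K s : R := Num.sg (off s - dotv (nrm s) (Defs.center K)).

(* The face has positive measure, so one of the finitely many facets of the
   convex polytope K spans its hyperplane. *)
Lemma face_one_sided K s : s \in edges_of K ->
  side K s != 0 /\ forall x, vol K x -> 0 < side K s * (off s - dotv (nrm s) x).
Proof.
move=> sK; have cK := center_in K.
have [m [a [b volE]]] := vol_halfspaces K.
(* Otherwise, a constraint with normal collinear to [nrm s] has a boundary that misses the face, any
   other one cuts it in a null set, and the face would be null. *)
have [i [k [ak bk]]] : exists i k, a i = k *: nrm s /\ b i = k * off s.
  apply: contrapT => H.
  have := face_gt0 s; rewrite (@hyperplane_measure_cover _ _ _ 'I_m
    (fun i => face s `&` hyperplane (a i) (b i))) ?ltxx//.
  - exact: face_measurable.
  - move=> i; apply: measurableI; [exact: face_measurable|exact: measurable_hyperplane].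
  - move=> y sy; have [cy nKy] := closure_face_sub sK (subset_closure sy).
    rewrite volE in cy nKy; have /existsNP[i /negP] := nKy.
    rewrite -leNgt => bi; exists i => //; split=> //=.
    by apply/eqP; rewrite eq_le bi (closure_halfspacesW cy).
  - move=> i; have [aE|aN] := eqVneq (a i) (dotv (nrm s) (a i) *: nrm s).
      rewrite (_ : _ `&` _ = set0).
        by rewrite /hyperplane_measure (_ : [set u | _] = set0).
      apply/seteqP; split=> // y [sy]; rewrite /hyperplane/= => ay; apply: H.
      exists i, (dotv (nrm s) (a i)); split=> //.
      by rewrite -ay {1}aE dotvZl (face_hyperplane sy).
    apply: (@hyperplane_measure_cover _ _ _ unit (fun=> hyperplane (a i) (b i))).
    + by apply: measurableI; [exact: face_measurable|exact: measurable_hyperplane].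
    + by move=> _; exact: measurable_hyperplane.
    + by move=> y [_ hy]; exists tt.
    + move=> _; apply: hyperplane_measure_transverse => //; exact: nrm_unit.
have kx x : vol K x -> 0 < k * (off s - dotv (nrm s) x).
  by rewrite volE => /(_ i); rewrite ak bk dotvZl mulrBr subr_gt0.
have kc := kx _ cK; rewrite /side sgr_eq0; split.
  by apply: contraTneq kc => ->; rewrite mulr0 ltxx.
move=> x /kx; move: kc; have [k0|k0|->] := ltgtP k 0; last by rewrite mul0r ltxx.
  by rewrite nmulr_rgt0// => /ltr0_sg ->; rewrite nmulr_rgt0// mulN1r oppr_gt0.
by rewrite pmulr_rgt0// => /gtr0_sg ->; rewrite pmulr_rgt0// mul1r.
Qed.

Lemma side_sqr K s : s \in edges_of K -> side K s * side K s = 1.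
Proof.
move=> /face_one_sided[]; rewrite /side sgr_eq0 => h _.
by rewrite -expr2 sqr_sg h.
Qed.

Lemma dist_faceE K s : dist_face K s = side K s * (off s - dotv (nrm s) (Defs.center K)).
Proof. by rewrite /dist_face distrC normrEsg. Qed.

Lemma dist_face_gt0 K s : s \in edges_of K -> 0 < dist_face K s.
Proof.
by move=> sK; rewrite dist_faceE; apply: (face_one_sided sK).2; exact: center_in.
Qed.

Lemma center_notin_hyperplane K s : s \in edges_of K ->
  dotv (nrm s) (Defs.center K) != off s.
Proof.
by move=> /dist_face_gt0; rewrite /dist_face normr_gt0 subr_eq0.
Qed.

Lemma segment_vol K x y t : vol K x -> closure (vol K) y -> 0 <= t < 1 ->
  vol K (x + t *: (y - x)).
Proof.
have [m [a [b ->]]] := vol_halfspaces K => Kx cy.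
by apply: segment_halfspaces => //; exact: closure_halfspacesW.
Qed.

Lemma cone_sub_vol K s : s \in edges_of K -> cone K s `<=` vol K.
Proof.
move=> sK _ [t /= + [y sy <-]]; rewrite in_itv/= => /andP[t0 t1].
apply: segment_vol; first exact: center_in.
  by have [] := closure_face_sub sK (subset_closure sy).
by rewrite (ltW t0).
Qed.

(** A common point puts base points [z] and [w] on one ray from the centre. If they differed, the
    nearer one would lie in the open cell by convexity, yet both are on its boundary; so [z = w],
    and faces are disjoint. *)
Lemma cone_inj K L s s' x : s \in edges_of K -> s' \in edges_of L ->
  cone K s x -> cone L s' x -> K = L /\ s = s'.
Proof.
move=> sK s'L Kx Lx; have KL := vol_inj (cone_sub_vol sK Kx) (cone_sub_vol s'L Lx).
split=> //; subst L; move: Kx Lx => [t /= + [z sz <-]] [u /= + [w sw]].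
rewrite !in_itv/= => /andP[t0 t1] /andP[u0 u1] /addrI tu.
have zw : z - Defs.center K = (u / t) *: (w - Defs.center K).
  by rewrite mulrC -scalerA tu scalerA mulVf ?gt_eqF// scale1r.
have wz : w - Defs.center K = (t / u) *: (z - Defs.center K).
  by rewrite mulrC -scalerA -tu scalerA mulVf ?gt_eqF// scale1r.
have [cz nz] := closure_face_sub sK (subset_closure sz).
have [cw nw] := closure_face_sub s'L (subset_closure sw).
have [ut|tu'|ut] := ltgtP u t.
- exfalso; apply: nz; rewrite -[z](subrKC (Defs.center K)) zw.
  apply: segment_vol => //; first exact: center_in.
  by rewrite ltr_pdivrMr// mul1r ut divr_ge0// ltW.
- exfalso; apply: nw; rewrite -[w](subrKC (Defs.center K)) wz.
  apply: segment_vol => //; first exact: center_in.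
  by rewrite ltr_pdivrMr// mul1r tu' divr_ge0// ltW.
- apply: (face_inj sz); suff -> : z = w by [].
  by apply: (addIr (- Defs.center K)); rewrite zw ut divff ?gt_eqF// scale1r.
Qed.

Lemma measurable_cone K s : s \in edges_of K -> measurable (cone K s).
Proof.
move=> sK; apply: (measurable_open_cone (a := nrm s) (c := off s)).
- exact: face_measurable.
- exact: face_hyperplane.
- exact: center_notin_hyperplane.
Qed.

Lemma leb_cone K s : s \in edges_of K -> nrm s ord0 ord0 != 0 ->
  leb R n.+1 (cone K s) = ((dist_face K s / `|nrm s ord0 ord0| / n.+1%:R)%:E *
    leb R n (hproj (nrm s) (off s) (face s)))%E.
Proof.
move=> sK n0; rewrite (leb_open_cone (a := nrm s) (c := off s))//.
- by rewrite normf_div /dist_face distrC.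
- exact: face_measurable.
- exact: face_hyperplane.
- exact: center_notin_hyperplane.
Qed.

End mesh_geometry.

(** * Rays parallel to the first axis and the faces they cross *)

Section chains.
Context (R : realType) (n : nat) (Omega : set 'rV[R]_n.+1).
Variable T : admissible_mesh Omega.
Implicit Types (K L M : cell T) (s : edge T) (x p q : 'rV[R]_n.+1) (y : 'rV[R]_n).

Lemma rV_cons_ext x (r : R) y : x ord0 ord0 = r ->
  (forall i, x ord0 (lift ord0 i) = y ord0 i) -> x = rV_cons (r, y).
Proof.
move=> xr xy; apply/rowP => j; case: (unliftP ord0 j) => [k ->|->].
  by rewrite rV_consS xy.
by rewrite rV_cons0 xr.
Qed.

Lemma rV_cons_segment (r r' t : R) y :
  rV_cons (r, y) + t *: (rV_cons (r', y) - rV_cons (r, y)) =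
  rV_cons (r + t * (r' - r), y).
Proof.
have aff (v w : 'rV[R]_n.+1) i :
    (w + t *: (v - w)) ord0 i = w ord0 i + t * (v ord0 i - w ord0 i) by rewrite !mxE.
apply: rV_cons_ext => [|i]; first by rewrite aff !rV_cons0.
by rewrite aff !rV_consS subrr mulr0 addr0.
Qed.

Lemma dotv_rV_consD x (r r' : R) y :
  dotv x (rV_cons (r', y)) = dotv x (rV_cons (r, y)) + x ord0 ord0 * (r' - r).
Proof. by rewrite !dotv_rV_cons; ring. Qed.

Lemma ball_rV_cons (r r' e : R) y : `|r - r'| < e ->
  ball (rV_cons (r, y)) e (rV_cons (r', y)).
Proof.
move=> rr'; have e0 : 0 < e by rewrite (le_lt_trans _ rr').
apply/rV_ballP => // j; case: (unliftP ord0 j) => [k ->|->].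
  by rewrite !rV_consS subrr normr0.
by rewrite !rV_cons0.
Qed.

(* Near a point lying on a single closed face, each adjacent cell fills its
   whole side of that face. *)
Lemma cell_fills_side s p : closure (face s) p ->
  (forall s', closure (face s') p -> s' = s) ->
  exists2 e, 0 < e & forall M, s \in edges_of M -> forall q, ball p e q ->
    0 < side M s * (off s - dotv (nrm s) q) -> vol M q.
Proof.
move=> sp ps.
have cl : closed (\bigcup_(s' in [set s' | s' != s]) closure (face s')).
  by apply: closed_bigcup => [|s' _]; [exact: finite_finset|exact: closed_closure].
have pN : (~` \bigcup_(s' in [set s' | s' != s]) closure (face s')) p.
  by move=> [s' /= s's /ps]; exact/eqP.
have := closed_openC cl; rewrite openE => /(_ p pN) /nbhs_ballP[e /= e0 he].
exists e => // M sM q pq hq.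
have [cp np] := closure_face_sub sM sp.
have [x [Mx px]] := cp _ (nbhsx_ballx p e e0).
(* If [q] were outside [M], the segment from [x] to [q] would leave [M] through a closed face while
   still in the ball, hence through [s]; but both ends are strictly on the [M] side of its
   hyperplane. *)
apply: contrapT => nq.
have [m [a [b volE]]] := vol_halfspaces M; rewrite volE in Mx nq.
have [t /andP[t0 t1]] := segment_exit Mx nq; rewrite -volE vol_bdry => -[s' s'M s'z].
rewrite -volE in Mx.
have [s's|s's] := eqVneq s' s; last first.
  apply: (he (x + t *: (q - x))); last by exists s'.
  apply/rV_ballP => // i; move/(rV_ballP _ _ e0)/(_ i) : px; move/(rV_ballP _ _ e0)/(_ i) : pq.
  rewrite !mxE !ltr_distl => /andP[? ?] /andP[? ?]; apply/andP; split; nra.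
subst s'; have := closure_face_hyperplane s'z; rewrite /hyperplane/= => hz.
have hx := (face_one_sided sM).2 _ Mx.
have : 0 < side M s * (off s - dotv (nrm s) (x + t *: (q - x))).
  rewrite dotvDr dotvZr dotvBr; nra.
by rewrite hz subrr mulr0 ltxx.
Qed.

(** Selects the lines parallel to the first axis that meet closed faces only transversally and at
    points of the faces themselves. The clauses exclude the relative boundaries of transverse faces
    and the hyperplanes of faces parallel to the axis. *)
Definition generic y := forall s,
  (nrm s ord0 ord0 != 0 -> ~ hproj (nrm s) (off s) (closure (face s) `\` face s) y) /\
  (nrm s ord0 ord0 = 0 -> ~ hyperplane (rV_uncons (nrm s)).2 (off s) y).

(** For transverse faces the nullity in [face_closure] passes to the projection. For a face parallel
    to the axis the tail of the unit normal is nonzero, so a hyperplane of the parameter space is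
    removed. *)
Lemma generic_ae : (leb R n).-negligible [set y | ~ generic y].
Proof.
pose N1 s := if nrm s ord0 ord0 == 0 then set0 else
  hproj (nrm s) (off s) (closure (face s) `\` face s).
pose N2 s := if nrm s ord0 ord0 == 0 then hyperplane (rV_uncons (nrm s)).2 (off s) else set0.
apply: (@negligibleS _ _ _ _ (\bigcup_s (N1 s `|` N2 s))).
  move=> y /existsNP[s] /not_andP[] /not_implyP[h /contrapT hy]; exists s => //.
    by left; rewrite /N1 (negbTE h).
  by right; rewrite /N2 h eqxx.
apply: negligible_bigcup_fin => s.
have mD : measurable (closure (face s) `\` face s).
  apply: measurableD; last exact: face_measurable.
  by apply: closed_measurable_rV; exact: closed_closure.
apply: negligibleU.
  rewrite /N1; case: eqP => [_|/eqP s0]; first exact: negligible_set0.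
  apply/negligibleP; first exact: measurable_hproj.
  apply: hproj_null => //; [exact: nrm_unit| |exact: face_closure].
  by move=> x [cx _]; exact: closure_face_hyperplane.
rewrite /N2; case: eqP => [s0|_]; last exact: negligible_set0.
apply/negligibleP; first exact: measurable_hyperplane.
apply: hyperplane_null; apply: contra_eqN (nrm_unit s) => /eqP h0.
rewrite (_ : nrm s = 0) /enorm.
  by rewrite /dotv big1 ?sqrtr0 1?eq_sym ?oner_eq0// => i _; rewrite !mxE mulr0.
apply/rowP => j; rewrite mxE; case: (unliftP ord0 j) => [k ->|->//].
by move/rowP: h0 => /(_ k); rewrite !mxE.
Qed.

Lemma generic_crossing y (r : R) s : generic y -> closure (face s) (rV_cons (r, y)) ->
  face s (rV_cons (r, y)) /\ nrm s ord0 ord0 != 0.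
Proof.
move=> /(_ s)[g1 g2] cs; have hs := closure_face_hyperplane cs.
have [s0|s0] := eqVneq (nrm s ord0 ord0) 0.
  exfalso; apply: (g2 s0); move: hs.
  by rewrite /hyperplane/= dotv_rV_cons s0 mul0r add0r.
split=> //; apply: contrapT => ns; apply: (g1 s0).
by rewrite /hproj/= -(hgraphE s0 hs).
Qed.

Lemma ray_exit K (r : R) y : vol K (rV_cons (r, y)) ->
  exists2 b, r < b & (closure (vol K) `\` vol K) (rV_cons (b, y)).
Proof.
move=> Kr; have [[M [Mr hM]] _] := vol_polytope K.
pose r' := `|r| + `|M| + 2.
have nq : ~ vol K (rV_cons (r', y)).
  have MM : M < `|M| + 1 by rewrite (le_lt_trans (ler_norm _))// ltrDl.
  move=> /(hM _ MM)/=; apply/negP; rewrite -ltNge; apply: (lt_le_trans _ (normr_rV_coord _ ord0)).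
  rewrite rV_cons0; apply: lt_le_trans (ler_norm _); rewrite /r'; have := normr_ge0 r; have := normr_ge0 M; lra.
have rr' : r < r' by rewrite /r'; have := ler_norm r; have := normr_ge0 M; lra.
have [m [a [b volE]]] := vol_halfspaces K; rewrite volE in Kr nq.
have [t /andP[t0 t1]] := segment_exit Kr nq; rewrite -volE rV_cons_segment => h.
by exists (r + t * (r' - r)) => //; rewrite ltrDl mulr_gt0// subr_gt0.
Qed.

(** The faces strictly ahead on the ray. This finite set shrinks at each crossing, so its cardinal
    bounds the number of steps of the chain. *)
Definition crossed (r : R) y : {set edge T} :=
  [set s | `[< exists2 r', r < r' & face s (rV_cons (r', y)) >]].

Lemma mem_crossed s (r : R) y :
  s \in crossed r y <-> exists2 r', r < r' & face s (rV_cons (r', y)).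
Proof. by rewrite inE; split => [/asboolP|h]; [|apply/asboolP]. Qed.

Lemma interior_neighbour K s : s \in edges_of K -> s \notin ext T ->
  exists L t, [/\ K <> L, s \in edges_of L & Defs.center L - Defs.center K = t *: nrm s].
Proof.
move=> sK /int_face[K1 [K2 [K12 + _ [t ct]]]] => E.
have : K \in [set M | s \in edges_of M]%SET by rewrite inE.
have sK1 : s \in edges_of K1.
  have : K1 \in [set M | s \in edges_of M]%SET by rewrite E !inE eqxx.
  by rewrite inE.
have sK2 : s \in edges_of K2.
  have : K2 \in [set M | s \in edges_of M]%SET by rewrite E !inE eqxx orbT.
  by rewrite inE.
rewrite E !inE => /orP[]/eqP ->; first by exists K2, t; split=> //; exact/eqP.
exists K1, (- t); split=> //; first by apply/eqP; rewrite eq_sym.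
by rewrite scaleNr -ct opprB.
Qed.

(* The half-edges (K, s), (L, s), ... crossed by the ray issued from a point of
   K up to its first exterior face; the distances telescope. *)
Lemma half_edge_chain (w : dofs T) y : XT w -> generic y -> forall N K (r : R),
  vol K (rV_cons (r, y)) -> (#|crossed r y| <= N)%N ->
  exists C : {set cell T * edge T},
  [/\ forall h, h \in C -> [/\ h.2 \in edges_of h.1, nrm h.2 ord0 ord0 != 0 &
        exists2 r', r < r' & face h.2 (rV_cons (r', y))],
      `|w.1 K| <= \sum_(h in C) `|w.2 h.2 - w.1 h.1| &
      exists2 z, closure Omega z &
        \sum_(h in C) dist_face h.1 h.2 * `|nrm h.2 ord0 ord0| =
        (z - Defs.center K) ord0 ord0].
Proof.
move=> Xw gy; elim=> [|N IH] K r Kr cN.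
all: have [b rb bK] := ray_exit Kr.
all: have [s sK sb] : exists2 s, s \in edges_of K & closure (face s) (rV_cons (b, y)).
1,3: by move: bK; rewrite vol_bdry => -[s sK sb]; exists s.
all: have [fs s0] := generic_crossing gy sb.
all: have scr : s \in crossed r y by apply/mem_crossed; exists b.
  by exfalso; move: cN; rewrite leqn0 cards_eq0 => /eqP c0; rewrite c0 inE in scr.
have us s' : closure (face s') (rV_cons (b, y)) -> s' = s.
  by move=> /(generic_crossing gy)[fs' _]; exact: face_inj fs' fs.
have hb : dotv (nrm s) (rV_cons (b, y)) = off s by exact: face_hyperplane fs.
have [side0 hK] := face_one_sided sK.
have n0 : `|nrm s ord0 ord0| = side K s * nrm s ord0 ord0.
  have : 0 < side K s * nrm s ord0 ord0.
    have := hK _ Kr; rewrite -hb (dotv_rV_consD _ r b) addrAC subrr add0r mulrA.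
    by rewrite pmulr_lgt0// subr_gt0.
  move=> h; rewrite -[RHS]gtr0_norm// normrM (_ : `|side K s| = 1) ?mul1r//.
  by apply/eqP; rewrite -(@eqrXn2 _ 2)// -normrX expr2 side_sqr// normr1 expr1n.
have sn0 : 0 < side K s * nrm s ord0 ord0 by rewrite -n0 normr_gt0.
have [sext|sint] := boolP (s \in ext T).
  exists [set (K, s)]%SET; rewrite !big_set1 /=; split.
  - by move=> h; rewrite inE => /eqP -> /=; split=> //; exists b.
  - by rewrite (Xw _ sext) sub0r normrN.
  (* The orthogonal foot of the centre belongs to the exterior face, hence to the closure of
     [Omega]; it is the witness [z] ending the telescoping sum. *)
  have [K' [EK _ [t ft]]] := ext_face sext.
  have : K \in [set L | s \in edges_of L]%SET by rewrite inE.
  rewrite EK inE => /eqP KK'; subst K'.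
  exists (Defs.center K + t *: nrm s).
    by apply/face_sub/ft.
  have := face_hyperplane ft; rewrite /hyperplane/= dotvDr dotvZr.
  rewrite (enorm1 (nrm_unit s)) mulr1 => ht.
  rewrite dist_faceE n0 mulrACA side_sqr// mul1r -ht addrAC subrr add0r.
  by rewrite addrC addKr mxE.
have [L [t [KL sL ct]]] := interior_neighbour sK sint.
have [e e0 he] := cell_fills_side sb us.
have be (u : R) : `|u| < e -> ball (rV_cons (b, y)) e (rV_cons (b + u, y)).
  by move=> ue; apply: ball_rV_cons; rewrite opprD addNKr normrN.
have hu (u : R) : off s - dotv (nrm s) (rV_cons (b + u, y)) = - (nrm s ord0 ord0 * u).
  by rewrite (dotv_rV_consD _ b) hb; ring.
have e2 : 0 < e / 2 by rewrite divr_gt0.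
have e2e : e / 2 < e by rewrite ltr_pdivrMr// ltr_pMr// ltr1n.
(* On equal sides of the face, both cells would contain the points of the ray just before the
   crossing, against disjointness. *)
have sideL : side L s = - side K s.
  have /eqP : (side L s - side K s) * (side L s + side K s) = 0.
    by rewrite -subr_sqr !expr2 !side_sqr// subrr.
  rewrite mulf_eq0 subr_eq0 addr_eq0 => /orP[/eqP LK|/eqP//].
  exfalso; apply: KL; apply: (@vol_inj _ _ _ T _ _ (rV_cons (b + - (e / 2), y))).
    apply: he => //; first by apply: be; rewrite normrN gtr0_norm.
    by rewrite hu -mulrN opprK mulrA mulr_gt0.
  apply: he => //; first by apply: be; rewrite normrN gtr0_norm.
  by rewrite hu -mulrN opprK LK mulrA mulr_gt0.
have Lq : vol L (rV_cons (b + e / 2, y)).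
  apply: he => //; first by apply: be; rewrite gtr0_norm.
  by rewrite hu sideL mulrNN mulrA mulr_gt0.
have bb : b < b + e / 2 by rewrite ltrDl.
have sub : crossed (b + e / 2) y \proper crossed r y.
  apply/properP; split.
    apply/fintype.subsetP => s' /mem_crossed[r' r'b fr']; apply/mem_crossed.
    by exists r' => //; rewrite (lt_trans rb)// (lt_trans bb).
  exists s => //; apply/negP => /mem_crossed[r' r'b fr'].
  have := face_hyperplane fr'; rewrite /hyperplane/= (dotv_rV_consD _ b) hb.
  move=> /eqP; rewrite -subr_eq0 addrAC subrr add0r mulf_eq0 (negbTE s0)/= subr_eq0.
  by rewrite gt_eqF// (lt_trans bb).
have [|C [C1 C2 [z cz C3]]] := IH L _ Lq.
  by rewrite -ltnS; apply: leq_trans cN; exact: proper_card.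
(* [C] only involves faces met beyond the crossing point, and the ray meets the hyperplane of [s]
   once. *)
have sC M : (M, s) \notin C.
  apply/negP => /C1[_ _ [r' r'b fr']].
  have := face_hyperplane fr'; rewrite /hyperplane/= (dotv_rV_consD _ b) hb.
  move=> /eqP; rewrite -subr_eq0 addrAC subrr add0r mulf_eq0 (negbTE s0)/= subr_eq0.
  by rewrite gt_eqF// (lt_trans bb).
have KC : (K, s) \notin ((L, s) |: C)%SET.
  by rewrite !inE negb_or sC andbT; apply/eqP => -[].
exists ((K, s) |: ((L, s) |: C))%SET; rewrite !big_setU1//=; split.
- move=> h; rewrite !inE => /orP[/eqP ->|/orP[/eqP ->|/C1[? ? [r' r'b fr']]]] /=.
  + by split=> //; exists b.
  + by split=> //; exists b.
  + by split=> //; exists r' => //; rewrite (lt_trans rb)// (lt_trans bb).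
- rewrite [X in `|X| <= _](_ : w.1 K = - (w.2 s - w.1 K) + ((w.2 s - w.1 L) + w.1 L)); last by ring.
  rewrite (le_trans (ler_normD _ _))// normrN lerD2l.
  by rewrite (le_trans (ler_normD _ _))// lerD2l.
- exists z => //; rewrite C3 !dist_faceE sideL n0.
  have nt : dotv (nrm s) (Defs.center L) = dotv (nrm s) (Defs.center K) + t.
    rewrite -[Defs.center L](subrK (Defs.center K)) ct dotvDr dotvZr.
    by rewrite (enorm1 (nrm_unit s)) mulr1 addrC.
  have c00 : (Defs.center L) ord0 ord0 = (Defs.center K) ord0 ord0 + t * nrm s ord0 ord0.
    by rewrite -[Defs.center L](subrK (Defs.center K)) ct !mxE addrC.
  rewrite !mxE c00 nt.
  have := side_sqr sK; set u := side K s => uu.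
  (* The sign [u] occurs once in the distances and once in the absolute value of the normal
     component; inserting [u * u = 1] aligns the two sides. *)
  rewrite (_ : t * nrm s ord0 ord0 = u * u * (t * nrm s ord0 ord0)); last by rewrite uu mul1r.
  by ring.
Qed.

End chains.

(** * Discrete Poincare inequality *)

Lemma integral_sum_indic d (U : measurableType d) (R : realType)
    (mu : {measure set U -> \bar R}) (I : finType) (P : pred I) (k : I -> R)
    (A : I -> set U) :
  (forall i, P i -> 0 <= k i) -> (forall i, P i -> measurable (A i)) ->
  (\int[mu]_x (\sum_(i | P i) k i * \1_(A i) x)%:E =
   \sum_(i | P i) (k i)%:E * mu (A i))%E.
Proof.
move=> k0 mA.
(* Terms outside [P] become zero on the empty set, since nothing is assumed about them. *)
pose k' i := if P i then k i else 0; pose A' i := if P i then A i else set0.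
have k'0 i : 0 <= k' i by rewrite /k'; case: ifPn => // /k0.
have mA' i : measurable (A' i) by rewrite /A'; case: ifPn => // /mA.
transitivity (\int[mu]_x (\sum_(i <- index_enum I) (k' i * \1_(A' i) x)%:E))%E.
  apply: eq_integral => x _; rewrite sumEFin big_mkcond /=; congr EFin.
  by apply: eq_bigr => i _; rewrite /k' /A'; case: ifPn => // _; rewrite mul0r.
rewrite ge0_integral_sum//; last 2 first.
- by move=> i; apply/measurable_EFinP; apply: measurable_funM => //.
- by move=> i x _; rewrite lee_fin mulr_ge0.
rewrite [RHS]big_mkcond /=; apply: eq_bigr => i _.
under eq_integral do rewrite EFinM.
rewrite ge0_integralZl_EFin//; last by apply/measurable_EFinP.
rewrite integral_indic// setIT /k' /A'; case: ifPn => // _.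
by rewrite mul0e.
Qed.

Lemma sum_indic_sqr (U : Type) (R : realType) (I : finType) (P : pred I) (k : I -> R)
    (A : I -> set U) x :
  (forall i j, P i -> P j -> A i x -> A j x -> i = j) ->
  (\sum_(i | P i) k i * \1_(A i) x) ^+ 2 = \sum_(i | P i) k i ^+ 2 * \1_(A i) x.
Proof.
move=> dis; have [[i Pi Ai]|none] := pselect (exists2 i, P i & A i x).
  have z j : P j && (j != i) -> \1_(A j) x = 0 :> R.
    move=> /andP[Pj ji]; rewrite indicE memNset// => Aj.
    by move/eqP: ji; apply; exact: dis.
  rewrite (bigD1 i)//= [RHS](bigD1 i)//= !big1 ?addr0.
  - by rewrite indicE mem_set// !mulr1.
  - by move=> j /z ->; rewrite mulr0.
  - by move=> j /z ->; rewrite mulr0.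
have z j : P j -> \1_(A j) x = 0 :> R.
  by move=> Pj; rewrite indicE memNset// => Aj; apply: none; exists j.
rewrite !big1 ?expr0n// => j /z ->; by rewrite mulr0.
Qed.

(* With S the sum of the a_i and D the sum of the weights,
   0 <= sum_i m_i (D a_i / m_i - S)^2. *)
Lemma sqr_sum_le_weighted (R : realFieldType) (I : finType) (C : {set I})
    (a m : I -> R) (D : R) :
  (forall i, i \in C -> 0 < m i) -> \sum_(i in C) m i <= D ->
  (\sum_(i in C) a i) ^+ 2 <= D * \sum_(i in C) a i ^+ 2 / m i.
Proof.
move=> m0 mD; set S := \sum_(i in C) a i; set Q := \sum_(i in C) _.
set M := \sum_(i in C) m i in mD.
have Q0 : 0 <= Q.
  by apply: sumr_ge0 => i /m0 mi; rewrite divr_ge0 ?sqr_ge0// ltW.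
apply: (@le_trans _ _ (M * Q)); last by rewrite ler_wpM2r.
have [C0|[i0 iC]] := set_0Vmem C.
  by rewrite /S /M /Q C0 !big_set0 expr0n mul0r.
have M0 : 0 < M.
  rewrite /M (bigD1 i0)//= ltr_wpDr ?m0//.
  by apply: sumr_ge0 => i /andP[/m0/ltW].
have : 0 <= \sum_(i in C) m i * (M * a i / m i - S) ^+ 2.
  by apply: sumr_ge0 => i /m0 mi; rewrite mulr_ge0 ?sqr_ge0// ltW.
rewrite (_ : \sum_(i in C) _ = M * (M * Q - S ^+ 2)); first by rewrite pmulr_rge0// subr_ge0.
transitivity (\sum_(i in C) (M ^+ 2 * (a i ^+ 2 / m i) - 2 * M * S * a i + S ^+ 2 * m i)).
  have aux (u v M' S' : R) : v != 0 ->
      v * (M' * u / v - S') ^+ 2 = M' ^+ 2 * (u ^+ 2 / v) - 2 * M' * S' * u + S' ^+ 2 * v.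
    by move=> ?; field.
  by apply: eq_bigr => i /m0 mi; rewrite aux ?gt_eqF.
rewrite big_split sumrB -!mulr_sumr -/Q -/S -/M /=; ring.
Qed.

Section poincare.
Context (R : realType) (n : nat) (Omega : set 'rV[R]_n.+1).
Hypotheses (bO : bounded_set Omega) (oO : open Omega) (O0 : Omega !=set0).
Variable T : admissible_mesh Omega.
Implicit Types (K L M : cell T) (s : edge T) (x : 'rV[R]_n.+1) (y : 'rV[R]_n).

(** A face together with one cell that it bounds: an interior face gives two half-edges, an exterior
    one gives one, and each carries one cone. *)
Definition half_edge : pred (cell T * edge T) := fun h => h.2 \in edges_of h.1.

Definition half_cone (h : cell T * edge T) := cone h.1 h.2.

Lemma GT_sum (v : dofs T) x : GT v x =
  \sum_(h | half_edge h) (v.2 h.2 - v.1 h.1) / dist_face h.1 h.2 * \1_(half_cone h) x.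
Proof. by rewrite /GT pair_big_dep. Qed.

Lemma half_cone_inj x h h' : half_edge h -> half_edge h' -> half_cone h x ->
  half_cone h' x -> h = h'.
Proof.
move: h h' => [K s] [L s']; rewrite /half_edge /half_cone /= => sK s'L Kx Lx.
by have [-> ->] := cone_inj sK s'L Kx Lx.
Qed.

Lemma measurable_half_cone h : half_edge h -> measurable (half_cone h).
Proof. exact: measurable_cone. Qed.

Lemma half_cone_sub h : half_edge h -> half_cone h `<=` Omega.
Proof. by move=> hh x /(cone_sub_vol hh) /vol_sub. Qed.

Lemma fun_of_vol (v : dofs T) K x : vol K x -> fun_of v x = v.1 K.
Proof.
move=> Kx; rewrite /fun_of (bigD1 K)//= indicE mem_set// mulr1 big1 ?addr0// => L LK.
by rewrite indicE memNset ?mulr0// => Lx; move/eqP: LK; apply; exact: (vol_inj Lx Kx).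
Qed.

Lemma fun_of_notin (v : dofs T) x : (forall K, ~ vol K x) -> fun_of v x = 0.
Proof. by move=> h; rewrite /fun_of big1// => K _; rewrite indicE memNset// mulr0. Qed.

Lemma measurable_fun_of (v : dofs T) : measurable_fun setT (fun_of v).
Proof.
apply: measurable_sum => K; apply: measurable_funM => //.
by apply: measurable_indic; apply: open_measurable_rV; exact: open_vol.
Qed.

(** The origins whose ray meets the face within distance [diam Omega]. All origins in [Omega] that
    see the face are included, and the constant thickness makes the measure explicit. *)
Definition shadow s : set 'rV[R]_n.+1 := [set x |
  hproj (nrm s) (off s) (face s) (rV_uncons x).2 /\
  0 <= (hgraph (nrm s) (off s) (rV_uncons x).2) ord0 ord0 - x ord0 ord0 <= diam Omega].

Lemma shadow_cons s (r : R) y : shadow s (rV_cons (r, y)) =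
  (hproj (nrm s) (off s) (face s) y /\
   0 <= hgraph (nrm s) (off s) y ord0 ord0 - r <= diam Omega).
Proof. by rewrite /shadow /mkset rV_unconsK rV_cons0. Qed.

Lemma measurable_rV_tail : measurable_fun setT (fun x => (rV_uncons x).2).
Proof. exact: (measurableT_comp (@measurable_snd _ _ _ _) (@measurable_rV_uncons R n)). Qed.

Lemma measurable_shadow s : measurable (shadow s).
Proof.
have mh : measurable_fun setT
    (fun x => (hgraph (nrm s) (off s) (rV_uncons x).2) ord0 ord0 - x ord0 ord0).
  apply: measurable_funB; last exact: measurable_rV_coord.
  apply: (measurableT_comp (@measurable_rV_coord R n.+1 ord0)).
  by apply: (measurableT_comp (measurable_hgraph _ _)); exact: measurable_rV_tail.
rewrite (_ : shadow s = (fun x => (rV_uncons x).2) @^-1` hproj (nrm s) (off s) (face s) `&`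
  (fun x => (hgraph (nrm s) (off s) (rV_uncons x).2) ord0 ord0 - x ord0 ord0) @^-1`
     `[0, diam Omega]%classic).
  apply: measurableI; rewrite -[X in measurable X]setTI.
    by apply: measurable_rV_tail => //; apply: measurable_hproj; exact: face_measurable.
  exact: mh.
by apply/seteqP; split=> x; rewrite /shadow /= in_itv.
Qed.

Lemma leb_shadow s : leb R n.+1 (shadow s) =
  ((diam Omega)%:E * leb R n (hproj (nrm s) (off s) (face s)))%E.
Proof.
have D0 := diam_gt0 bO ord0 oO O0.
have mP : measurable (hproj (nrm s) (off s) (face s)).
  by apply: measurable_hproj; exact: face_measurable.
rewrite leb_slice; last exact: measurable_shadow.
rewrite -integral_cst// integral_mkcond; apply: eq_integral => y _.
rewrite patchE; case: ifPn => [/set_mem yP|/negP yP]; last first.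
  rewrite (_ : rV_slice _ _ = set0) ?measure0//; apply/seteqP; split=> // r.
  by rewrite /rV_slice /= shadow_cons => -[hy _]; apply: yP; apply/mem_set.
set g := hgraph (nrm s) (off s) y ord0 ord0.
rewrite (_ : rV_slice _ _ = `[g - diam Omega, g]%classic); last first.
  apply/seteqP; split=> r; rewrite /rV_slice /= shadow_cons -/g in_itv/=.
    by move=> [_ /andP[? ?]]; apply/andP; split; lra.
  by move=> /andP[? ?]; split=> //; apply/andP; split; lra.
rewrite lebesgue_measure_itv/= lte_fin ltrBlDr ltrDl D0 -EFinD.
by rewrite opprB addrC subrK.
Qed.

Definition transverse h := half_edge h && (nrm h.2 ord0 ord0 != 0).

(** Weighted Cauchy-Schwarz along the chain. The weights [dist_face * |nrm_0|] are those whose sum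
    telescopes to at most [diam Omega]; the chain is then enlarged to all transverse half-edges
    whose shadow contains [x]. *)
Lemma fun_of_sqr_le (w : dofs T) x : XT w -> generic T (rV_uncons x).2 ->
  fun_of w x ^+ 2 <= \sum_(h | transverse h) (diam Omega *
    ((w.2 h.2 - w.1 h.1) ^+ 2 / (dist_face h.1 h.2 * `|nrm h.2 ord0 ord0|))) *
    \1_(shadow h.2) x.
Proof.
move=> Xw gx; have D0 := diam_gt0 bO ord0 oO O0.
have w0 h : transverse h -> 0 < dist_face h.1 h.2 * `|nrm h.2 ord0 ord0|.
  by move=> /andP[hh n0]; rewrite mulr_gt0 ?dist_face_gt0 ?normr_gt0.
have t0 h : transverse h -> 0 <= (diam Omega *
    ((w.2 h.2 - w.1 h.1) ^+ 2 / (dist_face h.1 h.2 * `|nrm h.2 ord0 ord0|))) *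
    \1_(shadow h.2) x.
  move=> /w0 h0; apply: mulr_ge0 => //; apply: mulr_ge0; first exact: ltW.
  by apply: divr_ge0; [exact: sqr_ge0|exact: ltW].
have [[K Kx]|none] := pselect (exists K : cell T, vol K x); last first.
  rewrite fun_of_notin; last by move=> K Kx; apply: none; exists K.
  by rewrite expr0n sumr_ge0.
rewrite (fun_of_vol _ Kx).
have [r [y xE]] := rV_consP x; subst x; rewrite rV_unconsK /= in gx *.
have [C [C1 C2 [z cz C3]]] := half_edge_chain Xw gx Kx (leqnn _).
have CT h : h \in C -> transverse h by move=> /C1[? ? _]; apply/andP.
have OK : Omega (Defs.center K) by apply: vol_sub; exact: center_in.
rewrite -[leLHS]ger0_norm ?sqr_ge0// normrX.
apply: (le_trans (y := (\sum_(h in C) `|w.2 h.2 - w.1 h.1|) ^+ 2)).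
  by rewrite ler_pXn2r ?nnegrE ?sumr_ge0.
apply: (le_trans (sqr_sum_le_weighted
  (m := fun h => dist_face h.1 h.2 * `|nrm h.2 ord0 ord0|) (D := diam Omega) _ _ _)).
- by move=> h /CT/w0.
- rewrite C3 (le_trans (ler_norm _))// (le_trans (normr_coord_enorm _ _))//.
  by apply: enorm_le_diam => //; exact: subset_closure.
rewrite [leRHS](bigID (fun h => h \in C))/= -[leLHS]addr0; apply: lerD; last first.
  by apply: sumr_ge0 => h /andP[/t0].
rewrite mulr_sumr [leRHS](eq_bigl (fun h => h \in C)); last first.
  by move=> h; apply/andP/idP => [[]//|hC]; split=> //; exact: CT.
apply: ler_sum => h hC; have [hh n0 [r' rr' fr']] := C1 _ hC.
rewrite -normrX (ger0_norm (sqr_ge0 _)) indicE mem_set ?mulr1//.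
have hg := hgraphE n0 (face_hyperplane fr').
rewrite shadow_cons -hg; split; first by rewrite /hproj/= -hg.
rewrite !rV_cons0 subr_ge0 (ltW rr') /=.
have := enorm_le_diam bO (face_sub fr') (subset_closure (vol_sub Kx)).
apply: le_trans; apply: le_trans (normr_coord_enorm _ ord0).
by rewrite [X in `|X|]mxE [X in `|_ + X|]mxE !rV_cons0 ler_norm.
Qed.

Lemma generic_tail_ae : (leb R n.+1).-negligible
  [set x | ~ generic T (rV_uncons x).2].
Proof.
have [N [mN N0 hN]] := generic_ae T.
have mN' : measurable [set x : 'rV[R]_n.+1 | N (rV_uncons x).2].
  by rewrite -[X in measurable X]setTI; exact: measurable_rV_tail.
exists [set x | N (rV_uncons x).2]; split=> //; last by move=> x /hN.
rewrite leb_slice2//; apply: integral0_eq => r _.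
by rewrite -[RHS]N0; congr (leb R n _); apply/seteqP; split=> y; rewrite /mkset rV_unconsK.
Qed.

Lemma discrete_poincare (w : dofs T) : XT w ->
  (\int[leb R n.+1]_x (fun_of w x ^+ 2)%:E <=
   (diam Omega ^+ 2 * n.+1%:R)%:E * \int[leb R n.+1]_x (GT w x ^+ 2)%:E)%E.
Proof.
move=> Xw; have D0 := diam_gt0 bO ord0 oO O0.
pose k h := diam Omega *
  ((w.2 h.2 - w.1 h.1) ^+ 2 / (dist_face h.1 h.2 * `|nrm h.2 ord0 ord0|)).
have k0 h : transverse h -> 0 <= k h.
  move=> /andP[hh n0]; apply: mulr_ge0; first exact: ltW.
  apply: divr_ge0; first exact: sqr_ge0.
  by rewrite ltW// mulr_gt0 ?dist_face_gt0 ?normr_gt0.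
have GE : (\int[leb R n.+1]_x (GT w x ^+ 2)%:E = \sum_(h | half_edge h)
    (((w.2 h.2 - w.1 h.1) / dist_face h.1 h.2) ^+ 2)%:E * leb R n.+1 (half_cone h))%E.
  rewrite -integral_sum_indic; last 2 first.
  - by move=> h _; exact: sqr_ge0.
  - by move=> h; exact: measurable_half_cone.
  apply: eq_integral => x _; congr EFin; rewrite GT_sum sum_indic_sqr// => h h'.
  exact: half_cone_inj.
apply: (@le_trans _ _ (\sum_(h | transverse h) (k h)%:E * leb R n.+1 (shadow h.2))%E).
  rewrite -integral_sum_indic//; last by move=> h _; exact: measurable_shadow.
  apply: ae_ge0_le_integral => //.
  - by move=> x _; rewrite lee_fin sqr_ge0.
  - by apply/measurable_EFinP; apply: measurable_funX; exact: measurable_fun_of.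
  - by move=> x _; rewrite lee_fin; apply: sumr_ge0 => h /k0 ?; rewrite mulr_ge0.
  - apply/measurable_EFinP; under eq_fun do rewrite big_mkcond; apply: measurable_sum => h.
    case: (transverse h) => //; apply: measurable_funM => //.
    by apply: measurable_indic; exact: measurable_shadow.
  - apply: (negligibleS _ generic_tail_ae) => x /= + gx; apply => _.
    by rewrite lee_fin; exact: fun_of_sqr_le.
rewrite GE ge0_sume_distrr; last first.
  by move=> h _; rewrite mule_ge0 ?measure_ge0// lee_fin sqr_ge0.
(* Half-edges parallel to the axis occur only on the right, with nonnegative terms. *)
rewrite [leRHS](bigID (fun h => nrm h.2 ord0 ord0 != 0))/=.
rewrite -[leLHS]adde0; apply: leeD; last first.
  apply: sume_ge0 => h _; rewrite mule_ge0 ?mule_ge0 ?measure_ge0 ?lee_fin ?sqr_ge0//.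
  by rewrite mulr_ge0 ?sqr_ge0.
apply: lee_sum => h /andP[hh n0]; rewrite leb_shadow /half_cone leb_cone// !muleA -!EFinM.
apply: lee_wpmul2r; first exact: measure_ge0.
(* The transverse terms agree exactly: with [m = |nrm_0|], both coefficients equal
   [diam^2 (w_s - w_K)^2 / (d_{K,s} m)]. *)
rewrite lee_fin /k le_eqVlt; apply/orP; left; apply/eqP.
have d0 : dist_face h.1 h.2 != 0 by rewrite gt_eqF// dist_face_gt0.
have m0 : `|nrm h.2 ord0 ord0| != 0 by rewrite normr_eq0.
have N0 : n.+1%:R != 0 :> R by rewrite pnatr_eq0.
by field; rewrite m0 d0 -natr1 addrC in N0 *; rewrite N0.
Qed.

End poincare.

(** * Square-integrable functions, test functions and weak derivatives *)

(** For [C > 0], evaluation at [(C, - B)] gives [C (A C - B^2)]. For [C = 0] the form is affine in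
    [b], and a nonzero [B] would let it reach [-1]. *)
Lemma discriminant_le (R : realFieldType) (A B C : R) :
  (forall a b, 0 <= a ^+ 2 * A + 2 * (a * b) * B + b ^+ 2 * C) -> B ^+ 2 <= A * C.
Proof.
move=> h.
have C0 : 0 <= C by have := h 0 1; rewrite expr0n mul0r !mul0r mulr0 mul0r !add0r expr1n mul1r.
have [Cp|] := ltP 0 C.
  have := h C (- B); rewrite (_ : _ + _ + _ = C * (A * C - B ^+ 2)); last by ring.
  by rewrite pmulr_rge0// subr_ge0.
move=> Cn; have {}C0 : C = 0 by apply/eqP; rewrite eq_le Cn C0.
have [->|B0] := eqVneq B 0; first by rewrite expr0n C0 mulr0.
have := h 1 (- (A + 1) / (2 * B)).
rewrite C0 mulr0 addr0 (_ : _ + _ = - 1); last by field.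
by rewrite oppr_ge0 ler10.
Qed.

(** * Square-integrable functions on the domain *)

Section L2_space.
Context (R : realType) (d : nat) (Omega : set 'rV[R]_d).
Hypothesis mO : measurable Omega.
Local Notation mu := (leb R d).
Implicit Types u v f : 'rV[R]_d -> R.

Lemma sqr_restrict u x : (u \_ Omega) x ^+ 2 = ((fun x => u x ^+ 2) \_ Omega) x.
Proof. by rewrite !patchE; case: ifPn => // _; rewrite /= expr0n. Qed.

Lemma integrable_restrict u : mu.-integrable Omega (EFin \o u) <->
  mu.-integrable setT (EFin \o (u \_ Omega)).
Proof.
rewrite integrable_mkcond// restrict_EFin; split => //.
Qed.

Lemma L2P u : L2 Omega u <->
  measurable_fun Omega u /\ mu.-integrable Omega (fun x => (u x ^+ 2)%:E).
Proof.
have mE : measurable_fun Omega u <-> measurable_fun setT (u \_ Omega).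
  exact: measurable_restrictT.
have iE : mu.-integrable Omega (fun x => (u x ^+ 2)%:E) <->
    mu.-integrable setT (fun x => ((u \_ Omega) x ^+ 2)%:E).
  rewrite (_ : (fun x => ((u \_ Omega) x ^+ 2)%:E) = EFin \o ((fun x => u x ^+ 2) \_ Omega)); last first.
    by apply/funext => x /=; rewrite sqr_restrict.
  exact: integrable_restrict.
rewrite mE iE /L2 /=; split=> [h|[mu' iu]].
  split; last exact: Lfun2_integrable_sqr.
  by move: h; rewrite inE => /andP[/[!inE]/= + _].
apply/andP; split; rewrite inE//= /finite_norm.
rewrite unlock; apply: poweR_lty.
have /integrableP[_] := iu.
apply: le_lt_trans; apply: ge0_le_integral => //=.
- apply/measurable_EFinP; apply: (measurableT_comp (measurable_powR 2)).
  exact: measurableT_comp.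
- by apply/measurable_EFinP; apply: measurableT_comp => //; exact: measurable_funX.
- by move=> x _; rewrite lee_fin powR_mulrn// normrX.
Qed.

Lemma L2_measurable u : L2 Omega u -> measurable_fun Omega u.
Proof. by move=> /L2P[]. Qed.

Lemma L2norm_ge0 u : 0 <= L2norm Omega u.
Proof. by rewrite fine_ge0// Lnorm_ge0. Qed.

Lemma L2norm_sqr u : L2 Omega u ->
  L2norm Omega u ^+ 2 = \int[mu]_(x in Omega) (u x ^+ 2).
Proof.
move=> L2u; have [_ iu] := (L2P u).1 L2u.
have N0 := Lnorm_ge0 mu 2%:E (EFin \o (u \_ Omega)).
have Nfin : ('N[mu]_2%:E[EFin \o (u \_ Omega)] \is a fin_num)%E.
  by rewrite ge0_fin_numE//; move: L2u; rewrite /L2/= inE => /andP[_]; rewrite inE.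
have E := @powR_Lnorm _ _ _ mu (EFin \o (u \_ Omega)) 2 _.
rewrite /L2norm -powR_mulrn ?fine_ge0// -fine_poweR E ?pnatr_eq0//.
rewrite /Rintegral [in RHS]integral_mkcond; congr fine; apply: eq_integral => x _.
rewrite restrict_EFin /= powR_mulrn//; congr EFin.
by rewrite -sqr_restrict -normrX ger0_norm ?sqr_ge0.
Qed.

Lemma L2M_integrable u v : L2 Omega u -> L2 Omega v ->
  mu.-integrable Omega (fun x => (u x * v x)%:E).
Proof.
move=> /L2P[mu' iu] /L2P[mv iv].
apply: (@le_integrable _ _ _ mu _ mO _ (fun x => (u x ^+ 2 + v x ^+ 2)%:E)).
- by apply/measurable_EFinP; exact: measurable_funM.
- move=> x _; rewrite lee_fin [leRHS]ger0_norm ?addr_ge0 ?sqr_ge0//.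
  rewrite normrM -(real_normK (num_real (u x))) -(real_normK (num_real (v x))).
  have := sqr_ge0 (`|u x| - `|v x|); have := sqr_ge0 (`|u x|); have := sqr_ge0 (`|v x|); nra.
- exact: (integrableD mO iu iv).
Qed.

Lemma L2_comb a b u v : L2 Omega u -> L2 Omega v -> L2 Omega (fun x => a * u x + b * v x).
Proof.
move=> L2u L2v; apply/L2P.
have mu' := L2_measurable L2u; have mv := L2_measurable L2v.
split; first by apply: measurable_funD; apply: measurable_funM.
have -> : (fun x => ((a * u x + b * v x) ^+ 2)%:E) = (fun x =>
    ((a ^+ 2)%:E * (u x * u x)%:E + (2 * (a * b))%:E * (u x * v x)%:E + (b ^+ 2)%:E * (v x * v x)%:E)%E).
  by apply/funext => x; rewrite -!EFinM -!EFinD; congr EFin; ring.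
apply: integrableD => //; first apply: integrableD => //.
all: by apply: integrableZl => //; exact: L2M_integrable.
Qed.

Lemma L2D u v : L2 Omega u -> L2 Omega v -> L2 Omega (u \+ v).
Proof.
move=> L2u L2v; have := L2_comb 1 1 L2u L2v.
by congr (L2 _ _); apply/funext => x /=; rewrite !mul1r.
Qed.

Lemma L2B u v : L2 Omega u -> L2 Omega v -> L2 Omega (u \- v).
Proof.
move=> L2u L2v; have := L2_comb 1 (-1) L2u L2v.
by congr (L2 _ _); apply/funext => x /=; rewrite !mul1r mulN1r.
Qed.

Lemma L2Z a u : L2 Omega u -> L2 Omega (fun x => a * u x).
Proof.
move=> L2u; have := L2_comb a 0 L2u L2u.
by congr (L2 _ _); apply/funext => x /=; rewrite mul0r addr0.
Qed.

Lemma L2_cauchy_schwarz u v : L2 Omega u -> L2 Omega v ->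
  `|\int[mu]_(x in Omega) (u x * v x)| <= L2norm Omega u * L2norm Omega v.
Proof.
move=> L2u L2v.
rewrite -(@ler_pXn2r _ 2) ?nnegrE ?mulr_ge0 ?L2norm_ge0//.
rewrite -normrX ger0_norm ?sqr_ge0// exprMn !L2norm_sqr//.
apply: discriminant_le => a b.
rewrite -!RintegralZl//; last 3 first.
- exact: ((L2P v).1 L2v).2.
- exact: L2M_integrable.
- exact: ((L2P u).1 L2u).2.
have i1 : mu.-integrable Omega (EFin \o (fun x => a ^+ 2 * u x ^+ 2)).
  by apply: (integrableZl mO _ ((L2P u).1 L2u).2).
have i2 : mu.-integrable Omega (EFin \o (fun x => 2 * (a * b) * (u x * v x))).
  by apply: (integrableZl mO _ (L2M_integrable L2u L2v)).
have i3 : mu.-integrable Omega (EFin \o (fun x => b ^+ 2 * v x ^+ 2)).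
  by apply: (integrableZl mO _ ((L2P v).1 L2v).2).
rewrite -!RintegralD//; last exact: (integrableD mO i1 i2).
apply: Rintegral_ge0 => x _.
by rewrite (_ : _ + _ = (a * u x + b * v x) ^+ 2) ?sqr_ge0//; ring.
Qed.

Lemma L2norm_triangle u v : L2 Omega u -> L2 Omega v ->
  L2norm Omega (u \+ v) <= L2norm Omega u + L2norm Omega v.
Proof.
move=> L2u L2v.
rewrite -(@ler_pXn2r _ 2) ?nnegrE ?addr_ge0 ?L2norm_ge0// sqrrD !L2norm_sqr//; last exact: L2D.
have iu := ((L2P u).1 L2u).2; have iv := ((L2P v).1 L2v).2.
have iuv := L2M_integrable L2u L2v.
have i2 : mu.-integrable Omega (EFin \o (fun x => 2 * (u x * v x))).
  exact: (integrableZl mO _ iuv).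
have i3 : mu.-integrable Omega (EFin \o (fun x => u x ^+ 2 + 2 * (u x * v x))).
  exact: (integrableD mO iu i2).
rewrite (_ : \int[mu]_(x in Omega) ((u \+ v) x ^+ 2) =
    \int[mu]_(x in Omega) (u x ^+ 2 + 2 * (u x * v x) + v x ^+ 2)); last first.
  by apply: eq_Rintegral => x _ /=; ring.
rewrite RintegralD// RintegralD// RintegralZl//.
rewrite lerD2r lerD2l -[leRHS]mulr_natl ler_pM2l//.
exact: (le_trans (ler_norm _) (L2_cauchy_schwarz L2u L2v)).
Qed.

Lemma L2normZ a u : L2 Omega u -> L2norm Omega (fun x => a * u x) = `|a| * L2norm Omega u.
Proof.
move=> L2u; apply/eqP; rewrite -(@eqrXn2 _ 2) ?mulr_ge0 ?L2norm_ge0//.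
rewrite exprMn !L2norm_sqr//; last exact: L2Z.
rewrite -normrX (ger0_norm (sqr_ge0 _)) -RintegralZl//; last exact: ((L2P u).1 L2u).2.
by apply/eqP; apply: eq_Rintegral => x _; rewrite exprMn.
Qed.

Lemma L2_ae_eq u v : {ae mu, forall x, Omega x -> u x = v x} ->
  measurable_fun Omega u -> measurable_fun Omega v ->
  forall w, L2 Omega w ->
  \int[mu]_(x in Omega) (u x * w x) = \int[mu]_(x in Omega) (v x * w x).
Proof.
move=> uv mu' mv w /L2_measurable mw; congr fine; apply: ae_eq_integral => //.
- by apply/measurable_EFinP; exact: measurable_funM.
- by apply/measurable_EFinP; exact: measurable_funM.
- by apply: filterS uv => x h /h ->.
Qed.

Lemma L2_bounded u (B : R) : (mu Omega < +oo)%E -> measurable_fun Omega u ->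
  (forall x, Omega x -> `|u x| <= B) -> L2 Omega u.
Proof.
move=> fO mu' uB; apply/L2P; split=> //.
apply: (@le_integrable _ _ _ mu _ mO _ (cst (B ^+ 2)%:E)).
- by apply/measurable_EFinP; exact: measurable_funX.
- move=> x Ox; rewrite lee_fin normrX [leRHS]ger0_norm ?sqr_ge0// ler_pXn2r ?nnegrE//.
    exact: uB.
  exact: le_trans (uB _ Ox).
- apply/integrableP; split; first exact: measurable_cst.
  rewrite (eq_integral (cst `|(B ^+ 2)%:E|%E))// integral_cst//.
  by rewrite lte_mul_pinfty// abse_ge0.
Qed.

Lemma L2_dotv_integrable (g h : 'rV[R]_d -> 'rV[R]_d) : L2v Omega g -> L2v Omega h ->
  mu.-integrable Omega (fun x => (dotv (g x) (h x))%:E).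
Proof.
move=> L2g L2h; rewrite /dotv.
under eq_fun do rewrite -sumEFin.
by apply: integrable_sum => // i _; exact: L2M_integrable.
Qed.

End L2_space.

(** * Smooth functions flat at the origin *)

Section smooth_bump.
Context (R : realType).
Implicit Types (p : {poly R}) (t : R).

(** The polynomial factor makes the family closed under differentiation, so smoothness follows by
    induction on the order. *)
Definition flat p t : R := if 0 < t then p.[t^-1] * expR (- t^-1) else 0.

Lemma flat_ge0E p t : 0 < t -> flat p t = p.[t^-1] * expR (- t^-1).
Proof. by rewrite /flat => ->. Qed.

Lemma flat_le0E p t : t <= 0 -> flat p t = 0.
Proof. by rewrite /flat ltNge => ->. Qed.

(* expR s >= (1 + s / k)^k beats the power s^(k-1). *)
Lemma flat_le p : exists2 C, 0 <= C & forall t, `|flat p t| <= C * `|t|.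
Proof.
pose c k : R := k.+1%:R ^+ k.+1.
exists (\sum_(i < size p) `|p`_i| * c i).
  by apply: sumr_ge0 => i _; rewrite mulr_ge0// exprn_ge0.
move=> t; have [t0|t0] := leP t 0.
  rewrite flat_le0E// normr0 mulr_ge0//.
  by apply: sumr_ge0 => i _; rewrite mulr_ge0// exprn_ge0.
rewrite flat_ge0E// normrM (gtr0_norm (expR_gt0 _)) (gtr0_norm t0).
rewrite horner_coef (le_trans (ler_wpM2r (expR_ge0 _) (ler_norm_sum _ _ _)))//.
rewrite !mulr_suml; apply: ler_sum => i _.
rewrite normrM -!mulrA ler_wpM2l// normrX gtr0_norm ?invr_gt0//.
set s := t^-1; have s0 : 0 < s by rewrite invr_gt0.
have -> : t = s^-1 by rewrite invrK.
rewrite expRN ler_pdivrMr ?expR_gt0// mulrAC ler_pdivlMr// -exprSr.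
have -> : s = i.+1%:R * (s / i.+1%:R) by rewrite mulrC divfK// pnatr_eq0.
rewrite expRM_natl exprMn ler_wpM2l ?exprn_ge0//.
rewrite ler_pXn2r ?nnegrE ?expR_ge0 ?divr_ge0 ?(ltW s0)//.
by apply: le_trans (expR_ge1Dx _); rewrite lerDr.
Qed.

Lemma flatX p t : t != 0 -> flat (p * 'X) t = t^-1 * flat p t.
Proof.
move=> t0; rewrite /flat hornerMX; case: (0 < t); last by rewrite mulr0.
by rewrite mulrAC mulrC.
Qed.

(** For [t > 0] the derivative of [1/t] accounts for ['X^2]. At [0] the difference quotient is
    [flat (p * 'X)], which tends to zero by [flat_le]. *)
Lemma is_derive_flat p t : is_derive t 1 (flat p) (flat ((p - p^`()) * 'X^2) t).
Proof.
have [t0|t0|->] := ltgtP t 0.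
- rewrite flat_le0E ?ltW//; apply: (near_eq_is_derive (f := cst 0)) (is_derive_cst _ _ _).
  near=> u; rewrite flat_le0E//; apply: ltW; near: u.
  exact: lt_nbhsl.
- apply: (near_eq_is_derive (f := fun u : R => p.[u^-1] * expR (- u^-1))).
    near=> u; rewrite flat_ge0E//; near: u; exact: lt_nbhsr.
  have dV : is_derive t 1 (fun u : R => u^-1) (- t ^- 2 *: 1).
    by apply: is_deriveV; rewrite gt_eqF.
  have d1 := is_derive1_comp (is_derive_poly p t^-1) dV.
  have dN : is_derive t 1 (fun u : R => - u^-1) (- (- t ^- 2 *: 1)).
    exact: is_deriveN.
  have d2 := @is_derive1_comp _ expR (fun u : R => - u^-1) t _ _ (is_derive_expR (- t^-1)) dN.
  have d3 := is_deriveM d1 d2; apply: (is_derive_eq d3).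
  rewrite flat_ge0E// !hornerE /= /GRing.scale /= -exprVn; ring.
- rewrite flat_le0E//; have [C C0 hC] := flat_le (p * 'X).
  have cv : h^-1 *: (flat p (h *: 1 + 0) - flat p 0) @[h --> 0^'] --> (0 : R).
    apply/cvgr0Pnorm_le => e e0; near=> h.
    have h0 : h != 0 by near: h; exact: nbhs_dnbhs_neq.
    rewrite /GRing.scale /= mulr1 addr0 (flat_le0E _ (lexx 0)) subr0 -flatX//.
    apply: (le_trans (hC h)); apply: (@le_trans _ _ ((C + 1) * `|h|)).
      by rewrite ler_wpM2r// lerDl.
    rewrite -ler_pdivlMl ?ltr_wpDl//; near: h; apply: dnbhs0_le.
    by rewrite mulr_gt0// invr_gt0 ltr_wpDl.
  by split; [apply/cvg_ex; exists 0|exact: cvg_lim cv].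
Unshelve. all: by end_near. Qed.

End smooth_bump.

(** * Smooth cut-off functions of boxes *)

Section Ck_algebra.
Context (R : realType) (d : nat).
Implicit Types (u v : 'rV[R]_d -> R) (i j : 'I_d).
Local Notation e_ i := (delta_mx ord0 i : 'rV[R]_d).

Lemma Ck_continuous k u : Ck k u -> continuous u.
Proof. by case: k => [|k] []. Qed.

Lemma CkW k u : Ck k.+1 u -> Ck k u.
Proof.
elim: k u => [|k IH] u; first by move=> [cu _].
move=> [cu h]; split=> // i; have [du Cu] := h i.
by split=> //; exact: IH.
Qed.

Lemma Ck_cst k (c : R) : Ck k (fun _ : 'rV[R]_d => c).
Proof.
elim: k c => [|k IH] c; first by split=> //; exact: cst_continuous.
split=> [|i]; first exact: cst_continuous.
split=> [x|]; first exact: derivable_cst.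
rewrite (_ : partial i _ = fun=> 0)//.
by apply/funext => x; rewrite /partial derive_cst.
Qed.

Lemma CkD k u v : Ck k u -> Ck k v -> Ck k (fun x => u x + v x).
Proof.
elim: k u v => [|k IH] u v.
  by move=> [cu _] [cv _]; split=> // x; apply: continuousD; [exact: cu|exact: cv].
move=> [cu hu] [cv hv]; split=> [x|i]; first by apply: continuousD; [exact: cu|exact: cv].
have [du Cu] := hu i; have [dv Cv] := hv i.
split=> [x|]; first by apply: derivableD.
rewrite (_ : partial i _ = fun x => partial i u x + partial i v x); first exact: IH.
by apply/funext => x; rewrite /partial deriveD.
Qed.

Lemma partialM i u v x : derivable u x (e_ i) -> derivable v x (e_ i) ->
  partial i (fun x => u x * v x) x = u x * partial i v x + v x * partial i u x.
Proof. by move=> du dv; rewrite /partial deriveM. Qed.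

Lemma CkM k u v : Ck k u -> Ck k v -> Ck k (fun x => u x * v x).
Proof.
elim: k u v => [|k IH] u v.
  by move=> [cu _] [cv _]; split=> // x; apply: continuousM; [exact: cu|exact: cv].
move=> uk vk; have [cu hu] := uk; have [cv hv] := vk.
split=> [x|i]; first by apply: continuousM; [exact: cu|exact: cv].
have [du Cu] := hu i; have [dv Cv] := hv i.
split=> [x|]; first by apply: derivableM.
rewrite (_ : partial i _ = fun x => u x * partial i v x + v x * partial i u x).
  by apply: CkD; apply: IH => //; exact: CkW.
by apply/funext => x; rewrite partialM.
Qed.

Lemma Ck_prod k (s : seq 'I_d) (f : 'I_d -> 'rV[R]_d -> R) :
  (forall i, Ck k (f i)) -> Ck k (fun x => \prod_(i <- s) f i x).
Proof.
move=> Cf; elim: s => [|i s IH].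
  by under eq_fun do rewrite big_nil; exact: Ck_cst.
by under eq_fun do rewrite big_cons; exact: CkM.
Qed.

(** Along [e_i] the argument of [g] moves at speed [c * (i == j)], so the difference quotient is one
    of [g] itself, in one variable. *)
Lemma derivative_coord (g : R -> R) (g' a c : R) i j (x : 'rV[R]_d) :
  is_derive (a + c * x ord0 j) 1 g g' ->
  is_derive x (e_ i) (fun x : 'rV[R]_d => g (a + c * x ord0 j)) (c * (i == j)%:R * g').
Proof.
move=> dg; pose b := c * (i == j)%:R; pose al := a + c * x ord0 j.
have E : (fun h : R => h^-1 *: (g (a + c * (h *: e_ i + x) ord0 j) - g al)) =
   (fun h : R => h^-1 *: (g (h *: b + al) - g al)).
  apply/funext => h; congr (_ *: (g _ - _)); rewrite !mxE eqxx eq_sym /b /al /GRing.scale /=; ring.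
have dif : differentiable g al by apply/derivable1_diffP; case: dg.
have db : derivable g al b by exact: diff_derivable.
have Db : 'D_b g al = b * g'.
  have -> : 'D_b g al = b * 'D_1 g al.
    by rewrite !deriveE// -[in LHS](mulr1 b) -[b * 1]/(b *: (1 : R)) linearZ.
  by congr (_ * _); case: dg.
split; first by move: db; rewrite /derivable E.
by rewrite -Db /derive E.
Qed.

Lemma Ck_flat_coord k (p : {poly R}) (a c : R) j :
  Ck k (fun x : 'rV[R]_d => flat p (a + c * x ord0 j)).
Proof.
have cf q : continuous (fun x : 'rV[R]_d => flat q (a + c * x ord0 j)).
  move=> x; apply: (@continuous_comp _ _ _ (fun x : 'rV[R]_d => a + c * x ord0 j)).
    apply: continuousD; first exact: cst_continuous.
    by apply: continuousM; [exact: cst_continuous|exact: coord_continuous].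
  apply: differentiable_continuous; apply/derivable1_diffP.
  by case: (is_derive_flat q (a + c * x ord0 j)).
elim: k p => [|k IH] p; first by split.
split=> // i; split=> [x|].
  by case: (derivative_coord i (is_derive_flat p (a + c * x ord0 j))).
rewrite (_ : partial i _ = fun x => c * (i == j)%:R *
    flat ((p - p^`()) * 'X^2) (a + c * x ord0 j)).
  by apply: CkM; [exact: Ck_cst|exact: IH].
apply/funext => x.
by case: (derivative_coord i (is_derive_flat p (a + c * x ord0 j))).
Qed.

(** [m] is a sharpness parameter: the function vanishes off the open box for [m > 0] and tends to
    its indicator as [m] grows. *)
Definition bump (a b : 'rV[R]_d) (m : R) (x : 'rV[R]_d) : R :=
  \prod_j (flat 1 (m * (x ord0 j - a ord0 j)) * flat 1 (m * (b ord0 j - x ord0 j))).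

Lemma Ck_bump k a b m : Ck k (bump a b m).
Proof.
apply: Ck_prod => j; apply: CkM.
  have := @Ck_flat_coord k 1 (- m * a ord0 j) m j.
  by congr Ck; apply/funext => x; congr (flat _ _); ring.
have := @Ck_flat_coord k 1 (m * b ord0 j) (- m) j.
by congr Ck; apply/funext => x; congr (flat _ _); ring.
Qed.

Definition box (a b : 'rV[R]_d) : set 'rV[R]_d :=
  [set x | forall j, a ord0 j < x ord0 j < b ord0 j].

Definition cbox (a b : 'rV[R]_d) : set 'rV[R]_d :=
  [set x | forall j, a ord0 j <= x ord0 j <= b ord0 j].

Lemma compact_cbox a b : compact (cbox a b).
Proof.
rewrite (_ : cbox a b = [set x | forall j, `[a ord0 j, b ord0 j]%classic (x ord0 j)]).
  apply: (@rV_compact _ _ (fun j => `[a ord0 j, b ord0 j]%classic)) => j.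
  exact: segment_compact.
by apply/seteqP; split=> x h j; have := h j; rewrite /= in_itv.
Qed.

Lemma closed_cbox a b : closed (cbox a b).
Proof. by apply: compact_closed; [exact: norm_hausdorff|exact: compact_cbox]. Qed.

Lemma flat1E t : flat (1 : {poly R}) t = if 0 < t then expR (- t^-1) else 0.
Proof. by rewrite /flat hornerE mul1r. Qed.

Lemma bump_eq0 a b m x : 0 < m -> ~ box a b x -> bump a b m x = 0.
Proof.
move=> m0 /existsNP[j /negP]; rewrite negb_and -!leNgt => h.
rewrite /bump (bigD1 j)//= (_ : _ * flat _ _ = 0) ?mul0r//.
have z t : t <= 0 -> flat (1 : {poly R}) (m * t) = 0.
  by move=> t0; rewrite flat_le0E// mulr_ge0_le0// ltW.
case/orP: h => h.
  by rewrite (z (x ord0 j - a ord0 j)) ?subr_le0 ?mul0r.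
by rewrite (z (b ord0 j - x ord0 j)) ?subr_le0 ?mulr0.
Qed.

Lemma bump_ge0_le1 a b m x : 0 <= bump a b m x <= 1.
Proof.
have f01 t : 0 <= flat (1 : {poly R}) t <= 1.
  rewrite flat1E; case: ifPn => [t0|_]; last by rewrite lexx ler01.
  by rewrite expR_ge0/= -expR0 ler_expR oppr_le0 invr_ge0 ltW.
have M01 (u v : R) : 0 <= u <= 1 -> 0 <= v <= 1 -> 0 <= u * v <= 1.
  by move=> /andP[? ?] /andP[? ?]; rewrite mulr_ge0// mulr_ile1.
apply: (big_ind (fun z : R => 0 <= z <= 1)) => // [|j _]; last exact: M01.
by rewrite ler01 lexx.
Qed.

Lemma bump_Cc_infty Omega a b m : 0 < m -> cbox a b `<=` Omega ->
  Cc_infty Omega (bump a b m).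
Proof.
move=> m0 abO.
have sub : closure [set x | bump a b m x != 0] `<=` cbox a b.
  apply: closure_subset_closed; first exact: closed_cbox.
  move=> x /= nz j; have : box a b x by apply: contrapT => /(bump_eq0 m0)/eqP; apply/negP.
  by move=> /(_ j) /andP[? ?]; rewrite !ltW.
split; first by move=> k; exact: Ck_bump.
  exact: (subclosed_compact (@closed_closure _ _) (@compact_cbox a b) sub).
exact: subset_trans sub abO.
Qed.

Lemma cvg_bump a b x : bump a b k.+1%:R x @[k --> \oo] --> (\1_(box a b) x : R).
Proof.
have [xab|nx] := pselect (box a b x); last first.
  rewrite indicE memNset//; under eq_fun do rewrite bump_eq0//.
  exact: cvg_cst.
rewrite indicE mem_set//.
have f1 (t : R) : 0 < t -> flat (1 : {poly R}) (k.+1%:R * t) @[k --> \oo] --> (1 : R).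
  move=> t0; under eq_fun do rewrite flat1E mulr_gt0//.
  have h : - (k.+1%:R * t)^-1 @[k --> \oo] --> (0 : R).
    under eq_fun do rewrite invfM -mulrN.
    by rewrite -(mul0r (- t^-1)); apply: cvgM; [exact: cvg_harmonic|exact: cvg_cst].
  have := cvg_comp _ expR h (@continuous_expR R 0).
  by rewrite expR0.
have pr (s : seq 'I_d) : \prod_(j <- s) (flat (1 : {poly R}) (k.+1%:R * (x ord0 j - a ord0 j)) *
    flat 1 (k.+1%:R * (b ord0 j - x ord0 j))) @[k --> \oo] --> (1 : R).
  elim: s => [|j s IH]; first by under eq_fun do rewrite big_nil; exact: cvg_cst.
  under eq_fun do rewrite big_cons.
  apply: (cvg_trans (G := nbhs (1 * 1 : R))); last by rewrite mulr1.
  apply: cvgM => //.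
  apply: (cvg_trans (G := nbhs (1 * 1 : R))); last by rewrite mulr1.
  have /andP[? ?] := xab j.
  by apply: cvgM; apply: f1; rewrite subr_gt0.
exact: pr.
Qed.

End Ck_algebra.

(** * Boxes: finite measure and generation of the Borel sets *)

Section boxes.
Context (R : realType) (d : nat).
Local Notation mu := (leb R d).

Lemma leb_ball_lty n (M : R) : (leb R n (ball (0%R : 'rV[R]_n) M) < +oo)%E.
Proof.
elim: n => [|n IH]; first by rewrite /= diracE; case: (_ \in _); rewrite ltry.
have mb : measurable (ball (0 : 'rV[R]_n.+1) M) by exact: measurable_rV_ball.
have mb' : measurable (ball (0 : 'rV[R]_n) M) by exact: measurable_rV_ball.
rewrite leb_slice2//.
pose J : set R := `]- M, M[%classic.
have : (\int[@lebesgue_measure R]_(s in J) leb R n (ball (0%R : 'rV[R]_n) M) < +oo)%E.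
  rewrite /J integral_cst//= lebesgue_measure_itv/= lte_fin; case: ifPn => _; last by rewrite mule0.
  by rewrite lte_mul_pinfty// ?ltry// ge0_fin_numE.
apply: le_lt_trans.
rewrite [leRHS]integral_mkcond; apply: ge0_le_integral => //=.
- have := measurable_fun_xsection (leb R n) (measurable_rV_consV mb).
  by apply: eq_measurable_fun => y _ /=; rewrite xsectionE.
- by apply/(measurable_restrictT _ _).1; [exact: measurable_itv|exact: measurable_cst].
move=> s _; rewrite patchE; have [M0|M0] := leP M 0.
  rewrite (_ : [set y | _] = set0) ?measure0; last first.
    by apply/seteqP; split=> // y [+ _]; rewrite ltNge M0.
  by case: ifPn.
case: ifPn => [_|/negP ns].
  apply: le_measure; rewrite ?inE//.
    rewrite (_ : [set y | _] = xsection (@rV_cons R n @^-1` ball 0 M) s); last by rewrite xsectionE.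
    by apply: measurable_xsection; exact: measurable_rV_consV.
  move=> y /(rV_ballP _ _ M0) h; apply/(rV_ballP _ _ M0) => i.
  by have := h (lift ord0 i); rewrite rV_consS !mxE.
rewrite (_ : [set y | _] = set0) ?measure0//; apply/seteqP; split=> // y.
move=> /(rV_ballP _ _ M0)/(_ ord0); rewrite rV_cons0 mxE sub0r normrN => sM.
by apply: ns; apply/mem_set; rewrite /J /= in_itv/= -ltr_norml.
Qed.

Lemma leb_bounded_lty n (A : set 'rV[R]_n) : bounded_set A -> measurable A ->
  (leb R n A < +oo)%E.
Proof.
move=> [M [Mr hM]] mA.
have M2 : M < `|M| + 1 by rewrite (le_lt_trans (ler_norm _))// ltrDl.
apply: (@le_lt_trans _ _ (leb R n (ball 0 (`|M| + 2)))); last exact: leb_ball_lty.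
apply: le_measure; rewrite ?inE//; first exact: measurable_rV_ball.
move=> x /(hM _ M2)/= xM; have M0 : 0 < `|M| + 2 by rewrite ltr_wpDl.
apply/(rV_ballP _ _ M0) => i; rewrite mxE sub0r normrN.
by rewrite (le_lt_trans (normr_rV_coord _ _))// (le_lt_trans xM)// ltrD2l ltr1n.
Qed.

Definition boxes : set (set 'rV[R]_d) := [set A | exists a b, A = box a b].

Lemma boxI (a b a' b' : 'rV[R]_d) : box a b `&` box a' b' =
  box (\row_j Num.max (a ord0 j) (a' ord0 j)) (\row_j Num.min (b ord0 j) (b' ord0 j)).
Proof.
apply/seteqP; split=> x /=.
  move=> [h h'] j; have /andP[h1 h2] := h j; have /andP[h3 h4] := h' j.
  by rewrite !mxE gt_max lt_min h1 h2 h3 h4.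
move=> h; split=> j; have := h j; rewrite !mxE gt_max lt_min => /andP[/andP[h1 h2] /andP[h3 h4]].
  by rewrite h1 h3.
by rewrite h2 h4.
Qed.

Lemma measurable_box (a b : 'rV[R]_d) : measurable (box a b : set 'rV[R]_d).
Proof.
rewrite (_ : box a b = \bigcap_(j in setT) (@rV_coord R d j @^-1` `]a ord0 j, b ord0 j[%classic)).
  apply: fin_bigcap_measurable => // j _; rewrite -[X in measurable X]setTI.
  exact: measurable_rV_coord.
apply/seteqP; split=> x h j; first by move=> _ /=; rewrite in_itv/= h.
by have := h j Logic.I; rewrite /= in_itv.
Qed.

(** A slab in one coordinate is a countable union of boxes whose other sides []-k, k[] exhaust the
    line. *)
Lemma measurable_boxes : @measurable _ 'rV[R]_d `<=` <<s boxes >>.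
Proof.
have mc (i : 'I_d) : measurable_fun [set: g_sigma_algebraType boxes]
    (@rV_coord R d i : g_sigma_algebraType boxes -> R).
  apply: (measurability _ (RGenOpens.measurableE R)) => _ [_ [u [v ->]] <-].
  rewrite setTI.
  pose a k : 'rV[R]_d := \row_j (if j == i then u else - k%:R).
  pose b k : 'rV[R]_d := \row_j (if j == i then v else k%:R).
  rewrite (_ : _ @^-1` _ = \bigcup_k box (a k) (b k)).
    by apply: bigcupT_measurable => k; apply: sub_sigma_algebra; exists (a k), (b k).
  apply/seteqP; split=> x /=; rewrite in_itv/= /rV_coord.
    move=> xi; have [k xk] : exists k : nat, `|x| < k%:R.
      by exists (Num.truncn `|x|).+1; rewrite truncnS_gt.
    exists k => // j; rewrite !mxE; case: eqP => [->//|_].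
    by rewrite -ltr_norml (le_lt_trans (normr_rV_coord _ _)).
  by move=> [k _ /(_ i)]; rewrite !mxE eqxx.
apply: smallest_sub; first exact: smallest_sigma_algebra.
rewrite -bigcup_seq/=; apply: bigcup_sub => i _ _ [B mB <-].
exact: (mc i).
Qed.

End boxes.

(** * Fundamental lemma of the calculus of variations *)

Section fundamental_lemma.
Context (R : realType) (d : nat) (Omega : set 'rV[R]_d).
Hypotheses (bO : bounded_set Omega) (oO : open Omega).
Local Notation mu := (leb R d).

Let mO : measurable Omega. Proof. exact: open_measurable_rV. Qed.

Let fO : (mu Omega < +oo)%E. Proof. exact: leb_bounded_lty. Qed.

Lemma L2_integrable g : L2 Omega g -> mu.-integrable Omega (EFin \o g).
Proof.
move=> L2g; have L21 : L2 Omega (cst 1).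
  by apply: (L2_bounded mO (B := 1)) => // x _; rewrite normr1.
have := L2M_integrable mO L2g L21.
by congr (_.-integrable _ _); apply/funext => x /=; rewrite mulr1.
Qed.

Variable g : 'rV[R]_d -> R.
Hypothesis L2g : L2 Omega g.
Hypothesis g_orth : forall psi, Cc_infty Omega psi ->
  \int[mu]_(x in Omega) (g x * psi x) = 0.

Let ig : mu.-integrable Omega (EFin \o g). Proof. exact: L2_integrable. Qed.

Let mg : measurable_fun Omega g. Proof. exact: L2_measurable L2g. Qed.

(** The cut-offs tend to the indicator of the box and are at most 1, so dominated convergence
    applies with majorant [|g|]. *)
Lemma integral_box_eq0 a b : cbox a b `<=` Omega ->
  (\int[mu]_(x in box a b) (g x)%:E = 0)%E.
Proof.
move=> abO.
have bxO : box a b `<=` Omega by move=> x xab; apply: abO => j; have /andP[? ?] := xab j; rewrite !ltW.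
pose f_ k x := (g x * bump a b k.+1%:R x)%:E.
have mb k : measurable_fun Omega (bump a b k.+1%:R).
  apply: measurable_funTS; apply: continuous_measurable_rV.
  by apply: (@Ck_continuous _ _ 0); exact: Ck_bump.
have mf_ k : measurable_fun Omega (f_ k).
  by apply/measurable_EFinP; apply: measurable_funM.
have mf : measurable_fun Omega (fun x => (g x * \1_(box a b) x)%:E).
  apply/measurable_EFinP; apply: measurable_funM => //.
  by apply: measurable_indic; exact: measurable_box.
have cf : {ae mu, forall x, Omega x -> f_ ^~ x @ \oo --> (g x * \1_(box a b) x)%:E}.
  apply: aeW => x _; apply: cvg_EFin; first exact: nearW.
  by apply: cvgM; [exact: cvg_cst|exact: cvg_bump].
have le_f : {ae mu, forall x k, Omega x -> (`|f_ k x| <= `|(g x)%:E|)%E}.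
  apply: aeW => x k _; rewrite /f_ abse_EFin lee_fin normrM ler_piMr//.
  by have /andP[b0 b1] := bump_ge0_le1 a b k.+1%:R x; rewrite ger0_norm.
have [_ _ h] := dominated_convergence mO mf_ mf cf (integrable_abse ig) le_f.
have f0 k : (\int[mu]_(x in Omega) f_ k x = 0)%E.
  have cc : Cc_infty Omega (bump a b k.+1%:R) by exact: bump_Cc_infty.
  have ifk : mu.-integrable Omega (f_ k).
    apply: (L2M_integrable mO L2g); apply: (L2_bounded mO (B := 1)) => // x _.
    by have /andP[b0 b1] := bump_ge0_le1 a b k.+1%:R x; rewrite ger0_norm.
  by rewrite -(fineK (integrable_fin_num mO ifk)); congr EFin; exact: g_orth.
have c0 : (fun k => \int[mu]_(x in Omega) f_ k x)%E @ \oo --> 0%E.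
  by under eq_fun do rewrite f0; exact: cvg_cst.
rewrite -(cvg_unique _ h c0); last exact: ereal_hausdorff.
rewrite -[in LHS](setIidr bxO) integral_mkcondr; apply: eq_integral => x _.
rewrite patchE indicE; case: ifPn => _; first by rewrite mulr1.
by rewrite mulr0.
Qed.

(** Monotone class argument from boxes, which are stable under intersection. Localising to a ball
    works because a sup-norm ball is itself a box, so the whole space is in the class. *)
Lemma integral_ball_eq0 c r : 0 < r -> ball c (r *+ 2) `<=` Omega ->
  forall A, measurable A -> (\int[mu]_(x in ball c r `&` A) (g x)%:E = 0)%E.
Proof.
move=> r0 cO.
have bQ : ball c r = box (\row_j (c ord0 j - r)) (\row_j (c ord0 j + r)).
  apply/seteqP; split=> x.
    by move=> /(rV_ballP _ _ r0) h j; rewrite !mxE -ltr_distl distrC.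
  by move=> h; apply/(rV_ballP _ _ r0) => j; have := h j; rewrite !mxE -ltr_distl distrC.
have mQ := measurable_rV_ball c r.
have QO : ball c r `<=` Omega by apply: subset_trans cO; apply: le_ball; rewrite mulr2n lerDl ltW.
have igQ A : measurable A -> mu.-integrable (ball c r `&` A) (EFin \o g).
  by move=> mA; apply: integrableS ig => //; [exact: measurableI|exact: subIset (or_introl QO)].
pose H := [set A | measurable A /\ (\int[mu]_(x in ball c r `&` A) (g x)%:E = 0)%E].
have boxH : @boxes R d `<=` H.
  move=> _ [a [b ->]]; split; first exact: measurable_box.
  rewrite bQ boxI; apply: integral_box_eq0; apply: subset_trans cO => x h.
  apply/rV_ballP; first by rewrite mulrn_wgt0.
  move=> j; have := h j; rewrite !mxE ge_max le_min => /andP[/andP[h1 _] /andP[h2 _]].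
  by rewrite distrC ltr_distl mulr2n; apply/andP; split; lra.
have HT : (\int[mu]_(x in ball c r) (g x)%:E = 0)%E.
  have [_] : H (ball c r) by apply: boxH; rewrite bQ; eexists; eexists.
  by rewrite setIid.
have lH : lambda_system setT H.
  apply/dynkin_lambda_system; split.
  - by split=> //; rewrite setIT.
  - move=> A [mA A0]; split; first exact: measurableC.
    have mQA := measurableI _ _ mQ mA; have mQC := measurableI _ _ mQ (measurableC mA).
    move: HT; rewrite -{1}(setIT (ball c r)) -(setUv A) setIUr integral_setU//.
    - by rewrite A0 add0e.
    - rewrite -setIUr setUv; exact: measurable_int (igQ _ measurableT).
    - by apply/disj_setPS => x [[_ Ax] [_ nAx]].
  - move=> F tF hF; have mF k : measurable (F k) by have [] := hF k.
    split; first exact: bigcupT_measurable.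
    rewrite setI_bigcupr integral_bigcup.
    + by apply: eseries0 => k _ _; have [] := hF k.
    + exact: trivIset_setIl.
    + by move=> k; exact: measurableI.
    + by rewrite -setI_bigcupr; apply: igQ; exact: bigcupT_measurable.
have := @lambda_system_subset _ (@boxes R d) _ setT H lH boxH.
move=> hs A mA; have [] // : H A.
apply: hs => //; last exact: measurable_boxes.
by move=> _ _ [a [b ->]] [a' [b' ->]]; rewrite boxI; eexists; eexists.
Qed.

(** Countably many rational balls cover [Omega]; on each, vanishing integrals over measurable
    subsets force [g = 0] almost everywhere. *)
Lemma du_bois_reymond : {ae mu, forall x, Omega x -> g x = 0}.
Proof.
pose P (p : 'rV[rat]_d * nat) := `[< ball (rat_center R p) (rat_radius R p *+ 2) `<=` Omega >].
have hp p : P p -> {ae mu, forall x : 'rV[R]_d, ball (rat_center R p) (rat_radius R p) x -> (g x)%:E = 0%E}.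
  move=> /asboolP pO.
  have pO' : ball (rat_center R p) (rat_radius R p) `<=` Omega.
    by apply: subset_trans pO; apply: le_ball; rewrite mulr2n lerDl ltW// rat_radius_gt0.
  apply: (@integral_ae_eq _ _ _ mu _ _ (cst 0%E) (EFin \o g)).
  - exact: measurable_rV_ball.
  - by apply: integrableS ig => //; exact: measurable_rV_ball.
  - exact: measurable_cst.
  - move=> E EB mE; rewrite integral0 -(setIidr EB).
    by apply: integral_ball_eq0 => //; exact: rat_radius_gt0.
pose Q (k : nat) (x : 'rV[R]_d) := if unpickle k is Some p then
  P p -> ball (rat_center R p) (rat_radius R p) x -> (g x)%:E = 0%E else True.
have : {ae mu, forall x, forall k, Q k x}.
  apply: ae_foralln => k; rewrite /Q; case: (unpickle k) => [p|]; last exact: aeW.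
  have [Pp|nP] := pselect (P p); last by apply: aeW => x /nP.
  by apply: filterS (hp _ Pp) => x h _; exact: h.
apply: filterS => x h Ox; have [p [px pO]] := open_rat_ball oO Ox.
have Pp : P p by exact/asboolP.
by have := h (pickle p); rewrite /Q pickleK => /(_ Pp px) [].
Qed.

End fundamental_lemma.

(** * Integration by parts *)

Section integration_by_parts.
Context (R : realType) (d : nat).
Local Notation mu := (leb R d).
Local Notation E := 'rV[R]_d.
Implicit Types (h u v : E -> R) (i : 'I_d) (K : set E).
Local Notation e_ i := (delta_mx ord0 i : E).

Lemma compact_support_bounded h K : compact K -> continuous h ->
  (forall x, h x != 0 -> K x) -> exists2 B, 0 <= B & forall x, `|h x| <= B.
Proof.
move=> cK ch hK.
have [M [Mr hM]] : bounded_set (h @` K).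
  apply: compact_bounded; apply: continuous_compact => //.
  exact: continuous_subspaceT.
have MM : M < `|M| + 1 by rewrite (le_lt_trans (ler_norm _))// ltrDl.
exists (`|M| + 1) => [|x]; first by rewrite addr_ge0.
have [h0|h0] := eqVneq (h x) 0; first by rewrite h0 normr0 addr_ge0.
by apply: (hM _ MM); exists x => //; exact: hK.
Qed.

Lemma partial_support h K i x : closed K -> (forall x, h x != 0 -> K x) ->
  partial i h x != 0 -> K x.
Proof.
move=> cK hK; apply: contra_neqP => nK.
rewrite /partial (near_eq_derive _ (g := cst 0)); first by rewrite derive_cst.
have : nbhs x (~` K) by apply: open_nbhs_nbhs; split=> //; exact: closed_openC.
apply: filterS => y nKy; apply/eqP; apply: contrapT => /negP.
by move=> /hK.
Qed.

Lemma line_derivative h i x s : derivable h (x + s *: e_ i) (e_ i) ->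
  is_derive s 1 (fun r : R => h (x + r *: e_ i)) (partial i h (x + s *: e_ i)).
Proof.
move=> dh.
have E1 : (fun r : R => r^-1 *: (h (x + (r *: 1 + s) *: e_ i) - h (x + s *: e_ i))) =
    (fun r : R => r^-1 *: (h (r *: e_ i + (x + s *: e_ i)) - h (x + s *: e_ i))).
  apply/funext => r; congr (_ *: (h _ - _)).
  by rewrite -[r *: 1]/(r * 1) mulr1 scalerDl addrCA.
by split; rewrite /derivable /derive /partial E1.
Qed.

Lemma difference_quotient_le h i B x t : 0 < t ->
  (forall x, derivable h x (e_ i)) -> (forall x, `|partial i h x| <= B) ->
  `|h (x + t *: e_ i) - h x| <= B * t.
Proof.
move=> t0 dh hB.
have [||c _] := @MVT R (fun r => h (x + r *: e_ i)) (fun r => partial i h (x + r *: e_ i)) 0 t t0.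
- by move=> s _; exact: line_derivative.
- apply: continuous_subspaceT => s; apply: differentiable_continuous.
  by apply/derivable1_diffP; case: (line_derivative (s := s) (dh (x + s *: e_ i))).
by rewrite scale0r addr0 subr0 => ->; rewrite normrM (gtr0_norm t0) ler_wpM2r// ltW.
Qed.

Lemma cvg_difference_quotient h i x : derivable h x (e_ i) ->
  (h (x + k.+1%:R^-1 *: e_ i) - h x) * k.+1%:R @[k --> \oo] --> partial i h x.
Proof.
move=> dh.
have tk : harmonic @ \oo --> (0 : R)^'.
  move=> P hP; have : \oo [set k | @harmonic R k != 0 -> P (harmonic k)] := cvg_harmonic hP.
  rewrite /fmap /nbhs /=; apply: filterS => k; apply.
  by rewrite /harmonic /= invr_eq0 pnatr_eq0.
have := cvg_comp _ _ tk dh.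
rewrite (_ : _ \o _ = fun k => (h (x + k.+1%:R^-1 *: e_ i) - h x) * k.+1%:R)//.
by apply/funext => k /=; rewrite invrK [_ *: _ + x]addrC; exact: mulrC.
Qed.

(** Difference quotients have zero integral by translation invariance. The mean value theorem bounds
    them by [B], and dominated convergence on a fixed ball passes to the derivative. *)
Lemma integral_partial_eq0 h K i : compact K -> continuous h ->
  (forall x, derivable h x (e_ i)) -> continuous (partial i h) ->
  (forall x, h x != 0 -> K x) -> \int[mu]_x partial i h x = 0.
Proof.
move=> cK ch dh cdh hK.
have clK : closed K by apply: compact_closed => //; exact: norm_hausdorff.
have hK' x : partial i h x != 0 -> K x by exact: partial_support.
have [B B0 hB] := compact_support_bounded cK cdh hK'.
have [M [Mr hM]] := compact_bounded cK.
pose N := `|M| + 1; have MN : M < N by rewrite (le_lt_trans (ler_norm _))// ltrDl.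
(* The support has radius at most [N] and the translations have length at most 1, so every translate
   of [h] used vanishes off [D]. *)
pose D : set E := ball 0 (N + 2).
have D0 : 0 < N + 2 by rewrite /N; have := normr_ge0 M; lra.
have mD : measurable D by exact: measurable_rV_ball.
have fD : (mu D < +oo)%E by exact: leb_ball_lty.
have suppD (r : R) x : `|r| <= 1 -> ~ D x -> h (x + r *: e_ i) = 0.
  move=> r1 nD; apply: contrapT => /eqP/hK/(hM _ MN)/= xN; apply: nD.
  apply/(rV_ballP _ _ D0) => j; rewrite mxE sub0r normrN.
  have xj := le_trans (normr_rV_coord _ j) xN.
  pose c := r * (e_ i) ord0 j.
  have re : `|c| <= 1.
    by rewrite /c normrM mxE; case: (_ && _); rewrite ?normr1 ?normr0 ?mulr1 ?mulr0.
  have xc : (x + r *: e_ i) ord0 j = x ord0 j + c by rewrite /c !mxE.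
  have := ler_normB (x ord0 j + c) c; rewrite addrK -xc => h1.
  by apply: (le_lt_trans h1); apply: (le_lt_trans (lerD xj re)); rewrite ltrD2l ltr1n.
have mh : measurable_fun setT h by exact: continuous_measurable_rV.
have mtr (a : E) : measurable_fun setT (fun x : E => h (x + a)).
  by apply: (measurableT_comp mh); apply: measurable_rVD.
have [B' B'0 hB'] := compact_support_bounded cK ch hK.
have cstD (b : R) : mu.-integrable D (cst b%:E).
  apply/integrableP; split; first exact: measurable_cst.
  by rewrite (eq_integral (cst `|b%:E|%E))// integral_cst// lte_mul_pinfty// abse_ge0.
have iD (a : E) : mu.-integrable D (fun x : E => (h (x + a))%:E).
  apply: (le_integrable mD _ _ (cstD B')).
    by apply/measurable_EFinP; exact: measurable_funTS.
  by move=> x _; rewrite lee_fin [leRHS]ger0_norm.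
have ih : mu.-integrable setT (EFin \o h).
  apply/integrableP; split; first exact/measurable_EFinP.
  rewrite (_ : (\int[mu]_x _)%E = (\int[mu]_(x in D) `|(h (x + 0))%:E|)%E); last first.
    rewrite [RHS]integral_mkcond; apply: eq_integral => x _; rewrite patchE.
    case: ifPn => [_|/negP nD]; first by rewrite addr0.
    have hx : h x = 0.
      have := @suppD 0 x; rewrite scale0r addr0 normr0; apply => // Dx.
      by apply: nD; apply/mem_set.
    by rewrite /= hx normr0.
  by have /integrableP[] := iD 0.
have eqD (r : R) : `|r| <= 1 -> (\int[mu]_(x in D) (h (x + r *: e_ i))%:E = \int[mu]_x (h x)%:E)%E.
  move=> r1; rewrite -(integral_translation (r *: e_ i) ih) integral_mkcond.
  apply: eq_integral => x _; rewrite patchE [r *: e_ i + x]addrC /=.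
  case: ifPn => // /negP nD; rewrite suppD// => Dx; apply: nD; exact/mem_set.
pose f_ k (x : E) := ((h (x + k.+1%:R^-1 *: e_ i) - h x) * k.+1%:R)%:E.
have k1 k : `|k.+1%:R^-1 : R| <= 1.
  by rewrite ger0_norm// invf_le1// ler1n.
have mf_ k : measurable_fun D (f_ k).
  apply/measurable_EFinP; apply: measurable_funTS; apply: measurable_funM => //.
  exact: measurable_funB.
have mf : measurable_fun D (fun x => (partial i h x)%:E).
  by apply/measurable_EFinP; apply: measurable_funTS; exact: continuous_measurable_rV.
have cf : {ae mu, forall x, D x -> f_ ^~ x @ \oo --> (partial i h x)%:E}.
  by apply: aeW => x _; apply: cvg_EFin; [exact: nearW|exact: cvg_difference_quotient].
have le_f : {ae mu, forall x k, D x -> (`|f_ k x| <= cst B%:E x)%E}.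
  apply: aeW => x k _; rewrite /f_ abse_EFin lee_fin normrM [X in _ * X]ger0_norm//.
  rewrite -ler_pdivlMr//; apply: difference_quotient_le => //.
have [_ _ lim] := dominated_convergence mD mf_ mf cf (cstD B) le_f.
have f0 k : (\int[mu]_(x in D) f_ k x = 0)%E.
  have := eqD _ (k1 k); have := eqD 0; rewrite normr0 scale0r => /(_ ler01) e0 ek.
  rewrite /f_; under eq_integral do rewrite EFinM.
  rewrite integralZr//; last first.
    have := integrableB mD (iD (k.+1%:R^-1 *: e_ i)) (iD 0).
    by congr (_.-integrable _ _); apply/funext => x /=; rewrite addr0.
  rewrite (_ : (\int[mu]_(x in D) _)%E = 0%E) ?mul0e//.
  have -> : (\int[mu]_(x in D) (h (x + k.+1%:R^-1 *: e_ i) - h x)%:E =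
     \int[mu]_(x in D) ((h (x + k.+1%:R^-1 *: e_ i))%:E - (h (x + 0))%:E))%E.
    by apply: eq_integral => x _; rewrite addr0.
  rewrite integralB//; rewrite [X in (X - _)%E]ek [X in (_ - X)%E]e0 subee//.
  exact: integrable_fin_num ih.
have c0 : (fun k => \int[mu]_(x in D) f_ k x)%E @ \oo --> 0%E.
  by under eq_fun do rewrite f0; exact: cvg_cst.
rewrite /Rintegral (_ : (\int[mu]_x _)%E = 0%E)//.
rewrite -(cvg_unique _ lim c0); last exact: ereal_hausdorff.
rewrite [RHS]integral_mkcond; apply: eq_integral => x _; rewrite patchE.
case: ifPn => // /negP nD; congr EFin; apply: contrapT => /eqP/hK'/(hM _ MN)/= xN.
apply: nD; apply/mem_set/(rV_ballP _ _ D0) => j; rewrite mxE sub0r normrN.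
by apply: (le_lt_trans (le_trans (normr_rV_coord _ j) xN)); rewrite ltrDl.
Qed.

End integration_by_parts.

(** * Weak gradients of test functions *)

Section test_functions.
Context (R : realType) (d : nat) (Omega : set 'rV[R]_d).
Hypotheses (bO : bounded_set Omega) (oO : open Omega).
Local Notation mu := (leb R d).
Local Notation E := 'rV[R]_d.
Implicit Types (psi eta u : E -> R) (g : E -> E) (i : 'I_d).

Let mO : measurable Omega. Proof. exact: open_measurable_rV. Qed.

Let fO : (mu Omega < +oo)%E. Proof. exact: leb_bounded_lty. Qed.

Lemma Cc_infty_continuous psi : Cc_infty Omega psi -> continuous psi.
Proof. by move=> [+ _ _] => /(_ 0%N); exact: Ck_continuous. Qed.

Lemma Cc_infty_derivable psi i x : Cc_infty Omega psi ->
  derivable psi x (delta_mx ord0 i).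
Proof. by move=> [+ _ _] => /(_ 1%N)[_ /(_ i)[]]. Qed.

Lemma Cc_infty_partial psi i : Cc_infty Omega psi -> continuous (partial i psi).
Proof. by move=> [+ _ _] => /(_ 1%N)[_ /(_ i)[_ []]]. Qed.

Lemma Cc_infty_partial_support psi i x : Cc_infty Omega psi ->
  partial i psi x != 0 -> closure [set x | psi x != 0] x.
Proof.
move=> cpsi; apply: partial_support; first exact: closed_closure.
by move=> y py; exact: subset_closure.
Qed.

Lemma bounded_continuous_L2 (h : E -> R) K : compact K -> continuous h ->
  (forall x, h x != 0 -> K x) -> L2 Omega h.
Proof.
move=> cK ch hK; have [B _ hB] := compact_support_bounded cK ch hK.
apply: (L2_bounded mO (B := B)) => //.
by apply: measurable_funTS; exact: continuous_measurable_rV.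
Qed.

Lemma Cc_infty_L2 psi : Cc_infty Omega psi -> L2 Omega psi.
Proof.
move=> cpsi; have [_ cK _] := cpsi.
apply: (bounded_continuous_L2 cK); first exact: Cc_infty_continuous.
by move=> x px; exact: subset_closure.
Qed.

Lemma Cc_infty_partial_L2 psi i : Cc_infty Omega psi -> L2 Omega (partial i psi).
Proof.
move=> cpsi; have [_ cK _] := cpsi.
apply: (bounded_continuous_L2 cK); first exact: Cc_infty_partial.
by move=> x; exact: Cc_infty_partial_support.
Qed.

Lemma Cc_infty_grad_L2v psi : Cc_infty Omega psi -> L2v Omega (grad psi).
Proof.
move=> cpsi i; rewrite (_ : (fun _ => _) = partial i psi); first exact: Cc_infty_partial_L2.
by apply/funext => x; rewrite mxE.
Qed.

(** The derivative of [psi * eta] has zero integral over the whole space, and it vanishes off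
    [Omega] since [psi] does. *)
Lemma Cc_infty_weak_grad psi : Cc_infty Omega psi -> is_weak_grad Omega psi (grad psi).
Proof.
move=> cpsi eta ceta i.
have dM x : partial i (fun x => psi x * eta x) x = psi x * partial i eta x + eta x * partial i psi x.
  by apply: partialM; exact: Cc_infty_derivable.
have h0 : \int[mu]_x partial i (fun x => psi x * eta x) x = 0.
  have [_ cK _] := cpsi.
  apply: (integral_partial_eq0 cK).
  - by move=> x; apply: continuousM; exact: Cc_infty_continuous.
  - by move=> x; apply: derivableM; exact: Cc_infty_derivable.
  - rewrite (funext dM) => x.
    have c1 : {for x, continuous (fun x => psi x * partial i eta x)}.
      by apply: continuousM; [exact: Cc_infty_continuous|exact: Cc_infty_partial].
    have c2 : {for x, continuous (fun x => eta x * partial i psi x)}.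
      by apply: continuousM; [exact: Cc_infty_continuous|exact: Cc_infty_partial].
    exact: continuousD c1 c2.
  - move=> x; rewrite mulf_eq0 negb_or => /andP[px _]; exact: subset_closure.
have [_ _ pO] := cpsi.
have /eqP : \int[mu]_(x in Omega) (psi x * partial i eta x + eta x * partial i psi x) = 0.
  rewrite -h0 Rintegral_mkcond; congr (fine _); apply: eq_integral => x _; congr EFin.
  rewrite patchE dM; case: ifPn => // /negP nO.
  have -> : psi x = 0.
    by apply: contrapT => /eqP px; apply: nO; apply/mem_set/pO/subset_closure.
  have -> : partial i psi x = 0.
    by apply: contrapT => /eqP px; apply: nO; apply/mem_set/pO/(Cc_infty_partial_support cpsi px).
  by rewrite mul0r mulr0 addr0.
rewrite RintegralD//; last 2 first.
- by apply: L2M_integrable => //; [exact: Cc_infty_L2|exact: Cc_infty_partial_L2].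
- by apply: L2M_integrable => //; [exact: Cc_infty_L2|exact: Cc_infty_partial_L2].
rewrite addr_eq0 => /eqP ->; congr (- _).
by apply: eq_Rintegral => x _; rewrite mxE mulrC.
Qed.

Lemma orthogonal_Cc_infty_eq u v : L2 Omega u -> L2 Omega v ->
  (forall psi, Cc_infty Omega psi ->
    \int[mu]_(x in Omega) (u x * psi x) = \int[mu]_(x in Omega) (v x * psi x)) ->
  {ae mu, forall x, Omega x -> u x = v x}.
Proof.
move=> L2u L2v uv.
have h : {ae mu, forall x, Omega x -> (u \- v) x = 0}.
  apply: (du_bois_reymond bO oO); first exact: L2B.
  move=> psi cpsi; have L2p := Cc_infty_L2 cpsi.
  rewrite (_ : \int[mu]_(x in Omega) _ = \int[mu]_(x in Omega) (u x * psi x - v x * psi x)).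
    by rewrite RintegralB ?uv ?subrr//; apply: L2M_integrable.
  by apply: eq_Rintegral => x _ /=; rewrite mulrBl.
by apply: filterS h => x h /h /eqP; rewrite subr_eq0 => /eqP.
Qed.

Lemma weak_grad_unique u g1 g2 : L2v Omega g1 -> L2v Omega g2 ->
  is_weak_grad Omega u g1 -> is_weak_grad Omega u g2 ->
  {ae mu, forall x, Omega x -> g1 x = g2 x}.
Proof.
move=> L1 L2g w1 w2.
have h i : mu.-negligible [set x | ~ (Omega x -> g1 x ord0 i = g2 x ord0 i)].
  apply: (orthogonal_Cc_infty_eq (u := fun x => g1 x ord0 i) (v := fun x => g2 x ord0 i)) => //.
  by move=> psi cpsi; apply: oppr_inj; rewrite -w1// -w2.
apply: negligibleS (negligible_bigcup_fin h) => x /= /not_implyP[Ox g12].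
apply: contrapT => H; apply: g12; apply/rowP => i; apply: contrapT => gi.
by apply: H; exists i => //= /(_ Ox).
Qed.

Lemma wgradP u : H1 Omega u ->
  L2v Omega (wgrad Omega u) /\ is_weak_grad Omega u (wgrad Omega u).
Proof.
by move=> [_ [g hg]]; exact: (@xgetPex _ 0 [set g | L2v Omega g /\ is_weak_grad Omega u g] (ex_intro _ g hg)).
Qed.

Lemma Cc_infty_H1 psi : Cc_infty Omega psi -> H1 Omega psi.
Proof.
move=> cpsi; split; first exact: Cc_infty_L2.
exists (grad psi); split; [exact: Cc_infty_grad_L2v|exact: Cc_infty_weak_grad].
Qed.

Lemma wgrad_Cc_infty psi : Cc_infty Omega psi ->
  {ae mu, forall x, Omega x -> wgrad Omega psi x = grad psi x}.
Proof.
move=> cpsi; have [L2w ww] := wgradP (Cc_infty_H1 cpsi).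
apply: (weak_grad_unique L2w _ ww); [exact: Cc_infty_grad_L2v|exact: Cc_infty_weak_grad].
Qed.

Lemma enorm_L2 g : L2v Omega g -> L2 Omega (fun x => enorm (g x)).
Proof.
move=> L2g; have id := L2_dotv_integrable mO L2g L2g.
apply/L2P => //; split.
  apply: (measurableT_comp (continuous_measurable_fun (@sqrt_continuous R))).
  by apply/measurable_EFinP; exact: measurable_int id.
by move: id; congr (_.-integrable _ _); apply/funext => x; rewrite sqr_enorm.
Qed.

Lemma L2v_sub g1 g2 : L2v Omega g1 -> L2v Omega g2 -> L2v Omega (g1 \- g2).
Proof.
move=> L1 L2g i; have := L2B mO (L1 i) (L2g i).
by congr (L2 _ _); apply/funext => x /=; rewrite !mxE.
Qed.

(** Opens the weak formulation to test functions. [psi] is its own approximation, because the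
    representative [wgrad] agrees with [grad] almost everywhere. *)
Lemma Cc_infty_H10 psi : Cc_infty Omega psi -> H10 Omega psi.
Proof.
move=> cpsi; split; first exact: Cc_infty_H1.
have L2p := Cc_infty_L2 cpsi.
have [L2w _] := wgradP (Cc_infty_H1 cpsi).
move=> e e0; exists psi; split=> //.
  suff -> : L2norm Omega (psi \- psi) = 0 by [].
  rewrite (_ : psi \- psi = fun x => 0 * psi x).
    by rewrite L2normZ// normr0 mul0r.
  by apply/funext => x /=; rewrite subrr mul0r.
suff -> : L2vnorm Omega (wgrad Omega psi \- grad psi) = 0 by [].
have L2d := L2v_sub L2w (Cc_infty_grad_L2v cpsi).
apply/eqP; rewrite -sqrf_eq0 /L2vnorm (L2norm_sqr mO (enorm_L2 L2d)).
apply/eqP; rewrite /Rintegral (ae_eq_integral (cst 0%E))//.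
- by rewrite integral0.
- by have [_ /measurable_int] := (L2P mO _).1 (enorm_L2 L2d).
- apply: filterS (wgrad_Cc_infty cpsi) => x h Ox /=.
  by rewrite sqr_enorm h// subrr /dotv big1// => i _; rewrite mxE mul0r.
Qed.

End test_functions.

(** * Error estimate *)

Lemma Rintegral_sum d (U : measurableType d) (R : realType)
    (mu : {measure set U -> \bar R}) (D : set U) (I : Type) (s : seq I)
    (P : pred I) (f : I -> U -> R) : measurable D ->
  (forall i, P i -> mu.-integrable D (EFin \o f i)) ->
  \int[mu]_(x in D) (\sum_(i <- s | P i) f i x) =
  \sum_(i <- s | P i) \int[mu]_(x in D) f i x.
Proof.
move=> mD fi; elim: s => [|i s IH].
  by rewrite big_nil /Rintegral integral0_eq// => x _; rewrite big_nil.
rewrite big_cons; case: ifPn => Pi; last first.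
  by rewrite -IH; apply: eq_Rintegral => x _; rewrite big_cons (negbTE Pi).
rewrite -IH -RintegralD//; last 2 first.
- exact: fi.
- rewrite (_ : EFin \o _ = fun x => (\sum_(i <- s | P i) (f i x)%:E)%E).
    exact: integrable_sum.
  by apply/funext => x /=; rewrite sumEFin.
by apply: eq_Rintegral => x _; rewrite big_cons Pi.
Qed.

(** * Discrete functions and mean normal gradients *)

Section discrete_functions.
Context (R : realType) (n : nat) (Omega : set 'rV[R]_n.+1).
Hypotheses (bO : bounded_set Omega) (oO : open Omega) (O0 : Omega !=set0).
Variable T : admissible_mesh Omega.
Local Notation mu := (leb R n.+1).
Local Notation E := 'rV[R]_n.+1.
Implicit Types (v w : dofs T) (g : E -> E) (h : cell T * edge T).

Let mO : measurable Omega. Proof. exact: open_measurable_rV. Qed.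

Let fO : (mu Omega < +oo)%E. Proof. exact: leb_bounded_lty. Qed.

Lemma L2_indic (A : set E) : measurable A -> L2 Omega \1_A.
Proof.
move=> mA; apply: (L2_bounded mO (B := 1)) => // x _.
by rewrite indicE; case: (_ \in _); rewrite ?normr1 ?normr0.
Qed.

Lemma L2_sum (I : finType) (P : pred I) (k : I -> E -> R) :
  (forall i, P i -> L2 Omega (k i)) -> L2 Omega (fun x => \sum_(i | P i) k i x).
Proof.
move=> ki; rewrite (_ : (fun x => _) = \sum_(i | P i) k i); last first.
  by apply/funext => x; rewrite fct_sumE.
elim/big_rec: _ => [|i u Pi Lu].
  apply: (L2_bounded mO (B := 0)) => //; first exact: measurable_cst.
  by move=> x _; rewrite normr0.
exact: (L2D mO (ki _ Pi) Lu).
Qed.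

Definition slope v h := (v.2 h.2 - v.1 h.1) / dist_face h.1 h.2.

Definition half_normal h := out_normal h.1 h.2.

Definition half_mean g h :=
  (fine (mu (half_cone h)))^-1 *
  \int[mu]_(y in half_cone h) dotv (g y) (half_normal h).

Lemma gradT_coord v x i : gradT v x ord0 i =
  \sum_(h | half_edge h) (n.+1%:R * slope v h * half_normal h ord0 i) * \1_(half_cone h) x.
Proof.
rewrite /gradT summxE; under eq_bigr do rewrite summxE.
rewrite pair_big_dep; apply: eq_bigr => h _.
by rewrite mxE mulrAC.
Qed.

Lemma meanGT_sum phi x : meanGT T phi x =
  \sum_(h | half_edge h) half_mean (wgrad Omega phi) h * \1_(half_cone h) x.
Proof. by rewrite /meanGT pair_big_dep. Qed.

Lemma L2_half_sum (k : cell T * edge T -> R) :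
  L2 Omega (fun x => \sum_(h | half_edge h) k h * \1_(half_cone h) x).
Proof.
by apply: L2_sum => h hh; apply: L2Z => //; apply: L2_indic; exact: measurable_half_cone.
Qed.

Lemma fun_of_L2 v : L2 Omega (fun_of v).
Proof.
apply: L2_sum => K _; apply: L2Z => //; apply: L2_indic.
by apply: open_measurable_rV; exact: open_vol.
Qed.

Lemma GT_L2 v : L2 Omega (GT v).
Proof. by have := L2_half_sum (slope v); congr L2; apply/funext => x; rewrite GT_sum. Qed.

Lemma meanGT_L2 phi : L2 Omega (meanGT T phi).
Proof.
by have := L2_half_sum (half_mean (wgrad Omega phi)); congr L2; apply/funext => x; rewrite meanGT_sum.
Qed.

Lemma gradT_L2v v : L2v Omega (gradT v).
Proof.
move=> i; have := L2_half_sum (fun h => n.+1%:R * slope v h * half_normal h ord0 i).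
by congr L2; apply/funext => x; rewrite gradT_coord.
Qed.

Lemma dotv_gradT v (a : E) x : dotv a (gradT v x) =
  \sum_(h | half_edge h) n.+1%:R * slope v h * (dotv a (half_normal h) * \1_(half_cone h) x).
Proof.
rewrite /dotv; under eq_bigr do rewrite gradT_coord mulr_sumr.
rewrite exchange_big /=; apply: eq_bigr => h _.
by rewrite mulr_suml mulr_sumr; apply: eq_bigr => i _; ring.
Qed.

Lemma meanGT_GT phi v x : meanGT T phi x * GT v x =
  \sum_(h | half_edge h) half_mean (wgrad Omega phi) h * slope v h * \1_(half_cone h) x.
Proof.
rewrite meanGT_sum GT_sum mulr_suml; apply: eq_bigr => h hh.
have [xh|xh] := pselect (half_cone h x); last first.
  by rewrite indicE memNset// !mulr0 mul0r.
rewrite (bigD1 h)//= big1 ?addr0; last first.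
  move=> h' /andP[hh' h'h]; rewrite [\1_(half_cone h') _]indicE memNset ?mulr0// => xh'.
  by move/eqP : h'h; apply; exact: (half_cone_inj hh' hh xh' xh).
by rewrite indicE mem_set// !mulr1.
Qed.

Lemma Rintegral_half_cone (k : E -> R) h : half_edge h ->
  \int[mu]_(x in Omega) (k x * \1_(half_cone h) x) = \int[mu]_(x in half_cone h) k x.
Proof.
move=> hh; rewrite Rintegral_mkcond [RHS]Rintegral_mkcond; apply: eq_Rintegral => x _.
rewrite !patchE indicE; case: ifPn; case: ifPn; rewrite ?mulr1 ?mulr0// !inE.
by move=> /(half_cone_sub hh) ? /negP; rewrite inE.
Qed.

Lemma integral_dotv_gradT phi v : L2v Omega (wgrad Omega phi) ->
  \int[mu]_(x in Omega) dotv (wgrad Omega phi x) (gradT v x) =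
  n.+1%:R * \int[mu]_(x in Omega) (meanGT T phi x * GT v x).
Proof.
move=> L2g.
have L2c h : L2 Omega (fun x => dotv (wgrad Omega phi x) (half_normal h)).
  by apply: L2_sum => i _; under eq_fun do rewrite mulrC; exact: L2Z.
have L2i h : half_edge h -> L2 Omega (\1_(half_cone h) : E -> R).
  by move=> hh; apply: L2_indic; exact: measurable_half_cone.
under eq_Rintegral do rewrite dotv_gradT.
under [in RHS]eq_Rintegral do rewrite meanGT_GT.
rewrite !Rintegral_sum//; last 2 first.
- by move=> h /L2i L2h; apply: L2_integrable => //; exact: L2Z.
- move=> h /L2i L2h.
  exact: (integrableZl mO (n.+1%:R * slope v h) (L2M_integrable mO (L2c h) L2h)).
rewrite mulr_sumr; apply: eq_bigr => h hh.
rewrite RintegralZl//; last exact: (L2M_integrable mO (L2c h) (L2i h hh)).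
rewrite RintegralZl//; last exact: (L2_integrable bO oO (L2i h hh)).
rewrite Rintegral_half_cone//.
have -> : \int[mu]_(x in Omega) \1_(half_cone h) x = fine (mu (half_cone h)).
  rewrite /Rintegral integral_indic//; last exact: measurable_half_cone.
  by rewrite setIidl//; exact: half_cone_sub.
rewrite /half_mean; set m := mu (half_cone h).
(* A cone of measure zero has mean 0 by the convention [0^-1 = 0], and the integral over it vanishes
   as well. *)
have [m0|m0] := eqVneq (fine m) 0; last by field.
have mc := measurable_half_cone hh.
have mz : m = 0%E.
  have mf : (m < +oo)%E by apply: le_lt_trans fO; apply: le_measure; rewrite ?inE//; exact: half_cone_sub.
  have mfin : m \is a fin_num by rewrite ge0_fin_numE ?measure_ge0.
  by rewrite -(fineK mfin) m0.
rewrite [X in _ * X = _](_ : _ = 0) ?m0 ?mulr0//.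
rewrite /Rintegral null_set_integral//.
apply/measurable_EFinP; apply: measurable_funS mO _ (L2_measurable mO (L2c h)).
exact: half_cone_sub.
Qed.

Lemma normTE v : normT v = Num.sqrt n.+1%:R * L2norm Omega (GT v).
Proof. by rewrite /normT sqrtrM// sqrtr_sqr ger0_norm// L2norm_ge0. Qed.

Lemma discrete_poincare_L2norm v : XT v -> L2norm Omega (fun_of v) <= diam Omega * normT v.
Proof.
move=> Xv; have D0 := ltW (diam_gt0 bO ord0 oO O0).
have N0 := L2norm_ge0 Omega (GT v).
rewrite -(@ler_pXn2r _ 2) ?nnegrE ?L2norm_ge0 ?mulr_ge0 ?sqrtr_ge0//.
rewrite normTE !exprMn sqr_sqrtr// !L2norm_sqr//; [|exact: GT_L2|exact: fun_of_L2].
have := discrete_poincare bO oO O0 Xv.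
have r (k : E -> R) : L2 Omega k -> (forall x, ~ Omega x -> k x = 0) ->
    (\int[mu]_x (k x ^+ 2)%:E = (\int[mu]_(x in Omega) (k x ^+ 2))%:E)%E.
  move=> L2k kO; rewrite /Rintegral fineK.
    rewrite [RHS]integral_mkcond; apply: eq_integral => x _.
    by rewrite patchE; case: ifPn => //; rewrite notin_setE => /kO ->; rewrite expr0n.
  exact: (integrable_fin_num mO ((L2P mO k).1 L2k).2).
rewrite !r -?EFinM ?lee_fin ?mulrA//.
- exact: GT_L2.
- move=> x Ox; rewrite GT_sum big1// => h hh; rewrite indicE memNset ?mulr0//.
  by move=> /(half_cone_sub hh).
- exact: fun_of_L2.
- by move=> x Ox; apply: fun_of_notin => K /vol_sub.
Qed.

End discrete_functions.

(** * Residual of the scheme and conformity error *)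

Section finite_volume_scheme.
Context (R : realType) (n : nat) (Omega : set 'rV[R]_n.+1).
Hypotheses (bO : bounded_set Omega) (oO : open Omega) (O0 : Omega !=set0).
Local Notation mu := (leb R n.+1).
Local Notation E := 'rV[R]_n.+1.
Variable f : E -> R.
Hypothesis L2f : L2 Omega f.
Variable F : E -> E.
Hypothesis L2F : L2v Omega F.
Variable ubar : E -> R.
Hypothesis H10u : H10 Omega ubar.
Hypothesis weak_form : forall phi, H10 Omega phi ->
  \int[mu]_(x in Omega) dotv (wgrad Omega ubar x) (wgrad Omega phi x) =
  \int[mu]_(x in Omega) (f x * phi x - dotv (F x) (wgrad Omega phi x)).

Let mO : measurable Omega. Proof. exact: open_measurable_rV. Qed.

Let flux : E -> E := wgrad Omega ubar \+ F.

Let L2g : L2v Omega (wgrad Omega ubar).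
Proof. by have [/wgradP[]] := H10u. Qed.

Lemma dotvDl (x y z : E) : dotv (x + y) z = dotv x z + dotv y z.
Proof. by rewrite dotvC dotvDr !(dotvC z). Qed.

Lemma flux_L2v : L2v Omega flux.
Proof.
move=> i; have := L2D mO (L2g i) (L2F i).
by congr L2; apply/funext => x /=; rewrite mxE.
Qed.

Lemma Rintegral_dotv_flux (h : E -> E) : L2v Omega h ->
  \int[mu]_(x in Omega) dotv (flux x) (h x) =
  \int[mu]_(x in Omega) dotv (wgrad Omega ubar x) (h x) +
  \int[mu]_(x in Omega) dotv (F x) (h x).
Proof.
move=> L2h; rewrite -RintegralD//; try exact: L2_dotv_integrable.
by apply: eq_Rintegral => x _; rewrite -dotvDl.
Qed.

Lemma flux_weak_div : is_weak_div Omega flux (fun x => - f x).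
Proof.
move=> psi cpsi; have Lpsi := Cc_infty_L2 bO oO cpsi.
have Lgrad := Cc_infty_grad_L2v bO oO cpsi.
have [Lwgrad _] := wgradP (Cc_infty_H1 bO oO cpsi).
have grad_eq (g : E -> E) : L2v Omega g ->
    \int[mu]_(x in Omega) dotv (g x) (grad psi x) =
    \int[mu]_(x in Omega) dotv (g x) (wgrad Omega psi x).
  move=> Lg; congr fine; apply: ae_eq_integral => //.
  - exact: measurable_int (L2_dotv_integrable mO Lg Lgrad).
  - exact: measurable_int (L2_dotv_integrable mO Lg Lwgrad).
  - by apply: filterS (wgrad_Cc_infty bO oO cpsi) => x h /h ->.
have ifpsi := L2M_integrable mO L2f Lpsi.
have iF := L2_dotv_integrable mO L2F Lwgrad.
rewrite Rintegral_dotv_flux// !grad_eq// (weak_form (Cc_infty_H10 bO oO cpsi)) RintegralB//.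
rewrite subrK (_ : \int[mu]_(x in Omega) (- f x * psi x) =
  \int[mu]_(x in Omega) (-1 * (f x * psi x))).
  by rewrite RintegralZl// mulN1r opprK.
by apply: eq_Rintegral => x _; rewrite mulN1r mulNr.
Qed.

Let L2Nf : L2 Omega (fun x => - f x).
Proof. by have := L2Z mO (-1) L2f; congr L2; apply/funext => x; rewrite mulN1r. Qed.

Lemma flux_Hdiv : Hdiv Omega flux.
Proof.
by split; [exact: flux_L2v|exists (fun x => - f x); split=> //; exact: flux_weak_div].
Qed.

Let wdivP : L2 Omega (wdiv Omega flux) /\ is_weak_div Omega flux (wdiv Omega flux).
Proof.
have [_ [g hg]] := flux_Hdiv.
exact: (@xgetPex _ 0 [set g | L2 Omega g /\ is_weak_div Omega flux g] (ex_intro _ g hg)).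
Qed.

Lemma wdiv_flux : {ae mu, forall x, Omega x -> wdiv Omega flux x = - f x}.
Proof.
have [L2w ww] := wdivP; apply: (orthogonal_Cc_infty_eq bO oO L2w L2Nf) => psi cpsi.
by apply: oppr_inj; rewrite -ww// flux_weak_div.
Qed.

Variable T : admissible_mesh Omega.
Implicit Types v w : dofs T.
Variable u : dofs T.
Hypothesis Xu : XT u.
Hypothesis scheme : forall v, XT v ->
  n.+1%:R * \int[mu]_(x in Omega) (GT u x * GT v x) =
  \int[mu]_(x in Omega) (f x * fun_of v x - dotv (F x) (gradT v x)).

Let residual v := \int[mu]_(x in Omega)
  (wdiv Omega flux x * fun_of v x + dotv (flux x) (gradT v x)).

Lemma residualE v : XT v -> residual v =
  n.+1%:R * \int[mu]_(x in Omega) ((meanGT T ubar \- GT u) x * GT v x).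
Proof.
move=> Xv; rewrite /residual.
have Lw := wdivP.1; have Lv := fun_of_L2 bO oO v; have Lg := gradT_L2v bO oO v.
have LG := GT_L2 bO oO v; have LU := GT_L2 bO oO u.
have LM := meanGT_L2 bO oO T ubar.
rewrite RintegralD//; last 2 first.
- exact: L2M_integrable.
- exact: (L2_dotv_integrable mO flux_L2v Lg).
rewrite (L2_ae_eq mO wdiv_flux (L2_measurable mO Lw) (L2_measurable mO L2Nf) Lv).
rewrite Rintegral_dotv_flux// integral_dotv_gradT//.
rewrite (_ : \int[mu]_(x in Omega) ((meanGT T ubar \- GT u) x * GT v x) =
  \int[mu]_(x in Omega) (meanGT T ubar x * GT v x - GT u x * GT v x)); last first.
  by apply: eq_Rintegral => x _; rewrite /= mulrBl.
rewrite RintegralB//; try exact: L2M_integrable.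
rewrite mulrBr scheme// RintegralB//; last 2 first.
- exact: (L2M_integrable mO L2f Lv).
- exact: (L2_dotv_integrable mO L2F Lg).
rewrite (_ : \int[mu]_(x in Omega) (- f x * fun_of v x) =
  \int[mu]_(x in Omega) (-1 * (f x * fun_of v x))); last first.
  by apply: eq_Rintegral => x _; rewrite mulN1r mulNr.
by rewrite RintegralZl//; [ring|exact: (L2M_integrable mO L2f Lv)].
Qed.

(** Covers both scaling, with [w] zero, and differences, with [a = -1]. *)
Definition dofs_comb a v w : dofs T :=
  (fun K => a * v.1 K + w.1 K, fun s => a * v.2 s + w.2 s).

Lemma XT_comb a v w : XT v -> XT w -> XT (dofs_comb a v w).
Proof. by move=> Xv Xw s sx; rewrite /= Xv// Xw// mulr0 addr0. Qed.

Lemma fun_of_comb a v w x : fun_of (dofs_comb a v w) x = a * fun_of v x + fun_of w x.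
Proof.
by rewrite /fun_of mulr_sumr -big_split /=; apply: eq_bigr => K _; ring.
Qed.

Lemma GT_comb a v w x : GT (dofs_comb a v w) x = a * GT v x + GT w x.
Proof.
rewrite !GT_sum mulr_sumr -big_split /=; apply: eq_bigr => h _; ring.
Qed.

Let zero : dofs T := (fun=> 0, fun=> 0).

Let GT0 x : GT zero x = 0.
Proof. by rewrite GT_sum big1// => h _; rewrite subrr !mul0r. Qed.

Let scale a v := dofs_comb a v zero.

Let GT_scale a v : GT (scale a v) = fun x => a * GT v x.
Proof. by apply/funext => x; rewrite GT_comb GT0 addr0. Qed.

Let normT_scale a v : normT (scale a v) = `|a| * normT v.
Proof.
by rewrite !normTE GT_scale L2normZ// 1?mulrCA//; exact: GT_L2.
Qed.

Let residual_scale a v : XT v -> residual (scale a v) = a * residual v.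
Proof.
move=> Xv; rewrite !residualE//; last exact: XT_comb.
have LB := L2B mO (meanGT_L2 bO oO T ubar) (GT_L2 bO oO u).
rewrite mulrCA; congr (_ * _); rewrite -RintegralZl//; last first.
  exact: (L2M_integrable mO LB (GT_L2 bO oO v)).
by apply: eq_Rintegral => x _; rewrite GT_scale; ring.
Qed.

Let flux_err v := Num.sqrt n.+1%:R * L2norm Omega (meanGT T ubar \- GT v).

Let sqrt_dim : Num.sqrt n.+1%:R * Num.sqrt n.+1%:R = n.+1%:R :> R.
Proof. by rewrite -expr2 sqr_sqrtr. Qed.

Let normT_ge0 v : 0 <= normT v. Proof. exact: sqrtr_ge0. Qed.

Let flux_err_ge0 v : 0 <= flux_err v.
Proof. by rewrite mulr_ge0 ?sqrtr_ge0 ?L2norm_ge0. Qed.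

Let pairing_le v w :
  `|n.+1%:R * \int[mu]_(x in Omega) ((meanGT T ubar \- GT v) x * GT w x)|
  <= flux_err v * normT w.
Proof.
rewrite normrM ger0_norm// -{1}sqrt_dim normTE /flux_err -!mulrA ler_wpM2l ?sqrtr_ge0//.
rewrite [leRHS]mulrCA ler_wpM2l ?sqrtr_ge0//; apply: L2_cauchy_schwarz => //.
  by apply: L2B => //; [exact: meanGT_L2|exact: GT_L2].
exact: GT_L2.
Qed.

Let residual_le v : XT v -> residual v <= flux_err u * normT v.
Proof. by move=> Xv; rewrite residualE// (le_trans (ler_norm _))// pairing_le. Qed.

Let zeta := zetaT T flux.

Let unit_residuals : set R := [set residual v | v in [set v | XT v /\ normT v = 1]].

Let zetaE : zeta = sup unit_residuals. Proof. by []. Qed.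

Let residuals_ub v : XT v -> normT v = 1 -> residual v <= zeta.
Proof.
move=> Xv v1; apply: ub_le_sup; last by exists v.
exists (flux_err u) => _ [w [Xw w1] <-].
by have := residual_le Xw; rewrite w1 mulr1.
Qed.

Lemma zetaT_le_flux_err : zeta <= flux_err u.
Proof.
rewrite zetaE; have [->|/set0P S0] := eqVneq unit_residuals set0; first by rewrite sup0.
apply: ge_sup => // _ [w [Xw w1] <-].
by have := residual_le Xw; rewrite w1 mulr1.
Qed.

(** A unit [v] and its opposite have opposite residuals, both at most [zeta]. If there is no unit
    vector, [zeta] is the supremum of the empty set, which is 0. *)
Lemma zetaT_ge0 : 0 <= zeta.
Proof.
have [[v Xv v1]|none] := pselect (exists2 v : dofs T, XT v & normT v = 1); last first.
  rewrite zetaE (_ : unit_residuals = set0) ?sup0//.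
  by rewrite -subset0 => t [v [Xv v1] _]; apply: none; exists v.
have XNv : XT (scale (-1) v) by exact: XT_comb.
have := residuals_ub Xv v1; have := residuals_ub XNv; rewrite normT_scale v1 normrN1 mulr1.
by rewrite residual_scale// => /(_ erefl); lra.
Qed.

(** Homogeneity reduces to unit norm; a [v] of norm zero cannot be normalised and is handled by the
    Cauchy-Schwarz bound [residual_le]. *)
Lemma residual_le_zetaT v : XT v -> residual v <= zeta * normT v.
Proof.
move=> Xv; have [v0|v0] := eqVneq (normT v) 0.
  by have := residual_le Xv; rewrite v0 !mulr0.
have vp : 0 < normT v by rewrite lt0r v0 normT_ge0.
have Xw : XT (scale (normT v)^-1 v) by exact: XT_comb.
have := residuals_ub Xw; rewrite normT_scale residual_scale//.
rewrite ger0_norm ?invr_ge0// mulVf// => /(_ erefl).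
by rewrite mulrC ler_pdivrMr.
Qed.

Let diff v := dofs_comb (-1) u v.

Lemma normT_diff_le v : XT v -> normT (diff v) <= flux_err v + zeta.
Proof.
move=> Xv; set w := diff v; have Xw : XT w by exact: XT_comb.
have [w0|w0] := eqVneq (normT w) 0.
  by rewrite w0 addr_ge0// zetaT_ge0.
have wp : 0 < normT w by rewrite lt0r w0 normT_ge0.
rewrite -(ler_pM2r wp) mulrDl.
have LW := GT_L2 bO oO w.
have -> : normT w * normT w = residual w -
    n.+1%:R * \int[mu]_(x in Omega) ((meanGT T ubar \- GT v) x * GT w x).
  rewrite residualE// -mulrBr normTE mulrACA sqrt_dim -expr2 L2norm_sqr//.
  rewrite -RintegralB//; last 2 first.
  - by apply: (L2M_integrable mO (L2B mO (meanGT_L2 bO oO T ubar) (GT_L2 bO oO u)) LW).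
  - by apply: (L2M_integrable mO (L2B mO (meanGT_L2 bO oO T ubar) (GT_L2 bO oO v)) LW).
  by congr (_ * _); apply: eq_Rintegral => x _; rewrite /= GT_comb; ring.
rewrite addrC lerD// ?residual_le_zetaT//.
by apply: le_trans (pairing_le v w); rewrite -normrN ler_norm.
Qed.

Lemma deltaT_le v : XT v -> deltaT ubar u <= 3 * deltaT ubar v + 2 * zeta.
Proof.
move=> Xv; have D0 := diam_gt0 bO ord0 oO O0.
have Xw : XT (diff v) by exact: XT_comb.
have Lu : L2 Omega ubar by have [[]] := H10u.
have Lv := fun_of_L2 bO oO v; have Lw := fun_of_L2 bO oO (diff v).
have LM := meanGT_L2 bO oO T ubar; have LG := GT_L2 bO oO v; have LW := GT_L2 bO oO (diff v).
have e1 : L2norm Omega (ubar \- fun_of u) <=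
    L2norm Omega (ubar \- fun_of v) + L2norm Omega (fun_of (diff v)).
  rewrite (_ : ubar \- fun_of u = (ubar \- fun_of v) \+ fun_of (diff v)).
    by apply: L2norm_triangle => //; exact: L2B.
  by apply/funext => x /=; rewrite fun_of_comb; ring.
have e2 : L2norm Omega (meanGT T ubar \- GT u) <=
    L2norm Omega (meanGT T ubar \- GT v) + L2norm Omega (GT (diff v)).
  rewrite (_ : meanGT T ubar \- GT u = (meanGT T ubar \- GT v) \+ GT (diff v)).
    by apply: L2norm_triangle => //; exact: L2B.
  by apply/funext => x /=; rewrite GT_comb; ring.
have e3 := discrete_poincare_L2norm bO oO O0 Xw.
have e4 := normT_diff_le Xv.
(* The weight [1/diam] in [deltaT] absorbs the Poincare constant, so [diff v] costs its norm once in
   each part of [deltaT]. *)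
have {}e1 : (diam Omega)^-1 * L2norm Omega (ubar \- fun_of u) <=
    (diam Omega)^-1 * L2norm Omega (ubar \- fun_of v) + normT (diff v).
  rewrite -[X in _ + X](mulKf (lt0r_neq0 D0)) -mulrDr ler_wpM2l ?invr_ge0 ?(ltW D0)//.
  by rewrite (le_trans e1)// lerD2l.
have {}e2 : flux_err u <= flux_err v + normT (diff v).
  by rewrite normTE /flux_err -mulrDr ler_wpM2l ?sqrtr_ge0.
have e5 : 0 <= (diam Omega)^-1 * L2norm Omega (ubar \- fun_of v).
  by rewrite mulr_ge0 ?L2norm_ge0// invr_ge0 ltW.
have := flux_err_ge0 v; rewrite /deltaT -!/(flux_err _).
move: e1 e2 e4 e5; move: (flux_err u) (flux_err v) (normT _) => a b c.
move: (_^-1 * _) (_^-1 * _) => p q; lra.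
Qed.

Lemma deltaT_ge0 v : 0 <= deltaT ubar v.
Proof.
have D0 := ltW (diam_gt0 bO ord0 oO O0).
by rewrite addr_ge0// mulr_ge0 ?L2norm_ge0 ?sqrtr_ge0 ?invr_ge0.
Qed.

Lemma flux_err_le_deltaT v : flux_err v <= deltaT ubar v.
Proof.
have D0 := ltW (diam_gt0 bO ord0 oO O0).
by rewrite /deltaT lerDr mulr_ge0 ?L2norm_ge0 ?invr_ge0.
Qed.

Lemma scheme_error_bounds :
  [/\ Hdiv Omega flux,
      {ae mu, forall x, Omega x -> - wdiv Omega flux x = f x},
      2^-1 * (zeta + interpT T ubar) <= deltaT ubar u &
      deltaT ubar u <= 3 * (zeta + interpT T ubar)].
Proof.
split; first exact: flux_Hdiv.
- by apply: filterS wdiv_flux => x h /h ->; rewrite opprK.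
(* [zeta] and the interpolation error are each at most [deltaT ubar u]; the factor one half comes
   from averaging. *)
- have : interpT T ubar <= deltaT ubar u.
    by apply: ge_inf; [exists 0 => _ [v _ <-]; exact: deltaT_ge0|exists u].
  have := le_trans zetaT_le_flux_err (flux_err_le_deltaT u); lra.
(* The bound holds for every [v], so it passes to the infimum; [2 * zeta] is then enlarged to
   [3 * zeta] since [zeta] is nonnegative. *)
- have : (deltaT ubar u - 2 * zeta) / 3 <= interpT T ubar.
    apply: lb_le_inf; first by exists (deltaT ubar u), u.
    by move=> _ [v Xv <-]; have := deltaT_le Xv; lra.
  have := zetaT_ge0; lra.
Qed.

End finite_volume_scheme.

(** The first two conjuncts guarantee that [wdiv Omega flux], selected by [xget], is a genuine weak
    divergence and not the default value, so that [zetaT T flux] is the intended quantity. *)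
Theorem theorem3p1 (R : realType) (d : nat) (hd : d = 2%N \/ d = 3%N)
  (Omega : set 'rV[R]_d) (hOmega : polytopal_domain Omega)
  (f : 'rV[R]_d -> R) (hf : L2 Omega f)
  (F : 'rV[R]_d -> 'rV[R]_d) (hF : L2v Omega F)
  (ubar : 'rV[R]_d -> R) (hubar : H10 Omega ubar)
  (weak_form : forall phi, H10 Omega phi ->
    \int[leb R d]_(x in Omega) dotv (wgrad Omega ubar x) (wgrad Omega phi x) =
    \int[leb R d]_(x in Omega) (f x * phi x - dotv (F x) (wgrad Omega phi x)))
  (T : admissible_mesh Omega) (u : dofs T) (hu : XT u)
  (scheme : forall v : dofs T, XT v ->
    d%:R * \int[leb R d]_(x in Omega) (GT u x * GT v x) =
    \int[leb R d]_(x in Omega) (f x * fun_of v x - dotv (F x) (gradT v x))) :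
  let flux : 'rV[R]_d -> 'rV[R]_d := wgrad Omega ubar \+ F in
  [/\ Hdiv Omega flux,
      {ae leb R d, forall x, Omega x -> - wdiv Omega flux x = f x},
      2^-1 * (zetaT T flux + interpT T ubar) <= deltaT ubar u &
      deltaT ubar u <= 3 * (zetaT T flux + interpT T ubar)].
Proof.
case: hOmega => bO oO O0 _.
by case: hd => ?; subst d; exact: (scheme_error_bounds bO oO O0 hf hF hubar weak_form hu scheme).
Qed.
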